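(* Let $\mathcal{G}_{10},\mathcal{G}_9,\mathcal{G}_8$ be the punctured ternary Golay codes and $\mathcal{G}_{10}^\perp,\mathcal{G}_9^\perp,\mathcal{G}_8^\perp$ their duals, as in the context, and for $m\ge1$ let $\mathcal{G}_{n,m}$, $\mathcal{G}_{n,m}^\perp$ ($n=10,9,8$) be the corresponding $m$-lifted codes over $\mathbb{F}_{3^m}$ ($\mathcal{G}_{n,1}=\mathcal{G}_n$, $\mathcal{G}_{n,1}^\perp=\mathcal{G}_n^\perp$). Then: (i) The following codes are all UPWS and NMDS: family $\mathcal{D}_3$: $\mathcal{G}_{10,1}=[10,6,4]_32$ and $\mathcal{G}_{10,m}=[10,6,4]_{3^m}4$ for all $m\ge3$; family $\mathcal{D}_4$: $\mathcal{G}_{9,1}=[9,6,3]_32$ and $\mathcal{G}_{9,m}=[9,6,3]_{3^m}3$ for all $m\ge2$; family $\mathcal{D}_5$: $\mathcal{G}_{8,1}=[8,6,2]_31$ and $\mathcal{G}_{8,m}=[8,6,2]_{3^m}2$ for all $m\ge2$ (the last number in each parameter list being the covering radius). (ii) All codes of the family $\mathcal{D}_5$ are completely regular NMDS codes; the code $\mathcal{G}_{9,1}=[9,6,3]_32$ is a completely regular NMDS code; the code $\mathcal{G}_{10}^\perp=[10,4,6]_35$ is $2$-regular. (iii) The following NMDS codes are not UPWS: $\mathcal{G}_{10,1}^\perp=[10,4,6]_35$ and $\mathcal{G}_{10,m}^\perp=[10,4,6]_{3^m}6$ for $m\ge2$; $\mathcal{G}_{9,1}^\perp=[9,3,6]_35$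 and $\mathcal{G}_{9,m}^\perp=[9,3,6]_{3^m}6$ for $m\ge2$; $\mathcal{G}_{8,1}^\perp=[8,2,6]_35$ and $\mathcal{G}_{8,m}^\perp=[8,2,6]_{3^m}6$ for $m\ge2$; and $\mathcal{G}_{10,2}=[10,6,4]_{3^2}3$. (iv) For every $m\ge1$, the codes $\mathcal{G}_{10,m}^\perp=[10,4,6]_{3^m}$, $\mathcal{G}_{9,m}^\perp=[9,3,6]_{3^m}$, $\mathcal{G}_{8,m}^\perp=[8,2,6]_{3^m}$ have the maximum possible number (for NMDS codes) of codewords of minimum weight $6$, namely $A^{\max}_6(10,4,3^m)$, $A^{\max}_6(9,3,3^m)$, $A^{\max}_6(8,2,3^m)$ respectively. Also, the punctured Golay codes $\mathcal{G}_{10}=[10,6,4]_3$, $\mathcal{G}_9=[9,6,3]_3$, $\mathcal{G}_8=[8,6,2]_3$ have the minimal possible number (among all codes with the same length, dimension and minimum distance) of codewords of their minimum weight $d=4,3,2$ respectively. (v) For every $m\ge1$, the codes $\mathcal{G}_{10,m}^\perp$, $\mathcal{G}_{9,m}^\perp$, $\mathcal{G}_{8,m}^\perp$ have no codewords of weight $7$.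
   Context: $\mathbb{F}_q$ is the field with $q$ elements. An $[n,k,d]_qR$ code is a $k$-dimensional linear subspace of $\mathbb{F}_q^n$ with minimum Hamming distance $d$ and covering radius $R$ (the least integer such that every vector of $\mathbb{F}_q^n$ is within Hamming distance $R$ of a codeword). $C^\perp$ is the dual code. $A_i(C)$ is the number of codewords of weight $i$. For a linear code $C$ over $\mathbb{F}_q$ with parity check matrix $H$ and $m\ge1$, the $m$-lifted code $C_m$ is the linear code over $\mathbb{F}_{q^m}$ with the same parity check matrix, $C_m=\{x\in\mathbb{F}_{q^m}^n: Hx^T=0\}$ (the $\mathbb{F}_{q^m}$-span of $C$); it has the same length, dimension and minimum distance. A linear $[n,k,d]_q$ code is near-MDS (NMDS) if $d=n-k$ and $d(C)+d(C^\perp)=n$. For NMDS $[n,k,d]_q$ codes, $A_d(C)\le A^{\max}_d(n,k,q):=\binom{n}{k-1}\frac{q-1}{k}$. $B_j(v,C)$ is the number of codewords at distance $j$ from $v$. A code with covering radius $R$ is UPWS (uniformly packed in the wide sense) if there exist rationals $\beta_0,\dots,\beta_R$ with $\sum_{j=0}^R\beta_jB_j(v,C)=1$ for all $v$. A code with covering radius $R$ is $t$-regular ($0\le t\le R$) if for all $v$ with $d(v,C)\le t$ and all $j=0,\dots,R$, $B_j(v,C)$ depends only on $j$ and $d(v,C)$; it is completely regular if it is $R$-regular. $\mathcal{G}_{11}$ is the ternary $[11,6,5]_3$ Golay code with generator matrix $[I_6\mid M_{11}]$, $M_{11}=\begin{pmatrix}2&2&2&2&2\\2&2&1&1&0\\2&1&2&0&1\\1&2&0&2&1\\1&0&2&1&2\\0&1&1&2&2\end{pmatrix}$.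 $\mathcal{G}_{10}$, $\mathcal{G}_9$, $\mathcal{G}_8$ are obtained from $\mathcal{G}_{11}$ by deleting coordinate $11$, coordinates $\{10,11\}$, and coordinates $\{9,10,11\}$ respectively (i.e. generator matrices $[I_6\mid M]$ with $M$ the first $4$, $3$, $2$ columns of $M_{11}$); $\mathcal{G}_n^\perp$ is the dual of $\mathcal{G}_n$. *)

(* Defs.v *)
From HB Require Import structures.
From mathcomp Require Import all_boot all_order all_algebra all_field.
Set Implicit Arguments.
Unset Strict Implicit.
Unset Printing Implicit Defensive.
Import Order.TTheory GRing.Theory Num.Theory.
Local Open Scope ring_scope.

(* A linear code of length n over F is a subspace of 'rV[F]_n. *)

Section LinearCodes.
Variable F : fieldType.

Definition code_of_gen (k n : nat) (G : 'M[F]_(k, n)) : {vspace 'rV[F]_n} :=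
  limg (linfun (mulmxr G : 'rV[F]_k -> 'rV[F]_n)).

(* x *m H^T = 0 is the transpose of the parity checks H *m x^T = 0. *)
Definition code_of_pcm (r n : nat) (H : 'M[F]_(r, n)) : {vspace 'rV[F]_n} :=
  lker (linfun (mulmxr H^T : 'rV[F]_n -> 'rV[F]_r)).

Definition gen_mx (n : nat) (C : {vspace 'rV[F]_n}) : 'M[F]_(\dim C, n) :=
  \matrix_i tnth (vbasis C) i.

Definition dual_code (n : nat) (C : {vspace 'rV[F]_n}) : {vspace 'rV[F]_n} :=
  code_of_pcm (gen_mx C).

Definition parity_check_mx (n : nat) (C : {vspace 'rV[F]_n}) :
    'M[F]_(\dim (dual_code C), n) :=
  gen_mx (dual_code C).

(* Deletes the coordinates of index at least n. *)
Definition puncture (n N : nat) (hn : (n <= N)%N) (C : {vspace 'rV[F]_N}) :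
    {vspace 'rV[F]_n} :=
  (linfun (mxsub id (widen_ord hn) : 'rV[F]_N -> 'rV[F]_n) @: C)%VS.

Lemma mem_code_of_gen k n (G : 'M[F]_(k, n)) x :
  reflect (exists u : 'rV[F]_k, x = u *m G) (x \in code_of_gen G).
Proof.
apply: (iffP memv_imgP) => [[u _ ->]|[u ->]]; exists u; rewrite ?lfunE //=.
by rewrite memvf.
Qed.

Lemma mem_code_of_pcm r n (H : 'M[F]_(r, n)) x :
  (x \in code_of_pcm H) = (H *m x^T == 0).
Proof. by rewrite memv_ker lfunE /= -trmx_eq0 trmx_mul trmxK. Qed.

Lemma row_gen_mx_mem n (C : {vspace 'rV[F]_n}) i : row i (gen_mx C) \in C.
Proof. by rewrite rowK vbasis_mem // mem_tnth. Qed.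

Lemma code_of_gen_mx n (C : {vspace 'rV[F]_n}) : code_of_gen (gen_mx C) = C.
Proof.
apply/vspaceP => x; apply/mem_code_of_gen/idP => [[u ->]|Cx].
  by rewrite mulmx_sum_row memv_suml // => i _; rewrite memvZ ?row_gen_mx_mem.
exists (\row_i coord (vbasis C) i x); rewrite mulmx_sum_row.
rewrite {1}(coord_vbasis Cx); apply: eq_bigr => i _.
by rewrite mxE rowK (tnth_nth 0).
Qed.

Lemma mem_dual_code n (C : {vspace 'rV[F]_n}) x :
  reflect (forall c, c \in C -> c *m x^T = 0) (x \in dual_code C).
Proof.
rewrite mem_code_of_pcm; apply: (iffP eqP) => [Hx c|Hx].
  rewrite -{1}(code_of_gen_mx C) => /mem_code_of_gen[u ->].
  by rewrite -mulmxA Hx mulmx0.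
by apply/row_matrixP => i; rewrite row_mul Hx ?row_gen_mx_mem // row0.
Qed.

Lemma dual_code_of_gen k n (G : 'M[F]_(k, n)) :
  dual_code (code_of_gen G) = code_of_pcm G.
Proof.
apply/vspaceP => x; rewrite mem_code_of_pcm.
apply/mem_dual_code/eqP => [Hx|Gx c /mem_code_of_gen[u ->]].
  apply/row_matrixP => i; rewrite row_mul row0 Hx //.
  by apply/mem_code_of_gen; exists (delta_mx 0 i); rewrite rowE.
by rewrite -mulmxA Gx mulmx0.
Qed.

Lemma puncture_code_of_gen k n N (hn : (n <= N)%N) (G : 'M[F]_(k, N)) :
  puncture hn (code_of_gen G) = code_of_gen (mxsub id (widen_ord hn) G).
Proof.
apply/vspaceP => x; apply/memv_imgP/mem_code_of_gen.
  case=> _ /mem_code_of_gen[u ->] ->; exists u.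
  rewrite lfunE /=; apply/matrixP => i j; rewrite !mxE.
  by apply: eq_bigr => l _; rewrite !mxE.
case=> u ->; exists (u *m G); first by apply/mem_code_of_gen; exists u.
rewrite lfunE /=; apply/matrixP => i j; rewrite !mxE.
by apply: eq_bigr => l _; rewrite !mxE.
Qed.

Lemma mem_code_of_gen_sub k n (G : 'M[F]_(k, n)) x :
  (x \in code_of_gen G) = (x <= G)%MS.
Proof.
by apply/mem_code_of_gen/submxP => -[u ->]; exists u.
Qed.

Lemma mem_code_of_pcm_sub r n (H : 'M[F]_(r, n)) x :
  (x \in code_of_pcm H) = (x <= kermx H^T)%MS.
Proof. by rewrite sub_kermx mem_code_of_pcm -trmx_eq0 trmx_mul trmxK. Qed.

Lemma gen_mx_code_of_pcm r n (H : 'M[F]_(r, n)) :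
  (gen_mx (code_of_pcm H) :=: kermx H^T)%MS.
Proof.
apply/eqmxP/rV_eqP => x.
by rewrite -mem_code_of_gen_sub code_of_gen_mx mem_code_of_pcm_sub.
Qed.

Lemma gen_mx_code_of_gen k n (G : 'M[F]_(k, n)) :
  (gen_mx (code_of_gen G) :=: G)%MS.
Proof.
apply/eqmxP/rV_eqP => x.
by rewrite -mem_code_of_gen_sub code_of_gen_mx mem_code_of_gen_sub.
Qed.

Lemma eqmx_code_of_pcm r1 r2 n (H1 : 'M[F]_(r1, n)) (H2 : 'M[F]_(r2, n)) :
  (H1 :=: H2)%MS -> code_of_pcm H1 = code_of_pcm H2.
Proof.
move=> eqH; apply/vspaceP => x.
by rewrite !mem_code_of_pcm -!sub_kermx eqH.
Qed.

Lemma parity_check_mx_code_of_pcm r n (H : 'M[F]_(r, n)) :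
  (parity_check_mx (code_of_pcm H) :=: H)%MS.
Proof.
apply: eqmx_trans (gen_mx_code_of_pcm _) _.
set G := gen_mx _; have GE : (G :=: kermx H^T)%MS := gen_mx_code_of_pcm H.
apply: eqmx_sym; apply/eqmxP; rewrite -mxrank_leqif_eq.
  rewrite !mxrank_ker !mxrank_tr GE mxrank_ker mxrank_tr.
  by rewrite subKn // rank_leq_col.
have /sub_kermxP GH : (G <= kermx H^T)%MS by rewrite GE.
by apply/sub_kermxP/trmx_inj; rewrite trmx_mul trmxK GH trmx0.
Qed.

Lemma parity_check_mxK n (C : {vspace 'rV[F]_n}) :
  code_of_pcm (parity_check_mx C) = C.
Proof.
rewrite -[in RHS](code_of_gen_mx C).
apply/vspaceP => x; rewrite mem_code_of_pcm_sub mem_code_of_gen_sub.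
suff E : (kermx (parity_check_mx C)^T :=: gen_mx C)%MS by rewrite E.
apply: eqmx_trans (eqmx_sym (gen_mx_code_of_pcm (parity_check_mx C))) _.
exact: parity_check_mx_code_of_pcm (gen_mx C).
Qed.

End LinearCodes.

Section Lifting.
Variables (K L : fieldType) (iota : {rmorphism K -> L}).

Definition lift_code (n : nat) (C : {vspace 'rV[K]_n}) : {vspace 'rV[L]_n} :=
  code_of_pcm (map_mx iota (parity_check_mx C)).

(* The lift does not depend on the parity check matrix. *)
Lemma lift_code_of_pcm r n (H : 'M[K]_(r, n)) :
  lift_code (code_of_pcm H) = code_of_pcm (map_mx iota H).
Proof.
apply: eqmx_code_of_pcm; apply/map_eqmx.
exact: parity_check_mx_code_of_pcm.
Qed.

(* The lift is the span over L of the original code. *)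
Lemma lift_code_of_gen k n (G : 'M[K]_(k, n)) :
  lift_code (code_of_gen G) = code_of_gen (map_mx iota G).
Proof.
rewrite -{1}(parity_check_mxK (code_of_gen G)) lift_code_of_pcm.
apply/vspaceP => x; rewrite mem_code_of_pcm_sub mem_code_of_gen_sub.
rewrite matrix.map_trmx -map_kermx.
set P := parity_check_mx _.
have kerP : (kermx P^T :=: G)%MS.
  apply: eqmx_trans (eqmx_sym (gen_mx_code_of_pcm P)) _.
  by rewrite (parity_check_mxK (code_of_gen G)); exact: gen_mx_code_of_gen.
by have /map_eqmx -> := kerP.
Qed.

End Lifting.

Lemma lift_code_id (F : fieldType) n (C : {vspace 'rV[F]_n}) :
  lift_code (@idfun F) C = C.
Proof.
rewrite /lift_code; set P := parity_check_mx C.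
have -> : map_mx (@idfun F) P = P by apply/matrixP => i j; rewrite mxE.
exact: parity_check_mxK.
Qed.

Section Weights.
Variables (F : finFieldType) (n : nat).
Implicit Types (C : {vspace 'rV[F]_n}) (x y v c : 'rV[F]_n).

Definition wt x : nat := #|[set i | x 0 i != 0]|.

Definition hdist x y : nat := #|[set i | x 0 i != y 0 i]|.

Definition nb_wt C (i : nat) : nat := #|[set c in C | wt c == i]|.

Definition nb_at C v (j : nat) : nat := #|[set c in C | hdist v c == j]|.

(* Equal to n.+1 exactly for the zero code, which has no minimum distance. *)
Definition min_dist C : nat :=
  \big[minn/n.+1]_(p : 'rV[F]_n * 'rV[F]_n |
      [&& p.1 \in C, p.2 \in C & p.1 != p.2]) hdist p.1 p.2.

(* The default value n is harmless: 0 is a codeword and hdist v 0 <= n. *)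
Definition dist_to C v : nat := \big[minn/n]_(c in C) hdist v c.

Definition covers C (r : nat) : bool :=
  [forall v : 'rV[F]_n, [exists c in C, (hdist v c <= r)%N]].

Lemma covers_exists C : exists r, covers C r.
Proof.
exists n; apply/forallP => v; apply/existsP; exists 0.
by rewrite mem0v /= -[X in (_ <= X)%N]card_ord max_card.
Qed.

Definition covering_radius C : nat := ex_minn (covers_exists C).

Definition code_params C (k d R : nat) : Prop :=
  [/\ \dim C = k, min_dist C = d & covering_radius C = R].

Definition NMDS C : Prop :=
  min_dist C = (n - \dim C)%N /\ (min_dist C + min_dist (dual_code C) = n)%N.

Definition UPWS C : Prop :=
  exists beta : 'I_(covering_radius C).+1 -> rat,
    forall v, \sum_j beta j * (nb_at C v j)%:R = 1.

Definition t_regular C (t : nat) : Prop :=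
  (t <= covering_radius C)%N /\
  forall v w, (dist_to C v <= t)%N -> dist_to C w = dist_to C v ->
    forall j, (j <= covering_radius C)%N -> nb_at C v j = nb_at C w j.

Definition completely_regular C : Prop := t_regular C (covering_radius C).

End Weights.

Definition Amax (n k q : nat) : rat :=
  'C(n, k.-1)%:R * ((q%:R - 1) / k%:R).

Definition M11 : 'M['F_3]_(6, 5) :=
  \matrix_(i, j) (nth 0%N (nth [::]
    [:: [:: 2; 2; 2; 2; 2];
        [:: 2; 2; 1; 1; 0];
        [:: 2; 1; 2; 0; 1];
        [:: 1; 2; 0; 2; 1];
        [:: 1; 0; 2; 1; 2];
        [:: 0; 1; 1; 2; 2]]%N i) j)%:R.

Definition G11 : {vspace 'rV['F_3]_11} := code_of_gen (row_mx 1%:M M11).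
Definition G10 : {vspace 'rV['F_3]_10} := puncture (isT : (10 <= 11)%N) G11.
Definition G9 : {vspace 'rV['F_3]_9} := puncture (isT : (9 <= 11)%N) G11.
Definition G8 : {vspace 'rV['F_3]_8} := puncture (isT : (8 <= 11)%N) G11.

(* Main.v *)
Require Import Defs.
From mathcomp Require Import all_boot all_order all_algebra all_field all_character zify ring.
Set Implicit Arguments.
Unset Strict Implicit.
Unset Printing Implicit Defensive.
Import Order.TTheory GRing.Theory Num.Theory.
Local Open Scope ring_scope.

(* Write D for the [n, kappa, 6] dual code and A for the punctured Golay code, with P a generator
   matrix of D.  Over F_3 the nonzero words of D have weights 6 and 9 only, and this makes the
   dependent kappa-sets of columns of P the blocks of a Steiner system S(kappa - 1, kappa, n).
   Ranks of column sets do not change under lifting, so the same system governs all the lifts.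

   For a vector v let S_i(v) be the number of pairs (U, c), U an i-set of coordinates and c a codeword
   agreeing with v outside U; these numbers determine the B_j(v) triangularly.  For the lift of A,
   S_kappa(v) is the number of non-blocks plus q times the number of blocks whose column span contains
   the syndrome of v, while S_(kappa-1)(v) is kappa times the latter number: eliminating it gives the
   UPWS relation.  For the lift of D an analogous count shows that a UPWS relation is impossible as
   soon as certain vectors w1, w2, w3 exist.  All the vectors used are combinations of vectors over
   F_3 with F_3-independent coefficients, and such a combination solves a system over F_3 iff each
   component does, so what remains is a finite computation over F_3, independent of the field. *)

(** * Hamming distance and agreement counts *)

(** The elimination behind the UPWS relation uses S_kappa, so it is available only when the lift of
    A has covering radius kappa. This is where m enters: some syndrome must lie outside the span of
    every block, which takes two components over F_3 for kappa = 2, 3 and three for kappa = 4. Over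
    smaller fields the radius drops. Over F_3 the possible values of (S_0, ..., S_r) are tabulated
    and a relation is solved from the table; for kappa = 4 over F_9 the radius is 3, and S_3 takes
    two values on the vectors at distance 3, which excludes any relation. Geometrically the columns
    of P are the ten points of an elliptic quadric in PG(3,3) (no three collinear), the nine points
    of PG(2,3) off a line, and the four points of PG(1,3) taken twice each; the blocks are the plane
    sections, the affine lines and the repeated points. The lower bounds on the number of minimum
    weight words are independent of all this: they come from inequalities between the B_j(v), summed
    over v, that are sharp at every v for the Golay code. *)

Section Hamming.
Variables (F : finFieldType) (n : nat).
Implicit Types (C : {vspace 'rV[F]_n}) (x y v c : 'rV[F]_n) (T : {set 'I_n}).

Lemma hdistE v c : hdist v c = wt (v - c).
Proof. by apply: eq_card => i; rewrite !inE !mxE subr_eq0. Qed.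

Lemma hdistC v c : hdist v c = hdist c v.
Proof. by apply: eq_card => i; rewrite !inE eq_sym. Qed.

Lemma hdist_le v c : (hdist v c <= n)%N.
Proof. by rewrite -[X in (_ <= X)%N]card_ord max_card. Qed.

Lemma wt_le x : (wt x <= n)%N.
Proof. by rewrite -[X in (_ <= X)%N]card_ord max_card. Qed.

Lemma wt_eq0 x : (wt x == 0%N) = (x == 0).
Proof.
rewrite cards_eq0; apply/eqP/eqP => [x0|->].
  apply/rowP => i; rewrite mxE; apply/eqP.
  by have := in_set0 i; rewrite -x0 inE => /negbFE.
by apply/setP => i; rewrite !inE mxE eqxx.
Qed.

Lemma wt0 : wt (0 : 'rV[F]_n) = 0%N.
Proof. by apply/eqP; rewrite wt_eq0. Qed.

Lemma wtN x : wt (- x) = wt x.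
Proof. by apply: eq_card => i; rewrite !inE mxE oppr_eq0. Qed.

Lemma wtD x y : (wt (x + y) <= wt x + wt y)%N.
Proof.
rewrite -cardsUI; apply: leq_trans (leq_addr _ _); apply/subset_leq_card.
apply/subsetP => i; rewrite !inE mxE; apply: contraR.
by rewrite negb_or !negbK => /andP[/eqP-> /eqP->]; rewrite addr0.
Qed.

Lemma hdist_triangle v c c' : (wt (c - c') <= hdist v c + hdist v c')%N.
Proof.
rewrite (hdistC v c) !hdistE; have -> : c - c' = (c - v) + (v - c').
  by rewrite addrA subrK.
exact: wtD.
Qed.

Lemma wt_mask x : (#|[set i | x ord0 i == 0%R]| + wt x = n)%N.
Proof.
rewrite /wt -[RHS]card_ord -(cardsC [set i | x 0 i == 0]); congr addn.
by apply: eq_card => i; rewrite !inE.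
Qed.

Lemma bigmin_attained (I : finType) (P : pred I) (f : I -> nat) d (x0 : nat) :
  (exists2 i, P i & f i = d) -> (forall i, P i -> d <= f i)%N -> (d <= x0)%N ->
  \big[minn/x0]_(i | P i) f i = d.
Proof.
move=> [i Pi <-] lef lex0; apply/eqP; rewrite eqn_leq; apply/andP; split.
  rewrite -big_filter.
  have : i \in [seq i <- index_enum I | P i].
    by rewrite mem_filter Pi mem_index_enum.
  elim: [seq _ <- _ | _] => // j s IH; rewrite inE big_cons geq_min.
  by case/orP => [/eqP<-|/IH->]; rewrite ?leqnn ?orbT.
by elim/big_rec: _ => // j m /lef Hj Hm; rewrite leq_min Hj.
Qed.

(** The strict bound [d < x0] excludes the case in which the operator returns its default [x0], as
    it does on an empty range. *)
Lemma bigmin_witness (I : finType) (P : pred I) (f : I -> nat) d (x0 : nat) :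
  \big[minn/x0]_(i | P i) f i = d -> (d < x0)%N ->
  (exists2 i, P i & f i = d) /\ (forall i, P i -> d <= f i)%N.
Proof.
move=> <- ltx0; split; last first.
  move=> i Pi; rewrite -big_filter.
  have : i \in [seq i <- index_enum I | P i].
    by rewrite mem_filter Pi mem_index_enum.
  elim: [seq _ <- _ | _] => // j s IH; rewrite inE big_cons geq_min.
  by case/orP => [/eqP<-|/IH->]; rewrite ?leqnn ?orbT.
have : \big[minn/x0]_(i | P i) f i = x0 \/
       exists2 i, P i & f i = \big[minn/x0]_(i | P i) f i.
  elim/big_rec: _ => [|j m Pj [->|[i Pi <-]]]; first by left.
    by rewrite /minn; case: ifP => _; [right; exists j | left].
  by rewrite /minn; case: ifP => _; right; [exists j | exists i].
by case=> // x0E; move: ltx0; rewrite {1}x0E ltnn.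
Qed.

Lemma min_distP C d :
  (exists c, [/\ c \in C, c != 0 & wt c = d]) ->
  (forall c, c \in C -> c != 0 -> (d <= wt c)%N) -> min_dist C = d.
Proof.
move=> [c [Cc c0 wc]] led; apply: bigmin_attained.
- by exists (c, 0); rewrite /= ?Cc ?mem0v ?c0 // hdistE subr0.
- move=> [x y] /= /and3P[Cx Cy neq]; rewrite hdistE led ?rpredB //.
  by rewrite subr_eq0.
- by rewrite -wc ltnW // ltnS wt_le.
Qed.

Lemma min_dist_wt C d :
  min_dist C = d -> (d <= n)%N ->
  (exists c, [/\ c \in C, c != 0 & wt c = d]) /\
  (forall c, c \in C -> c != 0 -> (d <= wt c)%N).
Proof.
move=> dE len; have [] := bigmin_witness dE; first by rewrite ltnS.
move=> [[x y] /= /and3P[Cx Cy neq] xyd] led; split.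
  by exists (x - y); rewrite rpredB ?subr_eq0 // -hdistE.
move=> c Cc c0; have := led (c, 0); rewrite /= Cc mem0v c0 hdistE subr0.
exact.
Qed.

Lemma dist_to_le C v c : c \in C -> (dist_to C v <= hdist v c)%N.
Proof.
move=> Cc; rewrite /dist_to -big_filter.
have : c \in [seq c <- index_enum 'rV[F]_n | c \in C].
  by rewrite mem_filter Cc mem_index_enum.
elim: [seq _ <- _ | _] => // j s IH; rewrite inE big_cons geq_min.
by case/orP => [/eqP<-|/IH->]; rewrite ?leqnn ?orbT.
Qed.

Lemma dist_to_attained C v : exists2 c, c \in C & hdist v c = dist_to C v.
Proof.
(* A minimum equal to the default [n] is attained by the codeword 0, since no distance exceeds
   [n]. *)
have [dn|ltn] := eqVneq (dist_to C v) n.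
  by exists 0; rewrite ?mem0v //; apply/eqP; rewrite eqn_leq dist_to_le ?mem0v // dn hdist_le.
have : (dist_to C v < n)%N.
  rewrite ltn_neqAle ltn; exact: leq_trans (dist_to_le v (mem0v C)) (hdist_le _ _).
by case/(bigmin_witness (erefl _)).
Qed.

Lemma covering_radiusP C r :
  (forall v, exists2 c, c \in C & (hdist v c <= r)%N) ->
  (exists v, forall c, c \in C -> (r <= hdist v c)%N) -> covering_radius C = r.
Proof.
move=> cov [v far]; rewrite /covering_radius; case: ex_minnP => m covm minm.
apply/eqP; rewrite eqn_leq minm /=; last first.
  apply/forallP => w; have [c Cc le] := cov w; apply/existsP.
  by exists c; rewrite Cc.
have /existsP[c /andP[Cc le]] := forallP covm v.
exact: leq_trans (far c Cc) le.
Qed.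

(* [agree_sum C i v] is S_i(v). *)
Definition agree C T v : nat :=
  #|[set c in C | [forall i in T, v 0 i == c 0 i]]|.

Definition agree_sum C (i : nat) v : nat :=
  (\sum_(T : {set 'I_n} | #|~: T| == i) agree C T v)%N.

Lemma agreeP C T v :
  reflect (exists2 c, c \in C & forall i, i \in T -> v 0 i = c 0 i)
          (agree C T v != 0%N).
Proof.
rewrite -lt0n; apply: (iffP card_gt0P) => -[c].
  rewrite inE => /andP[Cc /forall_inP vc]; exists c => // i /vc /eqP //.
move=> Cc vc; exists c; rewrite inE Cc; apply/forall_inP => i /vc->.
exact: eqxx.
Qed.

(** Double counting of the pairs (T, c): a codeword at distance j from [v] agrees with it on n - j
    coordinates, and T is any subset of these with n - i elements. *)
Lemma agree_sumE C i v : (i <= n)%N ->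
  agree_sum C i v = (\sum_(j < n.+1) nb_at C v j * 'C(n - j, n - i))%N.
Proof.
move=> lein.
have -> : agree_sum C i v =
    (\sum_(c in C) #|[set T : {set 'I_n} | T \subset [set i | (v 0 i == c 0 i)%R] & #|T| == (n - i)%N]|)%N.
  transitivity (\sum_(T : {set 'I_n} | #|~: T| == i)
      \sum_(c in C) (nat_of_bool [forall k in T, v ord0 k == c ord0 k]))%N.
    apply: eq_bigr => T _; rewrite /agree -sum1_card big_mkcond [RHS]big_mkcond.
    by apply: eq_bigr => c _; rewrite inE; case: (c \in C) => //=; case: ifP.
  rewrite exchange_big /=; apply: eq_bigr => c _.
  rewrite -sum1_card big_mkcond [RHS]big_mkcond; apply: eq_bigr => T _.
  rewrite inE; have -> : (T \subset [set k | v ord0 k == c ord0 k]) =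
      [forall k in T, v 0 k == c 0 k].
    apply/idP/forall_inP => [/subsetP H j /H|H]; first by rewrite inE.
    by apply/subsetP => j /H; rewrite inE.
  have -> : (#|T| == (n - i)%N) = (#|~: T| == i).
    have := cardsC T; rewrite card_ord; move: #|T| #|~: T| lein => a b.
    by move=> lein abn; apply/eqP/eqP; lia.
  by case: ([forall k in T, v 0 k == c 0 k]); case: ifP.
rewrite (partition_big (fun c => inord (hdist v c) : 'I_n.+1) xpredT) //=.
apply: eq_bigr => j _.
have hE c : (inord (hdist v c) == j) = (hdist v c == j :> nat).
  by rewrite -val_eqE /= inordK // ltnS hdist_le.
under eq_bigl => c do rewrite hE.
rewrite (eq_bigr (fun=> 'C(n - j, n - i))) => [|c /andP[_ /eqP<-]].
  rewrite sum_nat_const; congr muln.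
  by apply: eq_card => c; rewrite !inE.
rewrite cards_draws; congr 'C(_, _).
have : (#|[set i | v ord0 i == c ord0 i]| + hdist v c = n)%N.
  rewrite /hdist -[RHS]card_ord -(cardsC [set i | v ord0 i == c ord0 i]).
  by congr addn; apply: eq_card => k; rewrite !inE.
by move: #|_| (hdist v c) => a b <-; rewrite addnK.
Qed.

End Hamming.

(** * Coordinate masks and ranks of column sets *)

Section Masks.
Variables (F : fieldType) (n : nat).
Implicit Types (T U : {set 'I_n}).

(** A submatrix on the columns in [T] would have a width depending on the size of [T]; zeroing the
    other columns keeps the width [n] and gives the same rank. *)
Definition mask_mx T : 'M[F]_n := diag_mx (\row_i (i \in T)%:R).

Lemma mul_mask_mxE m (A : 'M[F]_(m, n)) T i j :
  (A *m mask_mx T) i j = if j \in T then A i j else 0.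
Proof.
rewrite mul_mx_diag !mxE; case: ifP => _; by rewrite ?mulr1 ?mulr0.
Qed.

Lemma mask_mx_tr T : (mask_mx T)^T = mask_mx T.
Proof. by rewrite /mask_mx tr_diag_mx. Qed.

Lemma mul_mask_eq m (A B : 'M[F]_(m, n)) T :
  (forall i j, j \in T -> A i j = B i j) <-> A *m mask_mx T = B *m mask_mx T.
Proof.
split=> [AB|/matrixP AB i j Tj].
  by apply/matrixP => i j; rewrite !mul_mask_mxE; case: ifP => // /AB->.
by have := AB i j; rewrite !mul_mask_mxE Tj.
Qed.

Lemma sub_mask_mx (x : 'rV[F]_n) T :
  reflect (forall i, i \notin T -> x 0 i = 0) (x <= mask_mx T)%MS.
Proof.
apply: (iffP submxP) => [[y ->] i nTi|x0]; first by rewrite mul_mask_mxE (negbTE nTi).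
by exists x; apply/rowP => i; rewrite mul_mask_mxE; case: ifP => // /negbT/x0.
Qed.

(** The upper bound holds for every set, by a factorisation through as many dimensions as the set
    has elements. Applied to [T] and to its complement, whose masks add up to the identity, it
    becomes an equality. *)
Lemma mxrank_mask T : \rank (mask_mx T) = #|T|.
Proof.
have le U : (\rank (mask_mx U) <= #|U|)%N.
  pose A := \matrix_(i < n, l < #|U|) (i == enum_val l)%:R : 'M[F]_(n, #|U|).
  suff -> : mask_mx U = A *m A^T by apply: mulmx_max_rank.
  apply/matrixP => i j; rewrite !mxE.
  have [Ui|nUi] := boolP (i \in U); last first.
    rewrite mul0rn big1 // => l _; rewrite !mxE.
    by case: (eqVneq i) => [iE|]; rewrite ?mul0r //; rewrite iE enum_valP in nUi.
  rewrite (bigD1 (enum_rank_in Ui i)) //= big1 ?addr0 => [|l nl]; rewrite !mxE.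
    by rewrite enum_rankK_in // eqxx mul1r eq_sym.
  case: (eqVneq i) => [iE|]; rewrite ?mul0r //.
  by case/eqP: nl; apply: enum_val_inj; rewrite enum_rankK_in.
apply/eqP; rewrite eqn_leq le /= -(leq_add2r #|~: T|) cardsC card_ord.
rewrite -{1}(mxrank1 F n).
have -> : 1%:M = mask_mx T + mask_mx (~: T) :> 'M[F]_n.
  apply/matrixP => i j; rewrite !mxE inE; case: (i \in T); case: (i == j) => /=;
  by rewrite ?addr0 ?add0r ?mul0rn.
apply: leq_trans (mxrank_add _ _) _; exact: leq_add.
Qed.

Lemma mxrank_mul_mask m (A : 'M[F]_(m, n)) T :
  \rank (mask_mx T *m A^T) = \rank (A *m mask_mx T).
Proof. by rewrite -mxrank_tr trmx_mul trmxK mask_mx_tr. Qed.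

Lemma mxrank_mask_subset m (A : 'M[F]_(m, n)) T U :
  T \subset U -> (\rank (A *m mask_mx T) <= \rank (A *m mask_mx U))%N.
Proof.
move=> /subsetP TU; have -> : A *m mask_mx T = A *m mask_mx U *m mask_mx T.
  apply/matrixP => i j; rewrite !mul_mask_mxE; case: ifP => // /TU ->.
  by [].
exact: mxrankM_maxl.
Qed.

Lemma mask_mul_submx m (A : 'M[F]_(n, m)) T U :
  T \subset U -> (mask_mx T *m A <= mask_mx U *m A)%MS.
Proof.
move=> /subsetP TU; have -> : mask_mx T = mask_mx T *m mask_mx U.
  apply/matrixP => i j; rewrite !mul_mask_mxE; case: ifP => // /negP nUj.
  rewrite !mxE; case: eqVneq => // ->; case Tj: (j \in T); rewrite ?mul0rn //.
  by case: nUj; apply: TU.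
by rewrite -mulmxA submxMl.
Qed.

Lemma mxrank_mask_le m (A : 'M[F]_(m, n)) T : (\rank (A *m mask_mx T) <= #|T|)%N.
Proof. by rewrite -mxrank_mask mxrankM_maxr. Qed.

End Masks.

Lemma map_mask_mx (K L : fieldType) (iota : {rmorphism K -> L}) n (T : {set 'I_n}) :
  map_mx iota (mask_mx K T) = mask_mx L T.
Proof.
by apply/matrixP => i j; rewrite !mxE rmorphMn /= rmorph_nat.
Qed.

(** * Agreement counts as powers of the field size *)

Section Fibers.
Variable F : finFieldType.

(** A nonempty fibre is a coset of the intersection of the row space of [V] with the kernel of
    [A]. *)
Lemma card_fiber m n p (V : 'M[F]_(m, n)) (A : 'M[F]_(n, p)) (w : 'rV[F]_p) :
  #|[set x : 'rV[F]_n | (x <= V)%MS & x *m A == w]| =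
  if (w <= V *m A)%MS then (#|F| ^ (\rank V - \rank (V *m A)))%N else 0%N.
Proof.
case: ifPn => [/submxP[y wE]|nw]; last first.
  apply/eqP; rewrite cards_eq0; apply/eqP/setP => x; rewrite !inE.
  by apply: contraNF nw => /andP[xV /eqP<-]; apply: submxMr.
have -> : (\rank V - \rank (V *m A))%N = \rank (V :&: kermx A)%MS.
  by rewrite -(mxrank_mul_ker V A) addKn.
rewrite -card_rowg -[RHS](card_imset _ (addrI (y *m V))).
apply: eq_card => x; rewrite inE; apply/andP/imsetP => [[xV /eqP xA]|[z]].
  exists (x - y *m V); last by rewrite addrC subrK.
  rewrite mem_rowg sub_capmx addmx_sub ?eqmx_opp ?submxMl //=.
  by apply/sub_kermxP; rewrite mulmxBl xA wE mulmxA subrr.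
rewrite mem_rowg sub_capmx => /andP[zV /sub_kermxP zA] ->.
by rewrite addmx_sub ?submxMl // mulmxDl zA addr0 -mulmxA wE.
Qed.

Lemma agree_gen k n (P : 'M[F]_(k, n)) (T : {set 'I_n}) (v : 'rV[F]_n) :
  agree (code_of_gen P) T v =
  if (v *m mask_mx F T <= P *m mask_mx F T)%MS
  then (#|F| ^ (\rank P - \rank (P *m mask_mx F T)))%N else 0%N.
Proof.
rewrite -card_fiber; apply: eq_card => c.
rewrite !inE mem_code_of_gen_sub; congr (_ && _).
apply/forall_inP/eqP => [vc|/rowP vc i Ti]; last first.
  by have := vc i; rewrite !mul_mask_mxE Ti => ->.
by apply/rowP => i; rewrite !mul_mask_mxE; case: ifP => // /vc/eqP.
Qed.

(** The map c -> v - c turns the codewords agreeing with [v] on [T] into the vectors supported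
    outside [T] that have the same syndrome as [v], so the count is a fibre of the syndrome map on
    these vectors. *)
Lemma agree_pcm k n (P : 'M[F]_(k, n)) (T : {set 'I_n}) (v : 'rV[F]_n) :
  agree (code_of_pcm P) T v =
  if (v *m P^T <= mask_mx F (~: T) *m P^T)%MS
  then (#|F| ^ (#|~: T| - \rank (P *m mask_mx F (~: T))))%N else 0%N.
Proof.
rewrite -mxrank_mul_mask -{1}(mxrank_mask F (~: T)) -card_fiber.
have vK : involutive (fun x : 'rV[F]_n => v - x) by move=> x; rewrite subKr.
rewrite /agree -[LHS](card_imset _ (inv_inj vK)).
apply: eq_card => x; rewrite [RHS]inE; apply/imsetP/andP => [[c]|[xU /eqP xP]].
  rewrite inE => /andP[]; rewrite mem_code_of_pcm -trmx_eq0 trmx_mul trmxK.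
  move=> /eqP cP /forall_inP vc ->; split; last by rewrite mulmxBl cP subr0.
  by apply/sub_mask_mx => i; rewrite !inE negbK => /vc/eqP vci; rewrite !mxE vci subrr.
exists (v - x); last by rewrite vK.
rewrite inE mem_code_of_pcm -trmx_eq0 trmx_mul trmxK mulmxBl xP subrr eqxx.
apply/forall_inP => i Ti; rewrite !mxE (sub_mask_mx _ _ xU) ?subr0 //.
by rewrite inE negbK.
Qed.

End Fibers.

Lemma ex_subset (T : finType) (A : {set T}) m :
  (m <= #|A|)%N -> exists2 B : {set T}, B \subset A & #|B| = m.
Proof.
rewrite -bin_gt0 -cards_draws => /card_gt0P[B]; rewrite inE => /andP[BA /eqP].
by exists B.
Qed.

Section AgreeSum.
Variables (F : finFieldType) (n : nat).
Implicit Types (C : {vspace 'rV[F]_n}) (x y v c : 'rV[F]_n) (T : {set 'I_n}).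

Lemma card_setC_eq T i : (i <= n)%N -> (#|~: T| == i) = (#|T| == (n - i)%N).
Proof.
have := cardsC T; rewrite card_ord; move: #|T| #|~: T| => a b ab lein.
by apply/eqP/eqP; lia.
Qed.

Lemma agree_sum_ord C i v : (i <= n)%N ->
  agree_sum C i v = (\sum_(j < i.+1) nb_at C v j * 'C(n - j, n - i))%N.
Proof.
move=> lein; rewrite agree_sumE //.
rewrite -!(big_mkord xpredT (fun j => nb_at C v j * 'C(n - j, n - i)))%N.
rewrite (@big_cat_nat _ _ _ i.+1) //= [X in (_ + X)%N]big_nat [X in (_ + X)%N]big1 ?addn0 //.
by move=> j /andP[ij jn]; rewrite bin_small ?muln0 //; lia.
Qed.

Lemma nb_atP C v j :
  reflect (exists2 c, c \in C & hdist v c = j) (nb_at C v j != 0%N).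
Proof.
rewrite -lt0n; apply: (iffP card_gt0P) => -[c].
  by rewrite inE => /andP[Cc /eqP]; exists c.
by move=> Cc /eqP vc; exists c; rewrite inE Cc.
Qed.

Lemma agree_sum_eq0P C i v : (i <= n)%N ->
  (forall T, #|~: T| = i -> agree C T v = 0%N) <->
  (forall c, c \in C -> (i < hdist v c)%N).
Proof.
move=> lein; split=> [agr0 c Cc|far T Ti]; last first.
  apply/eqP/negP => /negP/agreeP[c Cc vc]; have := far c Cc.
  rewrite ltnNge -Ti subset_leq_card //; apply/subsetP => j; rewrite !inE.
  by apply: contra => /vc ->.
rewrite ltnNge; apply/negP => le.
have [|T TZ Tc] := @ex_subset _ [set j | v ord0 j == c ord0 j] (n - i).
  have := cardsC [set j | v ord0 j == c ord0 j]; rewrite card_ord.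
  rewrite (_ : #|~: _| = hdist v c); last by apply: eq_card => j; rewrite !inE.
  by move: #|_| le => a; move: (hdist v c) => b; lia.
have /eqP : agree C T v = 0%N by apply/agr0/eqP; rewrite card_setC_eq // Tc.
apply/negP/agreeP; exists c => // j /(subsetP TZ); rewrite inE => /eqP //.
Qed.

Lemma far_agree_sum C i v : (i <= n)%N ->
  (forall c, c \in C -> (i < hdist v c)%N) -> agree_sum C i v = 0%N.
Proof.
move=> lein /agree_sum_eq0P agr0; apply: big1 => T /eqP.
exact: agr0.
Qed.

Lemma agree_sum_eq0_far C i v : (i <= n)%N -> agree_sum C i v = 0%N ->
  (forall c, c \in C -> (i < hdist v c)%N).
Proof.
move=> lein /eqP; rewrite sum_nat_eq0 => /forall_inP agr0.
by apply/agree_sum_eq0P => // T /eqP/agr0/eqP.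
Qed.

Lemma nb_at_far C i v j : (forall c, c \in C -> (i < hdist v c)%N) ->
  (j <= i)%N -> nb_at C v j = 0%N.
Proof.
move=> far le; apply/eqP/negP => /negP/nb_atP[c /far + vc].
by rewrite vc ltnNge le.
Qed.

Lemma covering_radius_le C : (covering_radius C <= n)%N.
Proof.
rewrite /covering_radius; case: ex_minnP => m _; apply.
by apply/forallP => v; apply/existsP; exists 0; rewrite mem0v hdist_le.
Qed.

(** Each S_i with i <= r is a combination of B_0, ..., B_r, so substitution turns a relation among
    the S_i into one among the B_j. *)
Lemma UPWS_agree_sum C r (g : nat -> rat) : covering_radius C = r ->
  (forall v, \sum_(i < r.+1) g i * (agree_sum C i v)%:R = 1) -> UPWS C.
Proof.
move=> Cr gP; have := covering_radius_le C; rewrite /UPWS Cr => lern.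
pose b (j : 'I_r.+1) : rat := \sum_(i < r.+1) g i * ('C(n - j, n - i))%:R.
exists b => v; rewrite /b.
rewrite -[RHS](gP v); under eq_bigr => j _ do rewrite mulr_suml.
rewrite exchange_big /=; apply: eq_bigr => i _.
have lein : (i <= n)%N by apply: leq_trans lern; rewrite -ltnS.
rewrite agree_sumE // natr_sum mulr_sumr.
rewrite -(big_mkord xpredT (fun j => g i * (nb_at C v j * 'C(n - j, n - i))%:R)).
rewrite (@big_cat_nat _ _ _ r.+1) //= [X in _ + X]big_nat [X in _ + X]big1 ?addr0; last first.
  move=> j /andP[rj jn]; rewrite bin_small ?muln0 ?mulr0 //.
  by have := ltn_ord i; lia.
by rewrite big_mkord; apply: eq_bigr => j _; rewrite natrM -mulrA; congr (_ * _); exact: mulrC.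
Qed.

(** The system expressing the S_i through the B_j is triangular with unit diagonal, so it is solved
    for B_j by induction. *)
Lemma nb_at_agree_sum C r v w : (r <= n)%N ->
  (forall i, (i <= r)%N -> agree_sum C i v = agree_sum C i w) ->
  forall j, (j <= r)%N -> nb_at C v j = nb_at C w j.
Proof.
move=> lern eqS; elim/ltn_ind => j IH lejr.
have lejn : (j <= n)%N by apply: leq_trans lern.
have := eqS j lejr; rewrite !agree_sum_ord // !big_ord_recr /= binn !muln1.
rewrite (eq_bigr (fun i : 'I_j => nb_at C w i * 'C(n - i, n - j))%N) => [|i _].
  by apply: addnI.
by rewrite IH // ltnW // (leq_trans (ltn_ord i)).
Qed.

(* Emptiness of the agreement counts encodes the distance to the code. *)
Lemma completely_regular_agree_sum C r : covering_radius C = r ->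
  (forall v w, (forall i, (i <= r)%N ->
      (agree_sum C i v == 0%N) = (agree_sum C i w == 0%N)) ->
    forall i, (i <= r)%N -> agree_sum C i v = agree_sum C i w) ->
  completely_regular C.
Proof.
move=> Cr H; split=> // v w _ dvw; have := covering_radius_le C; rewrite Cr => lern.
apply: nb_at_agree_sum => //; apply: H => i leir.
have lein : (i <= n)%N by apply: leq_trans lern.
have E u : (agree_sum C i u == 0%N) = (i < dist_to C u)%N.
  apply/eqP/idP => [/agree_sum_eq0_far far|lt].
    by have [c Cc <-] := dist_to_attained C u; apply: far.
  by apply: far_agree_sum => // c Cc; apply: leq_trans lt _; apply: dist_to_le.
by rewrite !E dvw.
Qed.

Lemma dim_code_of_gen k (P : 'M[F]_(k, n)) : \dim (code_of_gen P) = \rank P.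
Proof.
apply/eqP; rewrite -(eqn_exp2l _ _ (finNzRing_gt1 F)) -card_vspace -card_rowg.
by apply/eqP/eq_card => x; rewrite mem_rowg mem_code_of_gen_sub.
Qed.

Lemma dim_code_of_pcm k (P : 'M[F]_(k, n)) : \dim (code_of_pcm P) = (n - \rank P)%N.
Proof.
rewrite -(mxrank_tr P) -mxrank_ker.
apply/eqP; rewrite -(eqn_exp2l _ _ (finNzRing_gt1 F)) -card_vspace -card_rowg.
by apply/eqP/eq_card => x; rewrite mem_rowg mem_code_of_pcm_sub.
Qed.

Lemma dual_code_of_pcm k (P : 'M[F]_(k, n)) :
  dual_code (code_of_pcm P) = code_of_gen P.
Proof.
apply/vspaceP => x; rewrite /dual_code mem_code_of_pcm_sub mem_code_of_gen_sub.
have E := gen_mx_code_of_pcm P.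
rewrite -mem_code_of_pcm_sub (eqmx_code_of_pcm E) mem_code_of_pcm.
rewrite -trmx_eq0 trmx_mul trmxK -sub_kermx.
suff -> : (kermx (kermx P^T)^T :=: P)%MS by [].
apply: eqmx_sym; apply/eqmxP; rewrite -mxrank_leqif_eq.
  by rewrite mxrank_ker mxrank_tr mxrank_ker mxrank_tr subKn // rank_leq_col.
apply/sub_kermxP/trmx_inj; rewrite trmx_mul trmxK trmx0; exact: mulmx_ker.
Qed.

Lemma nb_at0 C j : nb_at C 0 j = nb_wt C j.
Proof. by apply: eq_card => c; rewrite !inE hdistE sub0r wtN. Qed.

Lemma nb_wt0 C : nb_wt C 0 = 1%N.
Proof.
apply/eqP/cards1P; exists 0; apply/setP => c; rewrite !inE wt_eq0.
by case: eqVneq => [->|]; rewrite ?mem0v ?andbF.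
Qed.

End AgreeSum.

(** * Near-MDS matrices and their Steiner systems *)

Section NearMDSMatrices.
Variables (F : fieldType) (k n : nat).
Implicit Types (P : 'M[F]_(k.+1, n)) (T : {set 'I_n}).

Definition crank P T : nat := \rank (P *m mask_mx F T).

(** The column conditions of a near-MDS code, apart from the existence of k + 1 dependent columns,
    which [steiner_mx] provides. *)
Definition near_mds_mx P : Prop :=
  (forall T, #|T| = k -> crank P T = k) /\
  (forall T, #|T| = k.+2 -> crank P T = k.+1).

(* Here k = kappa - 1: the columns of [P] carry a Steiner system S(k, k+1, n), whose blocks are the dependent (k+1)-sets. *)
Definition steiner_mx P : Prop :=
  forall T, #|T| = k ->
    exists B : {set 'I_n}, [/\ T \subset B, #|B| = k.+1 & crank P B = k].

Definition block P T : bool := (#|T| == k.+1) && (crank P T == k).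

End NearMDSMatrices.

Section MapNearMDS.
Variables (K L : fieldType) (iota : {rmorphism K -> L}) (k n : nat).
Implicit Types (P : 'M[K]_(k.+1, n)).

Lemma crank_map P T : crank (map_mx iota P) T = crank P T.
Proof. by rewrite /crank -(map_mask_mx iota) -map_mxM mxrank_map. Qed.

Lemma near_mds_map P : near_mds_mx P -> near_mds_mx (map_mx iota P).
Proof. by case=> H1 H2; split=> T Tc; rewrite crank_map; [apply: H1 | apply: H2]. Qed.

Lemma steiner_map P : steiner_mx P -> steiner_mx (map_mx iota P).
Proof.
by move=> H T /H[B [TB Bc Br]]; exists B; split=> //; rewrite crank_map.
Qed.

End MapNearMDS.

Section NearMDS.
Variables (F : finFieldType) (k n : nat) (P : 'M[F]_(k.+1, n)).
Hypotheses (n_def : n = (k + 7)%N) (nmdsP : near_mds_mx P).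
Implicit Types (T U B : {set 'I_n}) (v : 'rV[F]_n).

Local Notation q := #|F|.
Local Notation D := (code_of_gen P).
Local Notation A := (code_of_pcm P).

Lemma rank_near_mds : \rank P = k.+1.
Proof.
have [|T _ Tc] := @ex_subset _ [set: 'I_n] k.+2.
  by rewrite cardsT card_ord; lia.
apply/eqP; rewrite eqn_leq rank_leq_row /= -[X in (X <= _)%N](nmdsP.2 _ Tc).
exact: mxrankM_maxl.
Qed.

Lemma crank_large T : (k.+2 <= #|T|)%N -> crank P T = k.+1.
Proof.
case/ex_subset => U UT Uc; apply/eqP.
rewrite eqn_leq rank_leq_row -[X in (X <= _)%N](nmdsP.2 _ Uc).
exact: mxrank_mask_subset.
Qed.

Lemma crank_small T : (#|T| <= k)%N -> crank P T = #|T|.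
Proof.
move=> le; apply/eqP; rewrite eqn_leq mxrank_mask_le /=.
have [U TU Uc] : exists2 U : {set 'I_n}, T \subset U & #|U| = k.
  have [|V VT Vc] := @ex_subset _ (~: T) (k - #|T|).
    by have := cardsC T; rewrite card_ord; move: n_def;move: #|T| #|~: T| le => a b; lia.
  exists (T :|: V); rewrite ?subsetUl // cardsU.
  rewrite (_ : T :&: V = set0) ?cards0 ?Vc; first by lia.
  apply/setP => i; rewrite !inE; case Ti: (i \in T) => //=.
  by apply/negP => /(subsetP VT); rewrite inE Ti.
have := nmdsP.1 _ Uc; rewrite /crank.
have -> : P *m mask_mx F U = P *m mask_mx F T + P *m mask_mx F (U :\: T).
  apply/matrixP => i j; rewrite [RHS]mxE !mul_mask_mxE inE.
  have [Tj|_] := boolP (j \in T); first by rewrite (subsetP TU) ?addr0.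
  by rewrite add0r.
have := mxrank_add (P *m mask_mx F T) (P *m mask_mx F (U :\: T)).
have := mxrank_mask_le P (U :\: T); rewrite cardsD (setIidPr TU) Uc.
move=> H1 H2 H3; rewrite H3 in H2; move: H1 H2 le; move: #|T| (\rank _) (\rank _) => a b c; lia.
Qed.

Lemma crank_mid T : #|T| = k.+1 -> crank P T = if block P T then k else k.+1.
Proof.
move=> Tc; rewrite /block Tc eqxx /=; case: ifPn => [/eqP//|nk].
have := rank_leq_row (P *m mask_mx F T); rewrite -/(crank P T) => le.
have [|U UT Uc] := @ex_subset _ T k; first by rewrite Tc.
have := mxrank_mask_subset P UT; rewrite -/(crank P T) -/(crank P U) nmdsP.1 //.
by move: nk; lia.
Qed.

(** Restriction to a non-block maps the code bijectively onto the vectors on [T]. On a block it has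
    a one-dimensional kernel, so [v] is met q times or never. *)
Lemma agree_gen_mid T v : #|T| = k.+1 ->
  agree D T v = if block P T
    then (q * nat_of_bool (v *m mask_mx F T <= P *m mask_mx F T)%MS)%N else 1%N.
Proof.
move=> Tc; rewrite agree_gen rank_near_mds -/(crank P T) crank_mid //.
have [_|nb] := boolP (block P T).
  by rewrite subSnn expn1; case: ifP; rewrite ?muln1 ?muln0.
rewrite subnn ifT //; apply: submx_trans (submxMl _ _) _.
rewrite -(mxrank_leqif_sup (submxMl P _)).2 mxrank_mask -/(crank P T).
by rewrite crank_mid // (negbTE nb) Tc.
Qed.

Lemma agree_gen_large T v : (k.+2 <= #|T|)%N ->
  agree D T v = (v *m mask_mx F T <= P *m mask_mx F T)%MS :> nat.
Proof.
move=> Tc; rewrite agree_gen rank_near_mds -/(crank P T) crank_large // subnn.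
by case: ifP.
Qed.

Lemma agree_gen_small T v : (#|T| <= k)%N -> agree D T v = (q ^ (k.+1 - #|T|))%N.
Proof.
move=> Tc; rewrite agree_gen rank_near_mds -/(crank P T) crank_small // ifT //.
apply: submx_trans (submxMl _ _) _.
rewrite -(mxrank_leqif_sup (submxMl P _)).2 mxrank_mask -/(crank P T).
by rewrite crank_small.
Qed.

Lemma agree_pcm_small T v : (#|~: T| <= k)%N ->
  agree A T v = (v *m P^T <= mask_mx F (~: T) *m P^T)%MS :> nat.
Proof.
move=> Tc; rewrite agree_pcm -/(crank P (~: T)) crank_small // subnn.
by case: ifP.
Qed.

Lemma agree_pcm_mid T v : #|~: T| = k.+1 ->
  agree A T v = if block P (~: T)
    then (q * nat_of_bool (v *m P^T <= mask_mx F (~: T) *m P^T)%MS)%N else 1%N.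
Proof.
move=> Tc; rewrite agree_pcm -/(crank P (~: T)) crank_mid // Tc.
have [_|nb] := boolP (block P (~: T)).
  by rewrite subSnn expn1; case: ifP; rewrite ?muln1 ?muln0.
rewrite subnn ifT //; apply: submx_trans (submx1 _) _.
by rewrite sub1mx /row_full mxrank_mul_mask -/(crank P (~: T)) crank_mid // (negbTE nb).
Qed.

(** Both blocks have rank k, hence span the same space as the columns in [T], and so does their
    union. Two distinct blocks would have a union of at least k + 2 elements, whose rank is k +
    1. *)
Lemma blocks_eq B B' T :
  block P B -> block P B' -> T \subset B -> T \subset B' -> #|T| = k -> B = B'.
Proof.
move=> /andP[/eqP Bc /eqP Br] /andP[/eqP B'c /eqP B'r] TB TB' Tc.
have [//|neq] := eqVneq B B'.
have eqT U : T \subset U -> crank P U = k ->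
    (mask_mx F T *m P^T == mask_mx F U *m P^T)%MS.
  move=> TU Ur; rewrite -mxrank_leqif_eq; last exact: mask_mul_submx.
  by rewrite !mxrank_mul_mask -/(crank P T) -/(crank P U) Ur nmdsP.1.
have sub U : T \subset U -> crank P U = k ->
    (mask_mx F U *m P^T <= mask_mx F T *m P^T)%MS.
  by move=> TU Ur; case/andP: (eqT U TU Ur).
have : (mask_mx F (B :|: B') *m P^T <= mask_mx F T *m P^T)%MS.
  have -> : mask_mx F (B :|: B') = mask_mx F B + mask_mx F (B' :\: B).
    apply/matrixP => i j; rewrite !mxE !inE.
    by case: (i \in B); case: (i \in B'); case: (i == j); rewrite /= ?addr0 ?add0r ?mul0rn.
  rewrite mulmxDl; apply: addmx_sub; first exact: sub.
  by apply: submx_trans (sub _ TB' B'r); apply: mask_mul_submx; apply: subsetDl.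
move/mxrankS; rewrite !mxrank_mul_mask -/(crank P T) nmdsP.1 //.
rewrite -/(crank P (B :|: B')) crank_large ?ltnn //.
rewrite ltn_neqAle -{2}Bc subset_leq_card ?subsetUl // andbT.
apply: contra neq => /eqP c.
have BE : B = B :|: B' by apply/eqP; rewrite eqEcard subsetUl -c Bc leqnn.
have B'E : B' = B :|: B' by apply/eqP; rewrite eqEcard subsetUr -c B'c leqnn.
by rewrite {1}BE -B'E.
Qed.

(* The k+7-k = 7 one-point extensions of a k-set contain at most one block. *)
Lemma ex_nonblock : exists2 T : {set 'I_n}, #|T| = k.+1 & ~~ block P T.
Proof.
have [|U _ Uc] := @ex_subset _ [set: 'I_n] k.+2.
  by rewrite cardsT card_ord; lia.
have [|V VU Vc] := @ex_subset _ U k; first by rewrite Uc; lia.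
have : (0 < #|U :\: V|)%N by rewrite cardsD (setIidPr VU) Uc Vc; lia.
case/card_gt0P => x xUV.
have : (0 < #|(U :\: V) :\ x|)%N.
  by have := cardsD1 x (U :\: V); rewrite xUV cardsD (setIidPr VU) Uc Vc; lia.
case/card_gt0P => y; rewrite in_setD1 => /andP[yx yUV].
move: xUV yUV; rewrite !inE => /andP[xV xU] /andP[yV yU].
have cx : #|x |: V| = k.+1 by rewrite cardsU1 xV Vc.
have cy : #|y |: V| = k.+1 by rewrite cardsU1 yV Vc.
have [bx|] := boolP (block P (x |: V)); last by exists (x |: V).
have [by_|] := boolP (block P (y |: V)); last by exists (y |: V).
have := blocks_eq bx by_ (subsetUr _ _) (subsetUr _ _) Vc.
by move/setP/(_ y); rewrite !inE eqxx (negbTE yx) (negbTE yV).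
Qed.

(** Any k columns of [P] are independent, so only the zero word of weight at most k satisfies the
    parity checks. *)
Lemma far_from_pcm c : c \in A -> c != 0 -> (k.+1 <= wt c)%N.
Proof.
move=> Ac c0; rewrite ltnNge; apply/negP => le.
have : agree A (~: [set i | c ord0 i != 0]) 0 = 1%N.
  by rewrite agree_pcm_small ?setCK // mul0mx sub0mx.
move/eqP/cards1P => [x xE].
have: 0 \in [set x] /\ c \in [set x].
  rewrite -xE !inE mem0v Ac; split; apply/forall_inP => i; rewrite !inE ?eqxx //.
  by rewrite negbK mxE eq_sym.
by rewrite !inE => -[/eqP<- ]; rewrite (negbTE c0).
Qed.

(** A word of weight at most 5 vanishes on n - 5 = k + 2 coordinates, and restriction to so many
    coordinates is injective. *)
Lemma far_from_gen c : c \in D -> c != 0 -> (6 <= wt c)%N.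
Proof.
move=> Dc c0; rewrite ltnNge; apply/negP => le.
have : agree D [set i | c ord0 i == 0] 0 = 1%N.
  rewrite agree_gen_large ?mul0mx ?sub0mx //.
  by have := wt_mask c; move: #|_| => a; lia.
move/eqP/cards1P => [x xE].
have: 0 \in [set x] /\ c \in [set x].
  rewrite -xE !inE mem0v Dc; split; apply/forall_inP => i; rewrite !inE ?eqxx //.
  by rewrite mxE eq_sym.
by rewrite !inE => -[/eqP<- ]; rewrite (negbTE c0).
Qed.

Lemma dim_gen : \dim D = k.+1.
Proof. by rewrite dim_code_of_gen rank_near_mds. Qed.

Lemma dim_pcm : \dim A = 6%N.
Proof. by rewrite dim_code_of_pcm rank_near_mds n_def; lia. Qed.

(** A non-block is an information set: some codeword agrees with [v] on it, and can differ only on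
    the other n - (k + 1) = 6 coordinates. *)
Lemma covers_gen v : exists2 c, c \in D & (hdist v c <= 6)%N.
Proof.
have [T Tc nb] := ex_nonblock.
have : agree D T v != 0%N by rewrite agree_gen_mid // (negbTE nb).
case/agreeP => c Dc vc; exists c => //.
rewrite leqNgt; apply/negP => lt.
have le : (hdist v c <= #|~: T|)%N.
  by apply/subset_leq_card/subsetP => i; rewrite !inE; apply: contra => /vc->.
have := cardsC T; rewrite card_ord Tc; move: n_def; move: #|~: T| le => a; lia.
Qed.

(** The columns in a non-block form a basis, so every syndrome is a combination of these k + 1
    columns. *)
Lemma covers_pcm v : exists2 c, c \in A & (hdist v c <= k.+1)%N.
Proof.
have [T Tc nb] := ex_nonblock.
have : agree A (~: T) v != 0%N by rewrite agree_pcm_mid ?setCK // (negbTE nb).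
case/agreeP => c Ac vc; exists c => //; rewrite -Tc.
apply/subset_leq_card/subsetP => i; rewrite !inE; apply: contraR => nTi.
by rewrite vc ?inE.
Qed.

(* Counting the pairs (T, c), c vanishing on the k-set T. *)
Lemma nb_wt_gen : (k.+1 * nb_wt D 6 + nb_wt D 7 = 'C(n, k) * q.-1)%N.
Proof.
have len : (7 <= n)%N by rewrite n_def; lia.
have nk : (n - 7 = k)%N by rewrite n_def; lia.
have : agree_sum D 7 0 = ('C(n, k) * q)%N.
  transitivity (\sum_(T : {set 'I_n} | #|~: T| == 7) q)%N.
    apply: eq_bigr => T; rewrite card_setC_eq // => /eqP Tc.
    by rewrite agree_gen_small Tc nk // subSnn expn1.
  rewrite sum_nat_const; congr muln.
  have := card_draws 'I_n k; rewrite card_ord => <-.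
  by apply: eq_card => T; rewrite [RHS]inE -nk -card_setC_eq.
rewrite agree_sum_ord // !big_ord_recl big_ord0 /= /bump /= !nb_at0 nb_wt0.
have z j : (0 < j < 6)%N -> nb_wt D j = 0%N.
  move=> /andP[j0 j6]; apply/eqP; rewrite cards_eq0; apply/eqP/setP => c.
  rewrite !inE; apply/andP => -[Dc /eqP wc].
  have := far_from_gen Dc; rewrite -wt_eq0 wc leqNgt j6 -lt0n.
  by move/(_ j0).
rewrite !(z 1%N, z 2%N, z 3%N, z 4%N, z 5%N) //.
rewrite !(mul0n, add0n, addn0, subn0, mul1n) nk.
have -> : (n - (1 + (1 + (1 + (1 + (1 + (1 + 0)))))) = k.+1)%N by rewrite n_def; lia.
rewrite ?nk binSn binn muln1.
(* The zero word is counted once for each k-set, which turns the factor q into q - 1. *)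
rewrite -/6 -/7 -{1}(@prednK #|F|) ?(ltnW (finNzRing_gt1 F)) // (mulnS 'C(n, k)).
by move/eqP; rewrite eqn_add2l => /eqP <-; rewrite [X in (X + _)%N]mulnC.
Qed.

End NearMDS.

Section NearMDSCriteria.
Variables (F : finFieldType) (n : nat).
Implicit Types (C : {vspace 'rV[F]_n}) (T : {set 'I_n}).

Lemma agree0_gt1 C T : (1 < agree C T 0)%N ->
  exists c, [/\ c \in C, c != 0 & forall i, i \in T -> c 0 i = 0].
Proof.
rewrite /agree; set S := [set c in C | _]; rewrite (cardsD1 0) => S1.
have : (0 < #|S :\ 0%R|)%N by move: S1; case: (_ \in _); case: #|_|.
case/card_gt0P => c; rewrite !inE => /and3P[c0 Cc /forall_inP c0T].
by exists c; split=> // i /c0T/eqP<-; rewrite mxE.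
Qed.

Lemma agree0_eq1 C T :
  (forall c, c \in C -> (forall i, i \in T -> c 0 i = 0) -> c = 0) ->
  agree C T 0 = 1%N.
Proof.
move=> H; apply/eqP/cards1P; exists 0; apply/setP => c; rewrite !inE.
apply/andP/eqP => [[Cc /forall_inP c0]|->].
  by apply: H => // i /c0/eqP<-; rewrite mxE.
by rewrite mem0v; split=> //; apply/forall_inP.
Qed.

Lemma wt_vanish (c : 'rV[F]_n) T :
  (forall i, i \in T -> c 0 i = 0) -> (#|T| + wt c <= n)%N.
Proof.
move=> c0; rewrite -[X in (_ <= X)%N](wt_mask c) leq_add2r.
by apply/subset_leq_card/subsetP => i /c0; rewrite inE => /eqP.
Qed.

Variables (k : nat) (P : 'M[F]_(k.+1, n)).
Hypothesis (n_def : n = (k + 7)%N).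

(** The words of D vanishing on a (k+2)-set, and those of A supported on a k-set, number a power of
    q whose exponent is the rank defect of the set. The distance bounds leave only the zero word, so
    the defect is 0. *)
Lemma near_mds_of_dist : \rank P = k.+1 ->
  (forall c, c \in code_of_gen P -> c != 0 -> (6 <= wt c)%N) ->
  (forall c, c \in code_of_pcm P -> c != 0 -> (k.+1 <= wt c)%N) ->
  near_mds_mx P.
Proof.
move=> rP dD dA; have q1 := finNzRing_gt1 F.
have expq1 m : (#|F| ^ m = 1 -> m = 0)%N.
  by move/eqP; rewrite -[X in _ == X](expn0 #|F|) eqn_exp2l // => /eqP.
split=> T Tc.
  have : agree (code_of_pcm P) (~: T) 0 = 1%N.
    apply: agree0_eq1 => c Ac c0; apply/eqP; apply: contraT => /(dA _ Ac).
    have := wt_vanish c0; have := cardsC T; rewrite card_ord Tc.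
    by move: #|~: T| => a *; lia.
  rewrite agree_pcm mul0mx sub0mx setCK Tc -/(crank P T) => /expq1.
  by have := mxrank_mask_le P T; rewrite -/(crank P T) Tc; lia.
have : agree (code_of_gen P) T 0 = 1%N.
  apply: agree0_eq1 => c Dc c0; apply/eqP; apply: contraT => /(dD _ Dc).
  by have := wt_vanish c0; rewrite Tc => *; lia.
rewrite agree_gen mul0mx sub0mx rP -/(crank P T) => /expq1.
by have := rank_leq_row (P *m mask_mx F T); rewrite -/(crank P T); lia.
Qed.

(** Some nonzero word vanishes on the k-set and so has weight at most 7. Weight 7 is excluded and
    weights below 6 do not occur, so its zero set has k + 1 elements; this set is dependent because
    a nonzero word vanishes on it. *)
Lemma steiner_of_wt7 : near_mds_mx P ->
  (forall c, c \in code_of_gen P -> wt c != 7%N) -> steiner_mx P.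
Proof.
move=> nmds no7 T Tc; have q1 := finNzRing_gt1 F.
have [|c [Dc c0 cT]] := @agree0_gt1 (code_of_gen P) T.
  by rewrite (agree_gen_small n_def nmds) Tc // subSnn expn1.
have := wt_vanish cT; have := far_from_gen n_def nmds Dc c0; have := no7 c Dc.
rewrite Tc => /eqP c7 c6 cle; have wc : wt c = 6%N by lia.
exists [set i | c ord0 i == 0]; have := wt_mask c; rewrite wc => Zc.
have {}Zc : #|[set i | c ord0 i == 0]| = k.+1 by move: #|_| Zc => a; lia.
split=> //; first by apply/subsetP => i /cT ci; rewrite inE ci.
rewrite (crank_mid n_def nmds) //; case: ifPn => // nb.
have : agree (code_of_gen P) [set i | c ord0 i == 0] 0 = 1%N.
  by rewrite (agree_gen_mid n_def nmds) // (negbTE nb).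
move/eqP/cards1P => [x xE].
have: 0 \in [set x] /\ c \in [set x].
  rewrite -xE !inE mem0v Dc; split; apply/forall_inP => i; rewrite !inE ?eqxx //.
  by rewrite mxE eq_sym.
by rewrite !inE => -[/eqP<-]; rewrite (negbTE c0).
Qed.

End NearMDSCriteria.

(* In an NMDS code of codimension 6 this identity bounds A_6 by A_6^max, with equality iff A_7 = 0. *)
Lemma nb_wt_NMDS (F : finFieldType) k n (C : {vspace 'rV[F]_n}) :
  n = (k + 7)%N -> NMDS C -> \dim C = k.+1 ->
  (k.+1 * nb_wt C 6 + nb_wt C 7 = 'C(n, k) * #|F|.-1)%N.
Proof.
move=> n_def [dC dCd] dimC; move: dC dCd; rewrite dimC => dC dCd.
have {}dC : min_dist C = 6%N by rewrite dC n_def; lia.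
rewrite dC in dCd.
have [P PE] : exists P : 'M[F]_(k.+1, n), code_of_gen P = C.
  by move: (gen_mx C) (code_of_gen_mx C); rewrite dimC => P; exists P.
have {}dCd : min_dist (code_of_pcm P) = k.+1.
  by rewrite -dual_code_of_gen PE; lia.
rewrite -PE; apply: nb_wt_gen => //; apply: near_mds_of_dist => //.
- by rewrite -dim_code_of_gen PE.
- by rewrite PE; apply: (min_dist_wt dC _).2; rewrite n_def; lia.
- by apply: (min_dist_wt dCd _).2; rewrite n_def; lia.
Qed.

(** * The UPWS relation and the obstruction to it *)

Section Steiner.
Variables (F : finFieldType) (k n : nat) (P : 'M[F]_(k.+1, n)).
Hypotheses (n_def : n = (k + 7)%N) (nmdsP : near_mds_mx P) (stP : steiner_mx P).
Implicit Types (T U B : {set 'I_n}) (v : 'rV[F]_n).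

Local Notation q := #|F|.
Local Notation D := (code_of_gen P).
Local Notation A := (code_of_pcm P).

Lemma ex_block : exists B : {set 'I_n}, block P B.
Proof.
have [|T _ Tc] := @ex_subset _ [set: 'I_n] k.
  by rewrite cardsT card_ord; lia.
by have [B [_ /eqP Bc /eqP Br]] := stP Tc; exists B; rewrite /block Bc Br.
Qed.

Lemma min_dist_gen : min_dist D = 6%N.
Proof.
apply: min_distP; last exact: far_from_gen.
have [B bB] := ex_block; have Bc : #|B| = k.+1 by case/andP: bB => /eqP.
have [|c [Dc c0 cB]] := @agree0_gt1 _ _ D B.
  by rewrite (agree_gen_mid n_def) // bB mul0mx sub0mx muln1 finNzRing_gt1.
exists c; split=> //; have := far_from_gen n_def nmdsP Dc c0.
by have := wt_vanish cB; rewrite Bc; lia.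
Qed.

Lemma min_dist_pcm : min_dist A = k.+1.
Proof.
apply: min_distP; last exact: far_from_pcm.
have [B bB] := ex_block; have Bc : #|B| = k.+1 by case/andP: bB => /eqP.
have [|c [Ac c0 cB]] := @agree0_gt1 _ _ A (~: B).
  by rewrite (agree_pcm_mid n_def) ?setCK // bB mul0mx sub0mx muln1 finNzRing_gt1.
exists c; split=> //; have := far_from_pcm n_def nmdsP Ac c0.
have := wt_vanish cB; have := cardsC B; rewrite card_ord Bc.
by move: #|~: B| => a; lia.
Qed.

Lemma NMDS_gen : NMDS D.
Proof.
rewrite /NMDS dual_code_of_gen min_dist_gen min_dist_pcm dim_gen //.
by split; lia.
Qed.

Lemma NMDS_pcm : NMDS A.
Proof.
rewrite /NMDS dual_code_of_pcm min_dist_gen min_dist_pcm dim_pcm //.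
by split; lia.
Qed.

(** The zero set Z of such a word has k elements and lies in a block B. The words vanishing on Z and
    those vanishing on B both number q, so they are the same words, and the given one would have
    weight at most 6. *)
Lemma nb_wt7_gen : nb_wt D 7 = 0%N.
Proof.
apply/eqP; rewrite cards_eq0; apply/eqP/setP => c; rewrite !inE.
apply/andP => -[Dc /eqP wc].
set Z := [set i | c ord0 i == 0].
have Zc : #|Z| = k by have := wt_mask c; rewrite wc -/Z; move: #|Z|; lia.
have [B [ZB Bc Br]] := stP Zc.
have bB : block P B by rewrite /block Bc Br !eqxx.
have sub : [set c in D | [forall i in B, (0 : 'rV[F]_n) 0 i == c 0 i]] \subset
           [set c in D | [forall i in Z, (0 : 'rV[F]_n) 0 i == c 0 i]].
  apply/subsetP => x; rewrite !inE => /andP[-> /forall_inP x0].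
  by apply/forall_inP => i /(subsetP ZB)/x0.
have : c \in [set c in D | [forall i in B, (0 : 'rV[F]_n) 0 i == c 0 i]].
  have /eqP -> : [set c in D | [forall i in B, (0 : 'rV[F]_n) 0 i == c 0 i]] ==
           [set c in D | [forall i in Z, (0 : 'rV[F]_n) 0 i == c 0 i]].
    rewrite eqEcard sub -/(agree D Z 0) -/(agree D B 0).
    rewrite (agree_gen_small n_def nmdsP) ?Zc // (agree_gen_mid n_def) // bB.
    by rewrite mul0mx sub0mx muln1 subSnn expn1 leqnn.
  by rewrite inE Dc; apply/forall_inP => i; rewrite inE mxE eq_sym.
rewrite inE => /andP[_ /forall_inP cB].
have /wt_vanish : forall i, i \in B -> c 0 i = 0.
  by move=> i /cB/eqP<-; rewrite mxE.
by rewrite Bc wc; lia.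
Qed.

Lemma nb_wt6_gen : (k.+1 * nb_wt D 6 = 'C(n, k) * q.-1)%N.
Proof. by rewrite -(nb_wt_gen n_def nmdsP) nb_wt7_gen addn0. Qed.

Lemma nb_wt6_Amax : (nb_wt D 6)%:R = Amax n k.+1 q.
Proof.
have qE : q%:R = q.-1%:R + 1 :> rat.
  by rewrite natr1 prednK // ltnW // finNzRing_gt1.
rewrite /Amax /= qE addrK mulrA -natrM -nb_wt6_gen natrM mulrAC divff ?mul1r //.
by rewrite pnatr_eq0.
Qed.

Lemma nb_wt6_max (C : {vspace 'rV[F]_n}) : NMDS C -> \dim C = k.+1 ->
  (nb_wt C 6 <= nb_wt D 6)%N.
Proof.
move=> nC dC; have := nb_wt_NMDS n_def nC dC; rewrite -nb_wt6_gen => E.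
by rewrite -(leq_pmul2l (ltn0Sn k)) -E leq_addr.
Qed.

Lemma block_span B T : block P B -> T \subset B -> #|T| = k ->
  (mask_mx F T *m P^T :=: mask_mx F B *m P^T)%MS.
Proof.
move=> /andP[_ /eqP Br] TB Tc; apply/eqmxP.
rewrite -mxrank_leqif_eq; last exact: mask_mul_submx.
by rewrite !mxrank_mul_mask -/(crank P T) -/(crank P B) Br nmdsP.1.
Qed.

Definition nb_nonblock : nat := #|[set T : {set 'I_n} | (#|T| == k.+1) && ~~ block P T]|.

Lemma nb_nonblock_gt0 : (0 < nb_nonblock)%N.
Proof.
have [T Tc nb] := ex_nonblock n_def nmdsP; apply/card_gt0P; exists T.
by rewrite inE Tc eqxx.
Qed.

Definition span_blocks v : nat :=
  (\sum_(B : {set 'I_n} | block P B) (v *m P^T <= mask_mx F B *m P^T)%MS)%N.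

Definition code_blocks v : nat :=
  (\sum_(B : {set 'I_n} | block P B) (v *m mask_mx F B <= P *m mask_mx F B)%MS)%N.

(** Shared by both codes: S_6 of [D] and S_(k+1) of [A] are both sums over (k+1)-sets, because n - 6
    = k + 1. *)
Lemma sum_mid_sets (f g : {set 'I_n} -> nat) :
  (forall T, #|T| = k.+1 -> f T = if block P T then (q * g T)%N else 1%N) ->
  (\sum_(T : {set 'I_n} | #|T| == k.+1) f T =
   nb_nonblock + q * \sum_(B : {set 'I_n} | block P B) g B)%N.
Proof.
move=> fE; rewrite (bigID (block P)) /= addnC; congr addn.
  rewrite /nb_nonblock -sum1_card; apply: eq_big => [T|T /andP[/eqP Tc nb]].
    by rewrite inE.
  by rewrite fE // (negbTE nb).
rewrite big_distrr; apply: eq_big => [T|T /andP[/eqP Tc bT]]; last by rewrite fE // bT.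
by rewrite /block andbA andbb.
Qed.

Lemma agree_sum_gen6 v : agree_sum D 6 v = (nb_nonblock + q * code_blocks v)%N.
Proof.
rewrite -(sum_mid_sets (f := fun T => agree D T v)) => [|T].
  by apply: eq_bigl => T; rewrite card_setC_eq ?n_def; first (congr (_ == _); lia); lia.
exact: agree_gen_mid.
Qed.

Lemma agree_sumC (C : {vspace 'rV[F]_n}) i v :
  agree_sum C i v = (\sum_(U : {set 'I_n} | #|U| == i) agree C (~: U) v)%N.
Proof.
by rewrite /agree_sum (reindex_inj (@setC_inj _)); apply: eq_bigl => U; rewrite setCK.
Qed.

Lemma agree_sum_pcm_mid v :
  agree_sum A k.+1 v = (nb_nonblock + q * span_blocks v)%N.
Proof.
rewrite agree_sumC; apply: sum_mid_sets => T Tc.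
by rewrite (agree_pcm_mid n_def nmdsP) setCK.
Qed.

Lemma agree_sum_pcm_small i v : (i <= k)%N ->
  agree_sum A i v =
  (\sum_(U : {set 'I_n} | #|U| == i) (v *m P^T <= mask_mx F U *m P^T)%MS)%N.
Proof.
move=> le; rewrite agree_sumC; apply: eq_bigr => U /eqP Uc.
by rewrite (agree_pcm_small n_def nmdsP) setCK // Uc.
Qed.

(* Each k-set spans the same subspace as the unique block containing it, and each block contains k+1 of them. *)
Lemma agree_sum_pcm_small_blocks v : agree_sum A k v = (k.+1 * span_blocks v)%N.
Proof.
rewrite agree_sum_pcm_small //.
transitivity (\sum_(T : {set 'I_n} | #|T| == k) \sum_(B : {set 'I_n} | block P B && (T \subset B))
    (v *m P^T <= mask_mx F B *m P^T)%MS)%N.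
  apply: eq_bigr => T /eqP Tc; have [B [TB Bc Br]] := stP Tc.
  have bB : block P B by rewrite /block Bc Br !eqxx.
  rewrite (big_pred1 B) ?(block_span bB TB Tc) // => B' /=.
  apply/andP/eqP => [[bB' TB']|->]; last by [].
  exact: (blocks_eq nmdsP bB' bB TB' TB Tc).
rewrite (exchange_big_dep (block P)) /=; last by move=> T B _ /andP[].
rewrite /span_blocks big_distrr /=; apply: eq_bigr => B bB.
rewrite sum_nat_const; congr muln.
have Bc : #|B| = k.+1 by case/andP: bB => /eqP.
rewrite -(binSn k) -{1}Bc -cards_draws; apply: eq_card => T.
by rewrite unfold_in /= inE bB andbC.
Qed.

Lemma covering_radius_pcm v : agree_sum A k v = 0%N -> covering_radius A = k.+1.
Proof.
move=> S0; apply: covering_radiusP; first exact: covers_pcm.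
by exists v => c; apply: agree_sum_eq0_far S0 _; lia.
Qed.

Lemma covering_radius_gen v : agree_sum D 5 v = 0%N -> covering_radius D = 6%N.
Proof.
move=> S0; apply: covering_radiusP; first exact: covers_gen.
by exists v => c; apply: agree_sum_eq0_far S0 _; lia.
Qed.

Lemma UPWS_pcm : covering_radius A = k.+1 -> UPWS A.
Proof.
move=> R; pose N : rat := nb_nonblock%:R.
(* With X = [span_blocks P v] one has S_(k+1) = N + q X and S_k = (k + 1) X, so these two
   coefficients cancel X and leave N / N. The index k + 1 is in range because it is the covering
   radius. *)
pose g i : rat := if i == k.+1 then N^-1 else
  if i == k then - (q%:R / (k.+1%:R * N)) else 0.
apply: (UPWS_agree_sum (g := g) R) => v.
rewrite !big_ord_recr big1 /= => [|i _]; last first.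
  by rewrite /g !ifF ?mul0r //; apply/eqP; have := ltn_ord i; lia.
rewrite add0r /g ltn_eqF // !eqxx agree_sum_pcm_mid agree_sum_pcm_small_blocks.
rewrite natrD !natrM -/N.
have N0 : N != 0 by rewrite pnatr_eq0 -lt0n nb_nonblock_gt0.
have k0 : k.+1%:R != 0 :> rat by rewrite pnatr_eq0.
by field; rewrite -/N N0 nat1r.
Qed.

(* [w1] determines beta_6, [w2] then determines beta_5, and both contradict the relation at [w3]. *)
Lemma not_UPWS_gen w1 w2 w3 :
  agree_sum D 5 w1 = 0%N -> code_blocks w1 = 0%N ->
  agree_sum D 4 w2 = 0%N -> agree_sum D 5 w2 <> 0%N -> code_blocks w2 = 0%N ->
  agree_sum D 4 w3 = 0%N -> code_blocks w3 <> 0%N -> ~ UPWS D.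
Proof.
move=> S1 p1 S2 S2' p2 S3 p3; rewrite /UPWS (covering_radius_gen S1).
case=> beta betaP.
have le i : (i <= 6%N -> i <= n)%N by rewrite n_def; lia.
(* If S_4 vanishes then so do B_0, ..., B_4, and S_5 = B_5, S_6 = B_6 + (k + 2) B_5, since n - 5 = k
   + 2. *)
have E v : agree_sum D 4 v = 0%N ->
    (beta (inord 5) * (agree_sum D 5 v)%:R +
     beta (inord 6) * ((nb_nonblock + q * code_blocks v)%:R -
                       k.+2%:R * (agree_sum D 5 v)%:R) = 1).
  move=> S4; have far := agree_sum_eq0_far (le 4 isT) S4.
  rewrite -[RHS](betaP v) -agree_sum_gen6 !agree_sum_ord ?le //.
  have z j : (j <= 4)%N -> nb_at D v j = 0%N by apply: nb_at_far far.
  rewrite !big_ord_recr !big_ord0 /= !(z 0%N, z 1%N, z 2%N, z 3%N, z 4%N) //.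
  rewrite !(mul0n, add0n, mulr0, add0r).
  have -> : (n - 5 = k.+2)%N by rewrite n_def; lia.
  have -> : (n - 6 = k.+1)%N by rewrite n_def; lia.
  rewrite !binn binSn !muln1 natrD natrM [_%:R * k.+2%:R]mulrC addrAC subrr add0r.
  by congr (_ * _ + _ * _); congr (beta _); apply/val_inj; rewrite /= inordK.
have n0 : nb_nonblock%:R != 0 :> rat by rewrite pnatr_eq0 -lt0n nb_nonblock_gt0.
have S1' : agree_sum D 4 w1 = 0%N.
  apply: far_agree_sum => [|c Dc]; first exact: le.
  by apply: leq_trans (agree_sum_eq0_far (le 5 isT) S1 Dc).
have := E _ S1'; have := E _ S2; have := E _ S3; rewrite S1 p1 p2.
move: (beta _) (beta _) => b6 b5.
rewrite !(muln0, addn0, mulr0, subr0, add0r) natrD natrM.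
set N := nb_nonblock%:R; set s2 := (agree_sum D 5 w2)%:R.
set s3 := (agree_sum D 5 w3)%:R; set c3 := (code_blocks w3)%:R => E3 E2 E1.
have s20 : s2 != 0 by rewrite pnatr_eq0; apply/eqP.
have c30 : c3 != 0 by rewrite pnatr_eq0; apply/eqP.
have q0 : q%:R != 0 :> rat.
  by rewrite pnatr_eq0 -lt0n; apply: ltnW (finNzRing_gt1 F).
move: E1 E2 E3; move: N s2 s3 c3 q%:R k.+2%:R n0 s20 c30 q0.
move=> N s2 s3 c3 Q K n0 s20 c30 q0 E1 E2 E3.
have b60 : b6 != 0 by apply: contra_eq_neq E1 => ->; rewrite mul0r eq_sym oner_neq0.
(* The relation at [w1] is b6 N = 1. Comparing it with the one at [w2] gives b5 = b6 K; at [w3] the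
   terms in S_5 then cancel, whatever its value, and b6 q c3 = 0 remains with three nonzero
   factors. *)
have : (b5 - b6 * K) * s2 = 0.
  by apply: (addIr 1); rewrite -{1}E1 add0r -[RHS]E2; ring.
move/eqP; rewrite mulf_eq0 (negbTE s20) orbF subr_eq0 => /eqP b5E.
have : b6 * Q * c3 = 0.
  by apply: (addIr 1); rewrite -{1}E1 add0r -[RHS]E3 b5E; ring.
by move/eqP; rewrite !mulf_eq0 (negbTE b60) (negbTE q0) (negbTE c30).
Qed.

End Steiner.

(* When k = 1 the blocks span distinct lines, so a nonzero syndrome lies on at most one of them. *)
Lemma completely_regular_pcm2 (F : finFieldType) n (P : 'M[F]_(2, n)) :
  n = (1 + 7)%N -> near_mds_mx P -> steiner_mx P -> covering_radius (code_of_pcm P) = 2%N ->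
  completely_regular (code_of_pcm P).
Proof.
move=> n_def nmdsP stP R; apply: completely_regular_agree_sum R _ => v w eq0.
have S0 u : agree_sum (code_of_pcm P) 0 u = (u *m P^T == 0) :> nat.
  rewrite (agree_sum_pcm_small n_def nmdsP) // (big_pred1 set0); last first.
    by move=> U; rewrite cards_eq0.
  have -> : mask_mx F set0 = 0 :> 'M_n.
    by apply/matrixP => i j; rewrite !mxE inE mul0rn.
  by rewrite mul0mx; congr nat_of_bool; apply/idP/eqP => [/submxP[w0 ->]|->]; rewrite ?mulmx0 ?sub0mx.
have X1 u : u *m P^T != 0 -> (span_blocks P u <= 1)%N.
  move=> u0; rewrite /span_blocks -big_mkcondr /= sum1_card.
  apply/card_le1P => B; rewrite unfold_in /= => /andP[bB uB] B'.
  rewrite unfold_in /= inE; apply/andP/eqP => [[bB' uB']|->]; last by [].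
  have span B0 : block P B0 -> (u *m P^T <= mask_mx F B0 *m P^T)%MS ->
      (mask_mx F B0 *m P^T <= u *m P^T)%MS.
    case/andP=> _ /eqP Br uB0; have := mxrank_leqif_sup uB0.
    rewrite mxrank_mul_mask -/(crank P B0) Br rank_rV u0 => -[_].
    by rewrite eqxx => <-.
  have sub : (mask_mx F (B :|: B') *m P^T <= u *m P^T)%MS.
    have -> : mask_mx F (B :|: B') = mask_mx F B + mask_mx F (B' :\: B).
      apply/matrixP => i j; rewrite !mxE !inE.
      by case: (i \in B); case: (i \in B'); case: (i == j); rewrite /= ?addr0 ?add0r ?mul0rn.
    rewrite mulmxDl; apply: addmx_sub; first exact: span.
    by apply: submx_trans (span _ bB' uB'); apply: mask_mul_submx; apply: subsetDl.
  have [//|neq] := eqVneq B' B.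
  move/mxrankS: sub; rewrite mxrank_mul_mask rank_rV u0 -/(crank P (B :|: B')).
  have Bc : #|B| = 2%N by case/andP: bB => /eqP.
  have B'c : #|B'| = 2%N by case/andP: bB' => /eqP.
  rewrite (crank_large nmdsP) //.
  rewrite ltn_neqAle -{2}Bc subset_leq_card ?subsetUl // andbT.
  apply: contra neq => /eqP c.
  have BE : B = B :|: B' by apply/eqP; rewrite eqEcard subsetUl -c Bc leqnn.
  have B'E : B' = B :|: B' by apply/eqP; rewrite eqEcard subsetUr -c B'c leqnn.
  by rewrite {1}B'E -BE.
have S1 u : agree_sum (code_of_pcm P) 1 u = (2 * span_blocks P u)%N.
  exact: (agree_sum_pcm_small_blocks n_def nmdsP stP).
have S2 u : agree_sum (code_of_pcm P) 2 u = (nb_nonblock P + #|F| * span_blocks P u)%N.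
  exact: (agree_sum_pcm_mid n_def nmdsP).
have X0 u : u *m P^T = 0 -> span_blocks P u = #|[set B | block P B]|.
  move=> u0; rewrite /span_blocks u0 -sum1_card; apply: eq_big => B; first by rewrite inE.
  by rewrite sub0mx.
(* Whether the syndrome is zero, together with [span_blocks], determines S_0, S_1 and S_2. For a
   nonzero syndrome [span_blocks] is 0 or 1, and the vanishing of S_1 tells which. *)
suff XE : span_blocks P v = span_blocks P w.
  case=> [|[|[|//]]] _; rewrite ?S1 ?S2 ?XE //.
  by have := eq0 0%N isT; rewrite !S0 !eqb0 => /negb_inj->.
have := eq0 0%N isT; rewrite !S0 !eqb0 => e0; have := eq0 1%N isT; rewrite !S1.
have [v0|v0] := eqVneq (v *m P^T) 0.
  have /eqP w0 : w *m P^T == 0 by rewrite -[_ == _]negbK -e0 v0 eqxx.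
  by rewrite !X0.
have w0 : w *m P^T != 0 by rewrite -e0.
by have := X1 _ v0; have := X1 _ w0; case: (span_blocks P v) => [|[|]] //; case: (span_blocks P w) => [|[|]].
Qed.

(** * Lower bounds on the number of minimum weight words *)

Section CountingPairs.
Variables (F : finFieldType) (n : nat).
Implicit Types (C : {vspace 'rV[F]_n}) (c v x : 'rV[F]_n).

Lemma card_sphere i : #|[set x : 'rV[F]_n | wt x == i]| = ('C(n, i) * #|F|.-1 ^ i)%N.
Proof.
have cU (U : {set 'I_n}) :
    #|[set x : 'rV[F]_n | [set j | x 0 j != 0] == U]| = (#|F|.-1 ^ #|U|)%N.
  have -> : #|F|.-1 = #|predC1 (0 : F)| by rewrite cardC1.
  rewrite -(card_pffun_on 0).
  have inj : injective (fun f : {ffun 'I_n -> F} => \row_j f j).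
    by move=> f g /rowP fg; apply/ffunP => j; have := fg j; rewrite !mxE.
  rewrite -[RHS](card_imset _ inj); apply: eq_card => x; rewrite inE.
  apply/eqP/imsetP => [xU|[f /pffun_onP[fU f0] ->]].
    exists [ffun j => x 0 j]; last by apply/rowP => j; rewrite mxE ffunE.
    apply/pffun_onP; split.
      by apply/subsetP => j; rewrite inE ffunE -xU inE.
    by move=> y /mapP[j]; rewrite mem_enum -xU inE => xj ->; rewrite inE ffunE.
  apply/setP => j; rewrite inE mxE; apply/idP/idP => [fj|jU].
    by apply: (subsetP fU); rewrite inE.
  by have := f0 (f j); rewrite !inE; apply; apply: map_f; rewrite mem_enum.
rewrite -sum1_card.
rewrite (partition_big (fun x : 'rV[F]_n => [set j | x 0 j != 0])
  (fun U : {set 'I_n} => #|U| == i)) /=; last by move=> x; rewrite inE.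
transitivity (\sum_(U : {set 'I_n} | #|U| == i) #|F|.-1 ^ i)%N.
  apply: eq_bigr => U /eqP Ui; rewrite -{2}Ui -cU -sum1_card; apply: eq_bigl => x.
  by rewrite !inE; apply/andP/idP => [[]//|/eqP xU]; rewrite /wt xU Ui !eqxx.
rewrite sum_nat_const; congr muln; have := card_draws 'I_n i; rewrite card_ord => <-.
by apply: eq_card => U; rewrite [RHS]inE.
Qed.

Lemma sum_nb_at C i :
  (\sum_v nb_at C v i = #|C| * #|[set x : 'rV[F]_n | wt x == i]|)%N.
Proof.
transitivity (\sum_(v : 'rV[F]_n) \sum_(c in C) (hdist v c == i))%N.
  apply: eq_bigr => v _; rewrite /nb_at -sum1_card -big_mkcondr /=.
  by apply: eq_bigl => c; rewrite inE.
rewrite exchange_big /= -sum_nat_const; apply: eq_bigr => c _.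
rewrite (reindex_inj (addIr c)) -sum1_card big_mkcond [RHS]big_mkcond /=.
apply: eq_bigr => x _; rewrite hdistE addrK inE; case: (_ == i) => //.
Qed.

(** Translation by the first codeword moves it to 0, whence the factor [#|C|]. *)
Lemma sum_nb_at_mul C i j :
  (\sum_v nb_at C v i * nb_at C v j =
   #|C| * \sum_(c in C) #|[set x : 'rV[F]_n | wt x == i & wt (c - x) == j]|)%N.
Proof.
transitivity (\sum_(v : 'rV[F]_n) \sum_(c in C) \sum_(c' in C)
    ((hdist v c == i) && (hdist v c' == j)))%N.
  apply: eq_bigr => v _; rewrite /nb_at -!sum1_card big_distrlr /=.
  rewrite [LHS](eq_bigl (fun c => (c \in C) && (hdist v c == i))); last by move=> c; rewrite inE.
  rewrite big_mkcondr /=; apply: eq_bigr => c _; case: (hdist v c == i) => /=; last first.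
    by rewrite big1.
  rewrite -big_mkcondr /=; apply: eq_bigl => c'; by rewrite inE.
rewrite exchange_big /= -sum_nat_const; apply: eq_bigr => c Cc.
rewrite exchange_big /= (reindex_inj (addIr c)) /=.
apply: eq_big => [c'|c' _]; first by rewrite rpredDr.
rewrite (reindex_inj (addIr c)) -sum1_card big_mkcond [RHS]big_mkcond /=.
apply: eq_bigr => x _; rewrite !hdistE addrK inE.
have -> : x + c - (c' + c) = - (c' - x) by rewrite opprD addrACA subrr addr0 opprB.
by rewrite wtN; case: (_ && _).
Qed.

(** The weights leave no room for cancellation: [x] agrees with [c] on its own support and is
    therefore determined by that support, an i-subset of the support of [c]. *)
Lemma card_split_wt c i j : wt c = (i + j)%N ->
  (#|[set x : 'rV[F]_n | wt x == i & wt (c - x) == j]| <= 'C(i + j, i))%N.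
Proof.
move=> wc; rewrite -wc -cards_draws.
pose supp (x : 'rV[F]_n) := [set k | x ord0 k != 0].
have key x : wt x = i -> wt (c - x) = j ->
    forall k, x 0 k != 0 -> x 0 k = c 0 k.
  move=> xi xj k xk; apply/eqP; apply: contraT => xck.
  have sub : supp c \subset supp x :|: (supp (c - x) :\ k).
    apply/subsetP => l; rewrite !inE !mxE => cl; case: (eqVneq (x 0 l) 0) => //= xl.
    by rewrite xl subr0 cl andbT; apply: contra_neq xk => <-.
  have := leq_trans (subset_leq_card sub) (leq_card_setU _ _).1.
  have ck : k \in supp (c - x) by rewrite inE !mxE subr_eq0 eq_sym.
  have := cardsD1 k (supp (c - x)); rewrite ck.
  by rewrite -/(wt c) -/(wt x) -/(wt (c - x)) xi xj wc; move: #|_| => a; lia.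
rewrite -(@card_in_imset _ _ supp).
  apply/subset_leq_card/subsetP => U /imsetP[x]; rewrite !inE => /andP[/eqP xi /eqP xj] ->.
  rewrite -[#|_|]/(wt x) xi eqxx andbT; apply/subsetP => k; rewrite !inE => xk.
  by rewrite -(key x).
move=> x y; rewrite !inE => /andP[/eqP xi /eqP xj] /andP[/eqP yi /eqP yj] /setP xy.
apply/rowP => k; have := xy k; rewrite !inE.
have [-> /esym/negbFE/eqP->//|xk] := eqVneq (x 0 k) 0.
by move=> /esym yk; rewrite (key x xi xj k xk) (key y yi yj k yk).
Qed.

(** Two codewords at distances i and j from one vector differ by a word of weight at most i + j,
    hence by 0 or by a word of weight exactly i + j. The first case gives the diagonal term, the
    second the splittings of such a word. *)
Lemma sum_nb_at_mul_le C i j :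
  (forall c, c \in C -> c != 0 -> (i + j <= wt c)%N) ->
  (\sum_v nb_at C v i * nb_at C v j <=
   #|C| * ((i == j) * ('C(n, i) * #|F|.-1 ^ i) + 'C(i + j, i) * nb_wt C (i + j)))%N.
Proof.
move=> dC; rewrite sum_nb_at_mul leq_mul2l; apply/orP; right.
rewrite (bigD1 0) ?mem0v //=; apply: leq_add.
  rewrite -card_sphere; have [->|neq] := eqVneq i j.
    rewrite mul1n; apply/subset_leq_card/subsetP => x; rewrite !inE.
    by case/andP.
  rewrite leqn0 cards_eq0; apply/eqP/setP => x; rewrite !inE sub0r wtN.
  by apply/andP => -[/eqP-> /eqP ij]; rewrite ij eqxx in neq.
rewrite mulnC -sum_nat_const [X in (X <= _)%N](bigID (fun c => wt c == i + j)%N) /=.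
rewrite [X in (_ + X <= _)%N]big1 ?addn0; last first.
  move=> c /andP[/andP[Cc c0] wc]; apply/eqP; rewrite cards_eq0.
  apply/eqP/setP => x; rewrite !inE; apply/andP => -[/eqP xi /eqP xj].
  have := dC c Cc c0; have := wtD (c - x) x; rewrite subrK xi xj.
  by move: wc; lia.
rewrite [X in (_ <= X)%N](eq_bigl (fun c => (c \in C) && (wt c == i + j)%N)); last first.
  by move=> c; rewrite inE.
rewrite [X in (_ <= X)%N](bigID (fun c => c != 0)) /=.
apply: leq_trans (leq_addr _ _).
rewrite (eq_bigl (fun c => (c \in C) && (wt c == i + j)%N && (c != 0))); last first.
  by move=> c; rewrite andbAC.
by apply: leq_sum => c /andP[/andP[_ /eqP wc] _]; apply: card_split_wt.
Qed.

Lemma nb_at_close C d v i j c c' :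
  (forall c, c \in C -> c != 0 -> (d <= wt c)%N) -> (i + j < d)%N ->
  c \in C -> c' \in C -> hdist v c = i -> hdist v c' = j -> c = c'.
Proof.
move=> dC ijd Cc Cc' ci cj; apply/eqP; rewrite -subr_eq0; apply: contraT => cc.
have ccC : c - c' \in C by rewrite rpredB.
have := leq_trans (dC _ ccC cc) (hdist_triangle v c c'); rewrite ci cj.
by rewrite leqNgt ijd.
Qed.

Lemma nb_at_le1 C d v i :
  (forall c, c \in C -> c != 0 -> (d <= wt c)%N) -> (i + i < d)%N ->
  (nb_at C v i <= 1)%N.
Proof.
move=> dC iid; apply/card_le1P => c; rewrite inE => /andP[Cc /eqP ci] c'.
rewrite !inE; apply/andP/eqP => [[Cc' /eqP c'i]|->]; last by rewrite Cc ci.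
exact: (nb_at_close dC iid Cc' Cc c'i ci).
Qed.

Lemma nb_at_excl C d v i j :
  (forall c, c \in C -> c != 0 -> (d <= wt c)%N) -> (i + j < d)%N -> i != j ->
  (nb_at C v i == 0%N) || (nb_at C v j == 0%N).
Proof.
move=> dC ijd ij; rewrite -[_ || _]negbK negb_or; apply/andP.
case=> /nb_atP[c Cc ci] /nb_atP[c' Cc' cj].
have cc := nb_at_close dC ijd Cc Cc' ci cj.
by move: ij; rewrite -ci -cj cc eqxx.
Qed.

(* Two codewords at distance 2 from [v] sharing an entry not in [v] are at distance at most 2. *)
Lemma nb_at2_le C v :
  (forall c, c \in C -> c != 0 -> (3 <= wt c)%N) ->
  (2 * nb_at C v 2 <= n * #|F|.-1)%N.
Proof.
move=> dC; pose S := [set c in C | hdist v c == 2%N].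
have -> : (2 * nb_at C v 2 = \sum_(c in S) \sum_(i < n) (v 0%R i != c 0%R i))%N.
  rewrite mulnC -sum_nat_const; apply: eq_bigr => c; rewrite inE => /andP[_ /eqP <-].
  by rewrite -big_mkcond /= sum1_card; apply: eq_card => i; rewrite !inE.
rewrite exchange_big /= -[X in (_ <= X * _)%N]card_ord -sum_nat_const.
apply: leq_sum => i _; rewrite -big_mkcondr /= sum1_card.
have -> : #|F|.-1 = #|predC1 (v 0 i)| by rewrite cardC1.
rewrite -(@card_in_image _ _ (fun c : 'rV[F]_n => c 0 i)).
  apply/subset_leq_card/subsetP => y /imageP[c]; rewrite !unfold_in /= => /andP[_ vc] ->.
  by rewrite eq_sym.
move=> c c' /andP[+ ci] /andP[+ ci'] cc'; rewrite !inE.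
move=> /andP[Cc /eqP c2] /andP[Cc' /eqP c2'].
apply/eqP; rewrite -subr_eq0; apply: contraT => /(dC _ (rpredB Cc Cc')).
pose dif (c : 'rV[F]_n) := [set k | v ord0 k != c ord0 k].
have sub : [set k | (c - c') ord0 k != 0] \subset (dif c :\ i) :|: (dif c' :\ i).
  apply/subsetP => k; rewrite !inE !mxE subr_eq0; case: (eqVneq k i) => [->|_] /=.
    by rewrite cc' eqxx.
  by case: (eqVneq (v 0 k) (c 0 k)) => //= <-.
have := leq_trans (subset_leq_card sub) (leq_card_setU _ _).1.
have := cardsD1 i (dif c); have := cardsD1 i (dif c').
rewrite -/(hdist v c) -/(hdist v c') -/(wt (c - c')) c2 c2' !inE ci ci' /= !add1n.
by move=> -[<-] [<-] le; rewrite ltnNge le.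
Qed.

End CountingPairs.

Lemma sum_mull (T : finType) a (f : T -> nat) : (\sum_i a * f i = a * \sum_i f i)%N.
Proof. by rewrite big_distrr. Qed.

Lemma sum_addn (T : finType) (f g : T -> nat) :
  (\sum_i (f i + g i) = \sum_i f i + \sum_i g i)%N.
Proof. by rewrite big_split. Qed.

Lemma card_ternary_code (n k : nat) (C : {vspace 'rV['F_3]_n}) :
  \dim C = k -> #|C| = (3 ^ k)%N.
Proof. by move=> <-; rewrite card_vspace card_Fp. Qed.

(* Sum over v of (B_2(v) - 3)^2 >= 0, restricted to the v outside the disjoint balls of radius 1, on which B_2 vanishes. *)
Lemma min_wt4_lb (C : {vspace 'rV['F_3]_10}) :
  \dim C = 6%N -> min_dist C = 4%N -> (60 <= nb_wt C 4)%N.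
Proof.
move=> dimC /min_dist_wt/(_ isT)[_ dC].
have cC := card_ternary_code dimC.
(* The centre 3 is the value of B_2 at all vectors at distance 2 from the Golay code, which makes
   the bound sharp. *)
have pt v : (6 * nb_at C v 2 + 9 * (nb_at C v 0 + nb_at C v 1) <=
             nb_at C v 2 * nb_at C v 2 + 9)%N.
  have := @nb_at_le1 _ _ _ _ v 0%N dC isT; have := @nb_at_le1 _ _ _ _ v 1%N dC isT.
  have := @nb_at_excl _ _ _ _ v 0%N 1%N dC isT isT.
  have := @nb_at_excl _ _ _ _ v 0%N 2%N dC isT isT.
  have := @nb_at_excl _ _ _ _ v 1%N 2%N dC isT isT.
  have := (nat_Cauchy (nb_at C v 2) 3).1; rewrite -!mulnn.
  move: (nb_at C v 0) (nb_at C v 1) (nb_at C v 2) => a b c cauchy.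
  by move=> /orP[] /eqP e1 /orP[] /eqP e2 /orP[] /eqP e3; subst; lia.
have : (\sum_v (6 * nb_at C v 2 + 9 * (nb_at C v 0 + nb_at C v 1)) <=
    \sum_v (nb_at C v 2 * nb_at C v 2 + 9))%N by apply: leq_sum => v _; apply: pt.
rewrite sum_addn [X in (_ <= X)%N]sum_addn sum_nat_const ?sum_mull ?sum_addn.
have := @sum_nb_at_mul_le _ _ C 2 2 dC.
have := sum_nb_at C 0; rewrite card_sphere card_Fp // cC (_ : 'C(10, 0) * 2 ^ 0 = 1)%N //.
have := sum_nb_at C 1; rewrite card_sphere card_Fp // cC (_ : 'C(10, 1) * 2 ^ 1 = 20)%N //.
have := sum_nb_at C 2; rewrite card_sphere card_Fp // cC (_ : 'C(10, 2) * 2 ^ 2 = 180)%N //.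
(* The space has 81 times as many vectors as the code; after division by the size of the code the
   inequality reads 1269 <= 909 + 6 A_4. *)
rewrite card_mx card_Fp // mul1n (_ : 'C(4, 2) = 6%N) // (_ : (3 ^ 10 = 3 ^ 6 * 81)%N) ?(expnD 3 6 4) //.
move: (3 ^ 6)%N (expn_gt0 3 6) => q q0; move: (nb_wt C _) => A.
by move=> *; rewrite -(leq_pmul2l q0); lia.
Qed.

(* B_2(v) <= 9 for every v, and sum_v B_1(v) B_2(v) counts the words of weight 3 three times each. *)
Lemma min_wt3_lb (C : {vspace 'rV['F_3]_9}) :
  \dim C = 6%N -> min_dist C = 3%N -> (24 <= nb_wt C 3)%N.
Proof.
move=> dimC /min_dist_wt/(_ isT)[_ dC].
have cC := card_ternary_code dimC.
(* Both sides agree when [v] is within distance 1 of the code; otherwise this is B_2 <= 9, from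
   [nb_at2_le]. *)
have pt v : (nb_at C v 2 + 9 * (nb_at C v 0 + nb_at C v 1) <=
             nb_at C v 1 * nb_at C v 2 + 9)%N.
  have := @nb_at_le1 _ _ _ _ v 0%N dC isT; have := @nb_at_le1 _ _ _ _ v 1%N dC isT.
  have := @nb_at_excl _ _ _ _ v 0%N 1%N dC isT isT.
  have := @nb_at_excl _ _ _ _ v 0%N 2%N dC isT isT.
  have := nb_at2_le v dC; rewrite card_Fp //.
  move: (nb_at C v 0) (nb_at C v 1) (nb_at C v 2) => a b c c9.
  move=> /orP[] /eqP e1 /orP[] /eqP e2; case: b e1 e2 => [|[|b]]; lia.
have : (\sum_v (nb_at C v 2 + 9 * (nb_at C v 0 + nb_at C v 1)) <=
    \sum_v (nb_at C v 1 * nb_at C v 2 + 9))%N by apply: leq_sum => v _; apply: pt.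
rewrite sum_addn [X in (_ <= X)%N]sum_addn sum_nat_const ?sum_mull ?sum_addn.
have := @sum_nb_at_mul_le _ _ C 1 2 dC.
have := sum_nb_at C 0; rewrite card_sphere card_Fp // cC (_ : 'C(9, 0) * 2 ^ 0 = 1)%N //.
have := sum_nb_at C 1; rewrite card_sphere card_Fp // cC (_ : 'C(9, 1) * 2 ^ 1 = 18)%N //.
have := sum_nb_at C 2; rewrite card_sphere card_Fp // cC (_ : 'C(9, 2) * 2 ^ 2 = 144)%N //.
rewrite card_mx card_Fp // mul1n (_ : 'C(3, 1) = 3%N) // (_ : (3 ^ 9 = 3 ^ 6 * 27)%N) ?(expnD 3 6 3) //.
move: (3 ^ 6)%N (expn_gt0 3 6) => q q0; move: (nb_wt C _) => A.
by move=> *; rewrite -(leq_pmul2l q0); lia.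
Qed.

(* Sum over v of (B_1(v) - 2)^2 >= 0, restricted to the v outside the code, on which B_1 vanishes. *)
Lemma min_wt2_lb (C : {vspace 'rV['F_3]_8}) :
  \dim C = 6%N -> min_dist C = 2%N -> (8 <= nb_wt C 2)%N.
Proof.
move=> dimC /min_dist_wt/(_ isT)[_ dC].
have cC := card_ternary_code dimC.
(* The centre 2 is the value of B_1 off the Golay code, where each nonzero syndrome is a multiple of
   exactly two columns. *)
have pt v : (4 * nb_at C v 1 + 4 * nb_at C v 0 <= nb_at C v 1 * nb_at C v 1 + 4)%N.
  have := @nb_at_le1 _ _ _ _ v 0%N dC isT.
  have := @nb_at_excl _ _ _ _ v 0%N 1%N dC isT isT.
  have := (nat_Cauchy (nb_at C v 1) 2).1; rewrite -!mulnn.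
  move: (nb_at C v 0) (nb_at C v 1) => a b cauchy.
  by move=> /orP[] /eqP e1; subst; lia.
have : (\sum_v (4 * nb_at C v 1 + 4 * nb_at C v 0) <=
    \sum_v (nb_at C v 1 * nb_at C v 1 + 4))%N by apply: leq_sum => v _; apply: pt.
rewrite sum_addn [X in (_ <= X)%N]sum_addn sum_nat_const ?sum_mull ?sum_addn.
have := @sum_nb_at_mul_le _ _ C 1 1 dC.
have := sum_nb_at C 0; rewrite card_sphere card_Fp // cC (_ : 'C(8, 0) * 2 ^ 0 = 1)%N //.
have := sum_nb_at C 1; rewrite card_sphere card_Fp // cC (_ : 'C(8, 1) * 2 ^ 1 = 16)%N //.
rewrite card_mx card_Fp // mul1n (_ : 'C(2, 1) = 2%N) // (_ : (3 ^ 8 = 3 ^ 6 * 9)%N) ?(expnD 3 6 2) //.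
move: (3 ^ 6)%N (expn_gt0 3 6) => q q0; move: (nb_wt C _) => A.
by move=> *; rewrite -(leq_pmul2l q0); lia.
Qed.

(** * Computing with ternary vectors *)

(** Structural recursion, without division, so that the checks reduce well under [vm_compute]. *)
Fixpoint mod3 (a : nat) : nat := if a is a'.+3 then mod3 a' else a.

Lemma mod3E a : mod3 a = (a %% 3)%N.
Proof.
have [m] := ubnP a; elim: m a => // m IH [|[|[|a]]] //= am.
by rewrite IH; [rewrite -[a.+3]addn3 modnDr | lia].
Qed.

Lemma natF3_eq (a b : nat) : (a%:R == b%:R :> 'F_3) = (mod3 a == mod3 b).
Proof.
rewrite !mod3E -(inj_eq val_inj) /=; congr (_ == _); exact: val_Fp_nat.
Qed.

Lemma natF3_mod3 (a : nat) : (mod3 a)%:R = a%:R :> 'F_3.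
Proof. by apply/eqP; rewrite natF3_eq !mod3E modn_mod. Qed.

Definition vec (n : nat) (l : seq nat) : 'rV['F_3]_n := \row_j (nth 0%N l j)%:R.

Fixpoint words (n : nat) : seq (seq nat) :=
  if n is n'.+1 then flatten [seq [seq a :: w | w <- words n'] | a <- [:: 0; 1; 2]%N]
  else [:: [::]].

Lemma mem_words n l : (l \in words n) = (size l == n) && all (fun a => a < 3)%N l.
Proof.
elim: n l => [|n IH] l; first by case: l.
apply/flatten_mapP/idP => [[a a3 /mapP[w]]|].
  rewrite IH => /andP[/eqP sw w3] ->; rewrite /= sw eqxx w3 andbT.
  by move: a3; rewrite !inE => /or3P[] /eqP->.
case: l => // a w /= /andP[sw /andP[a3 w3]]; exists a.
  by case: a a3 => [|[|[|]]].
by apply: map_f; rewrite IH -eqSS sw.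
Qed.

Lemma uniq_words n : uniq (words n).
Proof.
elim: n => // n IH; rewrite /= cats0 !cat_uniq !map_inj_uniq ?IH /=;
  try by move=> x y [].
rewrite andbT; apply/andP; split; apply/negP => /hasP[x].
  rewrite mem_cat => /orP[] /mapP[y _ ->] /mapP[z _] //.
by move=> /mapP[y _ ->] /mapP[z _].
Qed.

Arguments words : simpl never.

Lemma vec_words n (x : 'rV['F_3]_n) : exists2 l, l \in words n & x = vec n l.
Proof.
exists [seq nat_of_ord (x 0 j) | j <- enum 'I_n].
  rewrite mem_words size_map size_enum_ord eqxx /=.
  by apply/allP => a /mapP[j _ ->]; apply: (ltn_ord (x 0 j)).
apply/rowP => j; rewrite mxE (nth_map j) ?size_enum_ord // nth_ord_enum.
by rewrite natr_Zp.
Qed.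

Lemma vec_inj n : {in words n &, injective (vec n)}.
Proof.
move=> l l'; rewrite !mem_words => /andP[/eqP sl /allP l3] /andP[/eqP sl' /allP l3'] /rowP e.
apply: (@eq_from_nth _ 0%N); first by rewrite sl sl'.
move=> i il; have := e (Ordinal (leq_trans il (eq_leq sl))); rewrite !mxE /= => /eqP.
rewrite natF3_eq !mod3E !modn_small //; first by move/eqP.
  by apply: l3'; rewrite mem_nth // sl' -sl.
by apply: l3; rewrite mem_nth.
Qed.

Lemma card_count (T : finType) (p : pred T) : #|[set x | p x]| = count p (enum T).
Proof.
rewrite -sum1_card -sum1_count big_enum_cond /=.
by apply: eq_bigl => x; rewrite inE.
Qed.

Lemma card_words n (p : pred 'rV['F_3]_n) :
  #|[set x | p x]| = count (fun l => p (vec n l)) (words n).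
Proof.
rewrite card_count -(count_map (vec n) p).
suff /seq.permP -> : perm_eq (enum 'rV['F_3]_n) [seq vec n l | l <- words n] by [].
apply: uniq_perm; rewrite ?enum_uniq //.
  by rewrite map_inj_in_uniq ?uniq_words //; apply: vec_inj.
by move=> x; rewrite mem_enum; have [l lw ->] := vec_words x; rewrite map_f.
Qed.

Fixpoint dotn (u c : seq nat) : nat :=
  if u is a :: u' then if c is b :: c' then (a * b + dotn u' c')%N else 0%N else 0%N.

Definition dot u c : nat := mod3 (dotn u c).

Lemma dotE k u c : (size u <= k)%N ->
  (dot u c)%:R = \sum_(i < k) (nth 0%N u i)%:R * (nth 0%N c i)%:R :> 'F_3.
Proof.
rewrite natF3_mod3; elim: k u c => [|k IH] [|a u] [|b c] //= su;
  rewrite ?big_ord0 ?big_ord_recl //=; try by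
    rewrite big1 ?mul0r ?mulr0 ?addr0 // => i _; rewrite ?nth_nil ?mul0r ?mulr0.
by rewrite natrD natrM IH.
Qed.

(* Matrices are given by their lists of columns. *)
Definition matc (k n : nat) (cs : seq (seq nat)) : 'M['F_3]_(k, n) :=
  \matrix_(i, j) (nth 0%N (nth [::] cs j) i)%:R.

Definition lmul (u : seq nat) (cs : seq (seq nat)) : seq nat := [seq dot u c | c <- cs].

Lemma lmulE k n u cs : (size u <= k)%N -> size cs = n ->
  vec k u *m matc k n cs = vec n (lmul u cs).
Proof.
move=> su sc; apply/rowP => j; rewrite !mxE (nth_map [::]) ?sc // (dotE _ su).
by apply: eq_bigr => i _; rewrite !mxE.
Qed.

Lemma vec_dot n u c : (size u <= n)%N -> vec n u *m (vec n c)^T = (dot u c)%:R%:M.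
Proof.
move=> su; apply/matrixP => i j; rewrite !mxE !ord1 eqxx mulr1n (dotE _ su).
by apply: eq_bigr => l _; rewrite !mxE.
Qed.

Definition wtl (l : seq nat) : nat := count (fun a => mod3 a != 0%N) l.

Lemma size_lmul u cs : size (lmul u cs) = size cs.
Proof. exact: size_map. Qed.

Lemma card_ord_count n (p : pred nat) : #|[set i : 'I_n | p i]| = count p (iota 0 n).
Proof.
by rewrite card_count -val_enum_ord count_map.
Qed.

Lemma count_nth (T : Type) (x0 : T) (p : pred T) s :
  count p s = count (fun i => p (nth x0 s i)) (iota 0 (size s)).
Proof. by rewrite -{1}(mkseq_nth x0 s) /mkseq count_map. Qed.

Lemma wt_vec n l : size l = n -> wt (vec n l) = wtl l.
Proof.
move=> sl; rewrite /wtl (count_nth 0%N) sl -card_ord_count.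
apply: eq_card => i; rewrite !inE mxE.
by rewrite -[0]/(0%:R) natF3_eq.
Qed.

Fixpoint hdl (l l' : seq nat) : nat :=
  if l is a :: l1 then if l' is b :: l1' then ((a != b) + hdl l1 l1')%N else 0%N else 0%N.

Lemma hdist_vec n l l' : size l = n -> size l' = n ->
  all (fun a => a < 3)%N l -> all (fun a => a < 3)%N l' ->
  hdist (vec n l) (vec n l') = hdl l l'.
Proof.
move=> sl sl' l3 l3'.
have -> : hdist (vec n l) (vec n l') =
    count (fun i => nth 0%N l i != nth 0%N l' i) (iota 0 n).
  rewrite -card_ord_count; apply: eq_card => i; rewrite !inE !mxE natF3_eq !mod3E.
  rewrite !modn_small //; first by apply: (allP l3'); rewrite mem_nth ?sl'.
  by apply: (allP l3); rewrite mem_nth ?sl.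
elim: n l l' sl sl' {l3 l3'} => [|n IH] [|a l] [|b l'] //= [sl] [sl'].
by rewrite -(IH l l') // (iotaDl 1 0) count_map.
Qed.

Lemma mod3_lt a : (mod3 a < 3)%N.
Proof. by rewrite mod3E ltn_mod. Qed.

Lemma all_lmul u cs : all (fun a => a < 3)%N (lmul u cs).
Proof. by apply/allP => a /mapP[c _ ->]; apply: mod3_lt. Qed.

(* [andb], [orb] and [implb] are strict under [vm_compute], hence the explicit conditionals and filters. *)
Fixpoint lazy_has (T : Type) (p : pred T) (s : seq T) : bool :=
  if s is x :: s' then if p x then true else lazy_has p s' else false.

Lemma lazy_hasE (T : Type) (p : pred T) s : lazy_has p s = has p s.
Proof. by elim: s => //= x s ->; case: (p x). Qed.

(* Subsets of the coordinates are encoded by their characteristic lists. *)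
Fixpoint masks (n : nat) : seq (seq bool) :=
  if n is n'.+1 then [seq true :: m | m <- masks n'] ++ [seq false :: m | m <- masks n']
  else [:: [::]].

Definition mask_of n (T : {set 'I_n}) : seq bool := [seq i \in T | i <- enum 'I_n].

Lemma size_mask_of n (T : {set 'I_n}) : size (mask_of T) = n.
Proof. by rewrite size_map size_enum_ord. Qed.

Lemma mem_masks n m : (m \in masks n) = (size m == n).
Proof.
elim: n m => [|n IH] m; first by case: m.
rewrite mem_cat; case: m => [|b m].
  by apply/negbTE/norP; split; apply/negP => /mapP[].
rewrite /= eqSS -IH; apply/orP/idP => [[] /mapP[m' m'm [_ ->]] //|mn].
by case: b; [left | right]; apply: map_f.
Qed.

Lemma uniq_masks n : uniq (masks n).
Proof.
elim: n => // n IH; rewrite /= cat_uniq !map_inj_uniq ?IH /=; try by move=> x y [].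
by rewrite andbT; apply/hasPn => m /mapP[m' _ ->]; apply/negP => /mapP[].
Qed.

Lemma nth_mask_of n (T : {set 'I_n}) (i : 'I_n) : nth false (mask_of T) i = (i \in T).
Proof. by rewrite (nth_map i) ?size_enum_ord // nth_ord_enum. Qed.

Arguments masks : simpl never.

Lemma mask_of_inj n : injective (@mask_of n).
Proof. by move=> T U TU; apply/setP => i; rewrite -!nth_mask_of TU. Qed.

Lemma masks_mask_of n m : m \in masks n -> exists T : {set 'I_n}, mask_of T = m.
Proof.
rewrite mem_masks => /eqP sm; exists [set i : 'I_n | nth false m i].
apply: (@eq_from_nth _ false); rewrite size_mask_of // => i iN.
by rewrite (nth_mask_of _ (Ordinal iN)) inE.
Qed.

Lemma mask_of_in n (T : {set 'I_n}) : mask_of T \in masks n.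
Proof. by rewrite mem_masks size_mask_of. Qed.

Lemma card_mask_of n (T : {set 'I_n}) : #|T| = count id (mask_of T).
Proof.
rewrite count_map -(@card_count _ (fun i => i \in T)).
by apply: eq_card => i; rewrite inE.
Qed.

Lemma card_masks n (p : pred (seq bool)) :
  #|[set T : {set 'I_n} | p (mask_of T)]| = count p (masks n).
Proof.
have -> : #|[set T : {set 'I_n} | p (mask_of T)]| =
    count p [seq mask_of T | T <- enum {set 'I_n}].
  by rewrite count_map card_count.
suff /seq.permP -> : perm_eq [seq mask_of T | T <- enum {set 'I_n}] (masks n) by [].
apply: uniq_perm; rewrite ?uniq_masks //.
  by rewrite map_inj_uniq ?enum_uniq //; apply: mask_of_inj.
move=> m; apply/mapP/idP => [[T _ ->]|/masks_mask_of[T <-]]; first exact: mask_of_in.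
by exists T; rewrite ?mem_enum.
Qed.

Fixpoint eq_on (m : seq bool) (l l' : seq nat) : bool :=
  if m is b :: m' then
    if l is a :: l1 then if l' is a' :: l1' then
      if (if b then a == a' else true) then eq_on m' l1 l1' else false
    else true else true
  else true.

Lemma eq_onE m l l' : size l = size m -> size l' = size m ->
  eq_on m l l' = all (fun i => nth false m i ==> (nth 0%N l i == nth 0%N l' i)) (iota 0 (size m)).
Proof.
elim: m l l' => [|b m IH] [|a l] [|a' l'] //= [sl] [sl'].
by rewrite IH // (iotaDl 1 0) all_map.
Qed.

Lemma eq_onP n (T : {set 'I_n}) l l' : size l = n -> size l' = n ->
  all (fun a => a < 3)%N l -> all (fun a => a < 3)%N l' ->
  reflect (forall i, i \in T -> vec n l 0 i = vec n l' 0 i) (eq_on (mask_of T) l l').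
Proof.
move=> sl sl' l3 l3'; rewrite eq_onE ?size_mask_of //.
have E (i : 'I_n) : (vec n l 0 i == vec n l' 0 i) = (nth 0%N l i == nth 0%N l' i).
  rewrite !mxE natF3_eq !mod3E !modn_small //.
    by apply: (allP l3'); rewrite mem_nth ?sl'.
  by apply: (allP l3); rewrite mem_nth ?sl.
apply: (iffP allP) => [H i Ti|H i].
  have := H i; rewrite mem_iota /= nth_mask_of Ti -E => /(_ _)/eqP; apply.
  exact: ltn_ord.
rewrite mem_iota /= add0n => iN; rewrite -[i]/(val (Ordinal iN)) nth_mask_of -E.
by apply/implyP => /H ->.
Qed.

Lemma row_free_kernelP (F : fieldType) m n (B : 'M[F]_(m, n)) :
  reflect (forall u : 'rV_m, u *m B = 0 -> u = 0) (row_free B).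
Proof.
rewrite -kermx_eq0; apply: (iffP rowV0P) => H u.
  by move=> /sub_kermxP/H.
by move=> /sub_kermxP/H.
Qed.

(** The columns of the cokernel serve as test vectors. Over F_3 this turns membership in a span into
    finitely many orthogonality tests. *)
Lemma submx_kernelP (F : fieldType) m n (B : 'M[F]_(m, n)) (s : 'rV_n) :
  reflect (forall u : 'rV_n, B *m u^T = 0 -> s *m u^T = 0) (s <= B)%MS.
Proof.
apply: (iffP idP) => [/submxP[x ->] u Bu|H]; first by rewrite -mulmxA Bu mulmx0.
rewrite submxE; apply/eqP/matrixP => i j; rewrite ord1.
have := H (col j (cokermx B))^T.
rewrite trmxK colE mulmxA mulmx_coker mul0mx => /(_ erefl).
by rewrite mulmxA -colE => /matrixP/(_ 0 0); rewrite mxE => ->; rewrite !mxE.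
Qed.

Section TernaryData.
Variables (k n : nat) (Pc : seq (seq nat)).
Hypotheses (n_def : n = (k + 7)%N) (size_Pc : size Pc = n).
Implicit Types (T U : {set 'I_n}).

Local Notation P := (matc k.+1 n Pc).
Local Notation W := (words k.+1).

Definition gen_words : seq (seq nat) := [seq lmul u Pc | u <- words k.+1].

Definition zeros : seq nat := nseq n 0%N.

Lemma vec_zeros : vec n zeros = 0.
Proof. by apply/rowP => j; rewrite !mxE nth_nseq if_same. Qed.

Lemma lmul_words u : u \in W -> vec k.+1 u *m P = vec n (lmul u Pc).
Proof. by rewrite mem_words => /andP[/eqP su _]; rewrite lmulE ?su. Qed.

Lemma gen_wordsP (c : 'rV['F_3]_n) :
  reflect (exists2 l, l \in gen_words & c = vec n l) (c \in code_of_gen P).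
Proof.
apply: (iffP (mem_code_of_gen _ _)) => [[u ->]|[l /mapP[u uw ->] ->]].
  have [l lw ->] := vec_words u; exists (lmul l Pc); first exact: map_f.
  exact: lmul_words.
by exists (vec k.+1 u); rewrite lmul_words.
Qed.

Lemma gen_words_wf l : l \in gen_words -> size l = n /\ all (fun a => a < 3)%N l.
Proof. by case/mapP => u _ ->; rewrite size_lmul all_lmul. Qed.

Lemma words_wf m l : l \in words m -> size l = m /\ all (fun a => a < 3)%N l.
Proof. by rewrite mem_words => /andP[/eqP ->]. Qed.

Lemma zeros_wf : size zeros = n /\ all (fun a => a < 3)%N zeros.
Proof. by rewrite size_nseq; split=> //; apply/allP => a /nseqP[->]. Qed.

Definition inj_check : bool :=
  all (fun u => (wtl (lmul u Pc) == 0%N) ==> (wtl u == 0%N)) W.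

Lemma rank_matc : inj_check -> \rank P = k.+1.
Proof.
move=> /allP inj; apply/eqP; apply/row_free_kernelP => u.
have [l lw ->] := vec_words u; rewrite lmul_words // => /eqP.
have [sl _] := words_wf lw.
rewrite -!wt_eq0 !wt_vec ?size_lmul // => l0; apply/eqP.
by rewrite -wt_eq0 wt_vec //; apply: (implyP (inj l lw)).
Qed.

Definition solv_in (D : seq (seq nat)) (m : seq bool) (e : seq nat) : bool :=
  lazy_has (eq_on m e) D.

Local Notation solvD := (solv_in gen_words).

Lemma solvDP T e : e \in words n ->
  (vec n e *m mask_mx 'F_3 T <= P *m mask_mx 'F_3 T)%MS = solvD (mask_of T) e.
Proof.
move=> /words_wf[se e3]; rewrite /solv_in lazy_hasE; apply/submxP/hasP => [[u]|[l]].
  have [l lw ->] := vec_words u; rewrite mulmxA lmul_words // => eT.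
  exists (lmul l Pc); first exact: map_f.
  by apply/eq_onP; rewrite ?size_lmul ?all_lmul // => i Ti; apply: (mul_mask_eq _ _ _).2 eT _ _ Ti.
move=> lg; have [sl l3] := gen_words_wf lg.
move/eq_onP => /(_ se sl e3 l3) el; case/mapP: lg sl l3 el => u uw -> _ _ el.
exists (vec k.+1 u); rewrite mulmxA lmul_words //.
by apply: (mul_mask_eq _ _ _).1 => i j Tj; rewrite !ord1 el.
Qed.

(** Membership of [s] in the span of the columns selected by [m], tested against every vector
    orthogonal to these columns. *)
Definition solvA (m : seq bool) (s : seq nat) : bool :=
  all (fun u => eq_on m (lmul u Pc) zeros ==> (dot u s == 0%N)) W.

Lemma eq_on_zeros T u : u \in W ->
  eq_on (mask_of T) (lmul u Pc) zeros = (vec k.+1 u *m (P *m mask_mx 'F_3 T) == 0).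
Proof.
move=> uw; have [sz z3] := zeros_wf.
apply/eq_onP/eqP; rewrite ?size_lmul ?all_lmul // => H.
  rewrite mulmxA lmul_words // -(mul0mx _ (mask_mx 'F_3 T)) -vec_zeros.
  by apply: (mul_mask_eq _ _ _).1 => i j Tj; rewrite !ord1 H.
move=> i Ti; rewrite -lmul_words //.
apply: ((mul_mask_eq _ _ _).2 _ _ _ Ti).
by rewrite -mulmxA H vec_zeros mul0mx.
Qed.

Lemma dot_eq0 u s m : size u = m ->
  (dot u s == 0%N) = (vec m u *m (vec m s)^T == 0).
Proof.
move=> su; rewrite vec_dot ?su //; apply/eqP/eqP => [->|/matrixP/(_ 0 0)].
  by apply/matrixP => i j; rewrite !mxE mul0rn.
rewrite !mxE /= => /eqP; rewrite -[0]/(0%:R) natF3_eq /dot !mod3E modn_mod => /eqP.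
by rewrite -mod3E.
Qed.

Lemma solvAP U s : s \in W ->
  (vec k.+1 s <= mask_mx 'F_3 U *m P^T)%MS = solvA (mask_of U) s.
Proof.
move=> sw; apply/submx_kernelP/allP => [H u uw|H u].
  have [su _] := words_wf uw; apply/implyP; rewrite eq_on_zeros // => /eqP uP.
  rewrite (dot_eq0 _ su) -trmx_eq0 trmx_mul trmxK H //.
  by apply/trmx_inj; rewrite trmx0 !trmx_mul !trmxK mask_mx_tr.
have [l lw ->] := vec_words u; have [sl _] := words_wf lw.
move=> /(congr1 trmx); rewrite trmx0 !trmx_mul !trmxK mask_mx_tr => /eqP uP.
have := implyP (H l lw); rewrite eq_on_zeros // => /(_ uP).
by rewrite (dot_eq0 _ sl) -trmx_eq0 trmx_mul trmxK => /eqP.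
Qed.

(** The k + 1 selected columns have length k + 1, so they are dependent exactly when a nonzero
    vector is orthogonal to all of them. *)
Definition blockb (m : seq bool) : bool :=
  if count id m == k.+1
  then has (fun u => eq_on m (lmul u Pc) zeros && (wtl u != 0%N)) W else false.

Lemma blockP T : near_mds_mx P -> block P T = blockb (mask_of T).
Proof.
move=> nmds; rewrite /block /blockb -card_mask_of; case: eqVneq => //= Tc.
have -> : (crank P T == k) = ~~ row_free (P *m mask_mx 'F_3 T).
  by rewrite /row_free -/(crank P T) (crank_mid n_def nmds) //; case: ifP => _; rewrite ?eqxx; lia.
apply/idP/idP => [|/hasP[u uw /andP[]]].
  apply: contraR => /hasPn H; apply/row_free_kernelP => u.
  have [l lw ->] := vec_words u => uP.
  have [sl _] := words_wf lw; apply/eqP; rewrite -wt_eq0 wt_vec //.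
  by have := H l lw; rewrite eq_on_zeros // uP eqxx /= negbK.
rewrite eq_on_zeros // => /eqP uP; apply: contra => /row_free_kernelP/(_ _ uP)/eqP.
by have [su _] := words_wf uw; rewrite -wt_eq0 wt_vec.
Qed.

Section Lift.
Variables (L : finFieldType) (iota : {rmorphism 'F_3 -> L}) (s : nat) (a : 'I_s -> L).
Hypothesis indep : forall c : 'I_s -> 'F_3, \sum_l a l * iota (c l) = 0 -> forall l, c l = 0.

Definition comb m (es : seq (seq nat)) : 'rV[L]_m :=
  \sum_l a l *: map_mx iota (vec m (nth [::] es l)).

Lemma comb_mx_eq0 m p (E : 'I_s -> 'M['F_3]_(m, p)) :
  \sum_l a l *: map_mx iota (E l) = 0 -> forall l, E l = 0.
Proof.
move=> /matrixP E0 l; apply/matrixP => i j; rewrite mxE.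
apply: (indep (c := fun l => E l i j)); have := E0 i j; rewrite summxE [RHS]mxE => E0ij; rewrite -[RHS]E0ij.
by apply: eq_bigr => l' _; rewrite !mxE.
Qed.

(** The cokernel of the lifted matrix has entries in F_3, so membership is a set of linear equations
    over F_3, which independent coefficients split into one set for each component. *)
Lemma comb_submx m p (B : 'M['F_3]_(m, p)) (E : 'I_s -> 'rV['F_3]_p) :
  ((\sum_l a l *: map_mx iota (E l))%R <= map_mx iota B)%MS = [forall l, (E l <= B)%MS].
Proof.
apply/idP/forallP => [|H]; last first.
  by apply: summx_sub => l _; rewrite scalemx_sub // map_submx.
rewrite submxE -map_cokermx mulmx_suml => /eqP H l; rewrite submxE; apply/eqP.
apply: (comb_mx_eq0 (E := fun l => E l *m cokermx B)); rewrite -[RHS]H.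
by apply: eq_bigr => l' _; rewrite -scalemxAl map_mxM.
Qed.

Lemma forall_nth (p : pred (seq nat)) es : size es = s ->
  [forall l : 'I_s, p (nth [::] es l)] = all p es.
Proof.
move=> ss; apply/forallP/(all_nthP [::]) => [H i|H l].
  by rewrite ss => il; apply: (H (Ordinal il)).
by apply: H; rewrite ss.
Qed.

Lemma comb_solvD T es : size es = s -> all (fun e => e \in words n) es ->
  (comb n es *m mask_mx L T <= map_mx iota P *m mask_mx L T)%MS = all (solvD (mask_of T)) es.
Proof.
move=> ss /allP ew; rewrite -(map_mask_mx iota) -map_mxM mulmx_suml.
rewrite (eq_bigr (fun l => a l *: map_mx iota (vec n (nth [::] es l) *m mask_mx 'F_3 T))); last first.
  by move=> l _; rewrite -scalemxAl map_mxM.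
rewrite comb_submx -forall_nth //; apply: eq_forallb => l.
by rewrite solvDP // ew // mem_nth // ss.
Qed.

Lemma comb_solvA U ss : size ss = s -> all (fun e => e \in W) ss ->
  (comb k.+1 ss <= mask_mx L U *m (map_mx iota P)^T)%MS = all (solvA (mask_of U)) ss.
Proof.
move=> szs /allP sw; rewrite -(map_mask_mx iota) map_trmx -map_mxM comb_submx -forall_nth //.
by apply: eq_forallb => l; rewrite solvAP // sw // mem_nth // szs.
Qed.

Lemma ex_syndrome (v : 'rV[L]_k.+1) : inj_check ->
  exists w : 'rV[L]_n, w *m (map_mx iota P)^T = v.
Proof.
move=> inj; have : (v <= (map_mx iota P)^T)%MS.
  by rewrite submx_full // /row_full mxrank_tr mxrank_map rank_matc.
by case/submxP => w ->; exists w.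
Qed.

Lemma masks_all (b p : pred (seq bool)) :
  all p [seq m <- masks n | b m] -> forall T, b (mask_of T) -> p (mask_of T).
Proof. by move=> /allP H T aT; apply: H; rewrite mem_filter aT mask_of_in. Qed.

(** The masks mark the coordinates of agreement, hence their size n - i. *)
Definition far_check i es : bool :=
  let D := gen_words in
  all (fun m => ~~ all (solv_in D m) es) [seq m <- masks n | (count id m == n - i)%N].

Lemma agree_sum_gen_far i es : (i <= n)%N ->
  size es = s -> all (fun e => e \in words n) es -> far_check i es ->
  agree_sum (code_of_gen (map_mx iota P)) i (comb n es) = 0%N.
Proof.
move=> lein ss ew /masks_all far; apply: big1 => T; rewrite card_setC_eq // => Tc.
have := far T; rewrite -card_mask_of Tc => /(_ isT) nsol.
by rewrite agree_gen comb_solvD // (negbTE nsol).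
Qed.

Definition close_check i es : bool :=
  let D := gen_words in
  has (fun m => all (solv_in D m) es) [seq m <- masks n | (count id m == n - i)%N].

Lemma agree_sum_gen_close i es : (i <= n)%N ->
  size es = s -> all (fun e => e \in words n) es -> close_check i es ->
  agree_sum (code_of_gen (map_mx iota P)) i (comb n es) <> 0%N.
Proof.
move=> lein ss ew /hasP[m]; rewrite mem_filter => /andP[+ /masks_mask_of[T mT]].
rewrite -mT -card_mask_of -card_setC_eq // => Tc sol /eqP.
rewrite sum_nat_eq0 => /forall_inP/(_ _ Tc).
by rewrite agree_gen comb_solvD // sol expn_eq0 -(negbK (_ == 0%N)) -lt0n ltnW ?finNzRing_gt1.
Qed.

Definition blocks_far_check es : bool :=
  let D := gen_words in
  all (fun m => ~~ all (solv_in D m) es) [seq m <- masks n | blockb m].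

Definition blocks_close_check es : bool :=
  let D := gen_words in
  has (fun m => all (solv_in D m) es) [seq m <- masks n | blockb m].

Lemma block_map T : near_mds_mx P -> block (map_mx iota P) T = blockb (mask_of T).
Proof. by move=> nmds; rewrite -blockP // /block crank_map. Qed.

Lemma code_blocks_far es : near_mds_mx P ->
  size es = s -> all (fun e => e \in words n) es -> blocks_far_check es ->
  code_blocks (map_mx iota P) (comb n es) = 0%N.
Proof.
move=> nmds ss ew /masks_all far; apply: big1 => T; rewrite block_map // => bT.
by rewrite comb_solvD //; have := far T bT => /negbTE ->.
Qed.

Lemma code_blocks_close es : near_mds_mx P ->
  size es = s -> all (fun e => e \in words n) es -> blocks_close_check es ->
  code_blocks (map_mx iota P) (comb n es) <> 0%N.
Proof.
move=> nmds ss ew /hasP[m]; rewrite mem_filter => /andP[+ /masks_mask_of[T mT]].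
rewrite -mT => bT sol /eqP.
rewrite sum_nat_eq0 => /forall_inP/(_ T); rewrite block_map // => /(_ bT).
by rewrite comb_solvD // sol.
Qed.

Lemma agree_sum_pcm_count i (w : 'rV[L]_n) ss : near_mds_mx P -> (i <= k)%N ->
  size ss = s -> all (fun e => e \in W) ss -> w *m (map_mx iota P)^T = comb k.+1 ss ->
  agree_sum (code_of_pcm (map_mx iota P)) i w =
  count (fun m => (count id m == i) && all (solvA m) ss) (masks n).
Proof.
move=> nmds leik szs sw wE.
rewrite (agree_sum_pcm_small n_def (near_mds_map iota nmds)) // wE -card_masks.
rewrite -big_mkcondr /= sum1_card; apply: eq_card => U.
by rewrite [RHS]inE -card_mask_of -comb_solvA.
Qed.

End Lift.

End TernaryData.

(** * Lifts of ternary codes *)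

Section Independence.
Variables (L : finFieldType) (iota : {rmorphism 'F_3 -> L}).

Definition indepF3 (s : nat) (a : nat -> L) : Prop :=
  forall c : 'I_s -> 'F_3, \sum_(l < s) a l * iota (c l) = 0 -> forall l, c l = 0.

Lemma indepF3_span_inj s a : indepF3 s a ->
  injective (fun c : {ffun 'I_s -> 'F_3} => \sum_(l < s) a l * iota (c l)).
Proof.
move=> ia c d /eqP; rewrite -subr_eq0 -sumrB => /eqP cd; apply/ffunP => l.
apply/eqP; rewrite -subr_eq0; apply/eqP; apply: (ia (fun l => c l - d l)).
by rewrite -[RHS]cd; apply: eq_bigr => i _; rewrite rmorphB mulrBr.
Qed.

(** Greedy choice: s coefficients span at most 3 ^ s elements, so a field with at least 3 ^ s.+1
    elements has one outside their span. *)
Lemma ex_indepF3 s : (3 ^ s <= #|L|)%N -> exists a, indepF3 s a.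
Proof.
elim: s => [|s IH] le; first by exists (fun=> 0) => c _ [].
have [a ia] := IH (leq_trans (leq_pexp2l (isT : (0 < 3)%N) (leqnSn s)) le).
pose f (c : {ffun 'I_s -> 'F_3}) := \sum_(l < s) a l * iota (c l).
have [x nx] : exists x, x \notin codom f.
  apply/existsP; rewrite -negb_forall; apply/negP => /forallP sur.
  have : (#|L| <= 3 ^ s)%N.
    rewrite -[X in (_ <= X ^ _)%N](card_Fp (isT : prime 3)) -[X in (_ <= _ ^ X)%N]card_ord -card_ffun.
    apply: leq_trans (leq_image_card f predT).
    by apply/subset_leq_card/subsetP => x _; apply: sur.
  by rewrite leqNgt; apply/negP/negPn; apply: leq_trans le; rewrite ltn_exp2l.
exists (fun l => if l == s then x else a l) => c.
rewrite big_ord_recr /= eqxx.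
rewrite (eq_bigr (fun l : 'I_s => a l * iota (c (widen_ord (leqnSn s) l)))); last first.
  by move=> l _; rewrite ltn_eqF.
have [c0|c0] := eqVneq (c ord_max) 0.
  rewrite c0 rmorph0 mulr0 addr0 => sum0 l.
  have [j ->|->] := unliftP ord_max l; last exact: c0.
  rewrite -[RHS](ia (fun j => c (widen_ord (leqnSn s) j)) sum0 j).
  by congr c; apply/val_inj; rewrite /= /bump leqNgt ltn_ord.
move/eqP; rewrite addrC addr_eq0 => /eqP xE.
case/negP: nx; apply/codomP; exists [ffun l => - c (widen_ord (leqnSn s) l) / c ord_max].
have c0' : iota (c ord_max) != 0 by rewrite fmorph_eq0.
rewrite /f; apply: (mulIf c0'); rewrite xE -sumrN mulr_suml; apply: eq_bigr => l _.
by rewrite -mulrA ffunE rmorphM rmorphN fmorphV -mulrA mulVf // mulr1 mulrN.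
Qed.

Lemma indepF3_span s a (y : L) : indepF3 s a -> #|L| = (3 ^ s)%N ->
  exists c : {ffun 'I_s -> 'F_3}, y = \sum_(l < s) a l * iota (c l).
Proof.
move=> ia Ls; have := inj_card_onto (indepF3_span_inj ia).
rewrite card_ffun card_Fp // card_ord Ls leqnn => /(_ isT y)/codomP[c ->].
by exists c.
Qed.

(** In a field of exactly 3 ^ s elements the coefficients form a basis over F_3. Every syndrome is
    then a combination, so that covering claims over [L] can be checked on s-tuples of words over
    F_3. *)
Lemma indepF3_row_span s a m (v : 'rV[L]_m) : indepF3 s a -> #|L| = (3 ^ s)%N ->
  exists ss, [/\ size ss = s, all (fun l => l \in words m) ss &
                 v = comb iota (fun l : 'I_s => a l) m ss].
Proof.
move=> ia Ls.
have /fin_all_exists[c cE] : forall j : 'I_m, exists c : {ffun 'I_s -> 'F_3},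
    v 0 j = \sum_(l < s) a l * iota (c l) by move=> j; apply: indepF3_span.
have /fin_all_exists[w wE] : forall l : 'I_s, exists w, w \in words m /\
    \row_j c j l = vec m w.
  by move=> l; have [w ww wE] := vec_words (\row_j c j l); exists w.
have nthw (l : 'I_s) : nth [::] [seq w l | l <- enum 'I_s] l = w l.
  by rewrite (nth_map l) ?size_enum_ord // nth_ord_enum.
exists [seq w l | l <- enum 'I_s]; split; first by rewrite size_map size_enum_ord.
  by apply/allP => x /mapP[l _ ->]; case: (wE l).
apply/rowP => j; rewrite cE summxE; apply: eq_bigr => l _.
by rewrite nthw -(wE l).2 !mxE.
Qed.

End Independence.

Definition units (m : nat) : seq (seq nat) :=
  [seq [seq nat_of_bool (i == j) | i <- iota 0 m] | j <- iota 0 m].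

Lemma vec_units m (i : 'I_m) : vec m (nth [::] (units m) i) = delta_mx 0 i.
Proof.
apply/rowP => j; rewrite !mxE (nth_map 0%N) ?size_iota // (nth_map 0%N) ?size_iota //.
by rewrite !nth_iota.
Qed.

Lemma units_words m (i : 'I_m) : nth [::] (units m) i \in words m.
Proof.
rewrite mem_words (nth_map 0%N) ?size_iota // size_map size_iota eqxx.
by apply/allP => a /mapP[j _ ->]; case: (_ == _).
Qed.

Section Normals.
Variables (k n : nat) (Pc : seq (seq nat)).

(** One entry for each i-set of columns: the vectors over F_3 orthogonal to all of them. The
    products with the columns are computed once for all masks. *)
Definition normals (i : nat) : seq (seq (seq nat)) :=
  let uD := [seq (u, lmul u Pc) | u <- words k.+1] in
  [seq [seq p.1 | p <- uD & eq_on m p.2 (zeros n)] | m <- masks n & count id m == i].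

Definition orthog (N : seq (seq nat)) (s : seq nat) : bool :=
  all (fun u => dot u s == 0%N) N.

Lemma count_normals i ss :
  count (fun m => (count id m == i) && all (solvA k n Pc m) ss) (masks n) =
  count (fun N => all (orthog N) ss) (normals i).
Proof.
rewrite count_map count_filter; apply: eq_count => m /=; rewrite andbC.
congr (_ && _); apply: eq_all => s.
by rewrite /orthog all_map all_filter all_map.
Qed.

End Normals.

Section Instance.
Variables (k n : nat) (Pc Gc : seq (seq nat)).
Hypotheses (n_def : n = (k + 7)%N) (size_Pc : size Pc = n) (size_Gc : size Gc = n).
Hypotheses (injP : inj_check k Pc) (injG : inj_check 5 Gc).
Hypothesis orthPG :
  all (fun u => all (fun w => dot (lmul u Pc) (lmul w Gc) == 0%N) (units 6)) (units k.+1).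
Hypothesis wtD : all (fun l => wtl l \in [:: 0; 6; 9]%N) (gen_words k Pc).
Hypothesis wtA : all (fun l => (wtl l == 0) || (k < wtl l))%N (gen_words 5 Gc).

Local Notation P := (matc k.+1 n Pc).
Local Notation G := (matc 6 n Gc).

(** Orthogonality of the rows gives one inclusion, and both sides have dimension 6 = n - (k + 1). *)
Lemma code_of_gen_pcm : code_of_gen G = code_of_pcm P.
Proof.
apply/eqP; rewrite eqEdim dim_code_of_gen dim_code_of_pcm (rank_matc size_Pc) //.
rewrite (rank_matc size_Gc) // (_ : n - k.+1 = 6)%N ?leqnn ?andbT; last by rewrite n_def -[k.+1]addn1 subnDl.
apply/subvP => c /mem_code_of_gen[u ->]; rewrite mem_code_of_pcm.
suff PG : P *m G^T = 0 by rewrite trmx_mul mulmxA PG mul0mx.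
apply/row_matrixP => i; rewrite row_mul row0; apply/trmx_inj/row_matrixP => j.
rewrite trmx_mul trmxK row_mul trmx0 row0 !rowE -!vec_units.
rewrite !lmul_words ?units_words //; apply/trmx_inj; rewrite trmx0 trmx_mul trmxK.
have mu m (l : 'I_m) : nth [::] (units m) l \in units m.
  by rewrite mem_nth // size_map size_iota.
apply/eqP; rewrite -dot_eq0 ?size_lmul //.
exact: (allP (allP orthPG _ (mu _ i)) _ (mu _ j)).
Qed.

Lemma wt_gen_cases c : c \in code_of_gen P -> [|| c == 0, wt c == 6%N | wt c == 9%N].
Proof.
case/(gen_wordsP _ size_Pc) => l lP ->; have [sl _] := gen_words_wf size_Pc lP.
by rewrite -wt_eq0 !wt_vec //; have := allP wtD l lP; rewrite !inE.
Qed.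

Lemma near_mds_matc : near_mds_mx P.
Proof.
apply: near_mds_of_dist; rewrite ?rank_matc // => c.
  by move=> /wt_gen_cases /or3P[->//|/eqP->|/eqP->].
rewrite -code_of_gen_pcm => /(gen_wordsP _ size_Gc)[l lG ->].
have [sl _] := gen_words_wf size_Gc lG.
by rewrite -wt_eq0 wt_vec // => /negbTE l0; have := allP wtA l lG; rewrite l0.
Qed.

Lemma steiner_matc : steiner_mx P.
Proof.
apply: (steiner_of_wt7 n_def near_mds_matc) => c /wt_gen_cases.
by case/or3P => [/eqP->|/eqP->|/eqP->]; rewrite ?wt0.
Qed.

End Instance.

Section Lift.
Variables (k n : nat) (Pc : seq (seq nat)).
Hypotheses (n_def : n = (k + 7)%N) (size_Pc : size Pc = n) (injP : inj_check k Pc).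

Local Notation P := (matc k.+1 n Pc).

Hypotheses (nmdsP : near_mds_mx P) (stP : steiner_mx P).
Variables (L : finFieldType) (iota : {rmorphism 'F_3 -> L}).

Local Notation PL := (map_mx iota P).

Lemma near_mds_lift : near_mds_mx PL.
Proof. exact: near_mds_map nmdsP. Qed.

Lemma steiner_lift : steiner_mx PL.
Proof. exact: steiner_map stP. Qed.

Lemma lift_dual_max q : #|L| = q ->
  [/\ \dim (lift_code iota (code_of_gen P)) = k.+1,
      min_dist (lift_code iota (code_of_gen P)) = 6%N,
      (nb_wt (lift_code iota (code_of_gen P)) 6)%:R = Amax n k.+1 q
    & forall C : {vspace 'rV[L]_n}, NMDS C -> \dim C = k.+1 ->
        (nb_wt C 6 <= nb_wt (lift_code iota (code_of_gen P)) 6)%N].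
Proof.
have nm := near_mds_lift; have st := steiner_lift.
move=> <-; rewrite lift_code_of_gen; split.
- exact: dim_gen.
- exact: min_dist_gen.
- exact: nb_wt6_Amax.
- exact: nb_wt6_max.
Qed.

Lemma lift_dual_nb_wt7 : nb_wt (lift_code iota (code_of_gen P)) 7 = 0%N.
Proof. by rewrite lift_code_of_gen; apply: nb_wt7_gen; [| exact: near_mds_lift | exact: steiner_lift]. Qed.

(** No i columns have a span containing all the components. For i = k a vector with the combined
    syndrome has S_k = 0, hence lies at distance k + 1 from the lifted code. *)
Definition syn_far_check i (ss : seq (seq nat)) : bool :=
  ~~ has (fun N => all (orthog N) ss) (normals k n Pc i).

Lemma lift_UPWS s ss : (3 ^ s <= #|L|)%N ->
  size ss = s -> all (fun l => l \in words k.+1) ss -> syn_far_check k ss ->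
  [/\ code_params (lift_code iota (code_of_pcm P)) 6 k.+1 k.+1,
      UPWS (lift_code iota (code_of_pcm P)) & NMDS (lift_code iota (code_of_pcm P))].
Proof.
have nm := near_mds_lift; have st := steiner_lift.
move=> sL szs sw far; have [a ia] := ex_indepF3 iota sL.
rewrite lift_code_of_pcm.
have [w wE] := ex_syndrome size_Pc iota (comb iota (fun l : 'I_s => a l) k.+1 ss) injP.
have R : covering_radius (code_of_pcm PL) = k.+1.
  apply: (covering_radius_pcm n_def nm (v := w)).
  rewrite (agree_sum_pcm_count n_def size_Pc ia nmdsP (leqnn k) szs sw wE).
  by rewrite count_normals; apply/eqP; rewrite -leqn0 leqNgt -has_count.
split.
- by split; [exact: dim_pcm | exact: min_dist_pcm |].
- exact: UPWS_pcm.
- exact: NMDS_pcm.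
Qed.

Definition not_UPWS_check (es1 es2 es3 : seq (seq nat)) : bool :=
  [&& far_check k n Pc 5 es1, blocks_far_check k n Pc es1,
      far_check k n Pc 4 es2, close_check k n Pc 5 es2, blocks_far_check k n Pc es2,
      far_check k n Pc 4 es3 & blocks_close_check k n Pc es3].

Lemma lift_dual_not_UPWS s es1 es2 es3 : (3 ^ s <= #|L|)%N ->
  all (fun es => (size es == s) && all (fun e => e \in words n) es) [:: es1; es2; es3] ->
  not_UPWS_check es1 es2 es3 ->
  [/\ code_params (lift_code iota (code_of_gen P)) k.+1 6 6,
      NMDS (lift_code iota (code_of_gen P)) & ~ UPWS (lift_code iota (code_of_gen P))].
Proof.
have nm := near_mds_lift; have st := steiner_lift.
move=> sL /and4P[/andP[/eqP s1 w1] /andP[/eqP s2 w2] /andP[/eqP s3 w3] _].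
case/and4P => f1 b1 f2 /and4P[c2 b2 f3 b3]; have [a ia] := ex_indepF3 iota sL.
have nmK := nmdsP.
have le5 : (5 <= n)%N by rewrite n_def; apply: leq_trans (leq_addl _ _).
have le4 : (4 <= n)%N by rewrite n_def; apply: leq_trans (leq_addl _ _).
rewrite lift_code_of_gen.
have F1 := agree_sum_gen_far size_Pc ia le5 s1 w1 f1.
split.
- split; [exact: dim_gen | exact: min_dist_gen | exact: (covering_radius_gen n_def nm F1)].
- exact: NMDS_gen.
- apply: (not_UPWS_gen n_def nm F1 (code_blocks_far n_def size_Pc ia nmK s1 w1 b1)
    (agree_sum_gen_far size_Pc ia le4 s2 w2 f2) (agree_sum_gen_close size_Pc ia le5 s2 w2 c2)
    (code_blocks_far n_def size_Pc ia nmK s2 w2 b2)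
    (agree_sum_gen_far size_Pc ia le4 s3 w3 f3) (code_blocks_close n_def size_Pc ia nmK s3 w3 b3)).
Qed.

End Lift.

Lemma agree_sum_close (F : finFieldType) n (C : {vspace 'rV[F]_n}) i v : (i <= n)%N ->
  agree_sum C i v <> 0%N -> exists2 c, c \in C & (hdist v c <= i)%N.
Proof.
move=> lein S0; have [c Cc cd] := dist_to_attained C v; exists c => //.
rewrite leqNgt; apply/negP => far; apply: S0; apply: far_agree_sum => // c' Cc'.
by apply: leq_trans far _; rewrite cd dist_to_le.
Qed.

Lemma nb_at_translate (F : finFieldType) n (C : {vspace 'rV[F]_n}) v c j : c \in C ->
  nb_at C v j = nb_at C (v - c) j.
Proof.
move=> Cc; rewrite /nb_at -(card_imset _ (addIr (- c))); apply: eq_card => x.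
apply/imsetP/idP => [[y]|].
  rewrite !inE => /andP[Cy yj] ->; rewrite rpredB //= hdistE.
  by rewrite opprB addrA subrK -hdistE.
rewrite inE => /andP[Cx xj]; exists (x + c); last by rewrite addrK.
by rewrite inE rpredD //= hdistE opprD addrA addrAC -hdistE.
Qed.

Lemma indepF3_1 : indepF3 (@idfun 'F_3) 1 (fun=> 1).
Proof. by move=> c; rewrite big_ord1 mul1r => c0 l; rewrite ord1. Qed.

Lemma map_idfun m p (B : 'M['F_3]_(m, p)) : map_mx (@idfun 'F_3) B = B.
Proof. by apply/matrixP => i j; rewrite mxE. Qed.

(** * Codes over F_3: distance profiles and tables of agreement counts *)

Section GroundField.
Variables (k n : nat) (Pc : seq (seq nat)).
Hypotheses (size_Pc : size Pc = n) (injP : inj_check k Pc).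

Local Notation P := (matc k.+1 n Pc).

Definition profile (l : seq nat) (j : nat) : nat :=
  count (fun c => hdl l c == j) (gen_words k Pc).

Lemma nb_at_profile l j : l \in words n -> nb_at (code_of_gen P) (vec n l) j = profile l j.
Proof.
move=> /words_wf[sl l3].
have inj : injective (fun u : 'rV['F_3]_k.+1 => u *m P).
  by apply: row_free_inj; rewrite /row_free (rank_matc size_Pc).
have -> : nb_at (code_of_gen P) (vec n l) j =
    #|[set u : 'rV['F_3]_k.+1 | hdist (vec n l) (u *m P) == j]|.
  rewrite /nb_at -[RHS](card_imset _ inj); apply: eq_card => c; rewrite inE.
  apply/andP/imsetP => [[/mem_code_of_gen[u ->] uj]|[u]]; first by exists u; rewrite ?inE.
  by rewrite inE => uj ->; split=> //; apply/mem_code_of_gen; exists u.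
rewrite card_words /profile /gen_words count_map; apply: eq_in_count => u uw /=.
by rewrite lmul_words // hdist_vec ?size_lmul ?all_lmul.
Qed.

Lemma nb_wt_profile j : nb_wt (code_of_gen P) j = profile (zeros n) j.
Proof.
rewrite -nb_at0 -(vec_zeros n) nb_at_profile // mem_words.
by have [-> ->] := zeros_wf n; rewrite eqxx.
Qed.

Definition covers_check r : bool :=
  let D := gen_words k Pc in
  all (fun l => lazy_has (fun c => hdl l c <= r)%N D) (words n).

Lemma covering_radius_check r l : covers_check r -> l \in words n ->
  all (fun c => r <= hdl l c)%N (gen_words k Pc) ->
  covering_radius (code_of_gen P) = r.
Proof.
move=> /allP cov lw far; apply: covering_radiusP => [v|].
  have [l' l'w ->] := vec_words v; have := cov l' l'w; rewrite lazy_hasE => /hasP[c cP le].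
  exists (vec n c); first by apply/(gen_wordsP _ size_Pc); exists c.
  have [sc c3] := gen_words_wf size_Pc cP; have [sl l3] := words_wf l'w.
  by rewrite hdist_vec.
exists (vec n l) => c /(gen_wordsP _ size_Pc)[l' l'P ->].
have [sc c3] := gen_words_wf size_Pc l'P; have [sl l3] := words_wf lw.
by rewrite hdist_vec //; apply: (allP far).
Qed.

(** At each of the three vectors the relation reads beta_4 B_4 + beta_5 B_5 = 1. The first one fixes
    beta_5 and the second beta_4; the inequality says, with denominators cleared, that the third is
    violated. *)
Lemma not_UPWS_profiles l1 l2 l3 : covering_radius (code_of_gen P) = 5 ->
  all (fun l => l \in words n) [:: l1; l2; l3] ->
  all (fun l => all (fun j => profile l j == 0)%N (iota 0 4)) [:: l1; l2; l3] ->
  (profile l1 4 == 0%N) && (profile l2 5 == 0%N) ->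
  (profile l3 4 * profile l1 5 + profile l3 5 * profile l2 4 !=
   profile l2 4 * profile l1 5)%N ->
  ~ UPWS (code_of_gen P).
Proof.
move=> R /and4P[w1 w2 w3 _] /and4P[z1 z2 z3 _] /andP[/eqP z4 /eqP z5] neq.
rewrite /UPWS R => -[beta betaP].
have E l : l \in words n -> all (fun j => profile l j == 0)%N (iota 0 4) ->
    beta (inord 4) * (profile l 4)%:R + beta (inord 5) * (profile l 5)%:R = 1.
  move=> lw /and5P[/eqP p0 /eqP p1 /eqP p2 /eqP p3 _]; rewrite -[RHS](betaP (vec n l)).
  rewrite !big_ord_recr big_ord0 /= !nb_at_profile // p0 p1 p2 p3 !mulr0 !add0r.
  by congr (beta _ * _ + beta _ * _); apply/val_inj; rewrite /= inordK.
have := E _ w1 z1; have := E _ w2 z2; have := E _ w3 z3.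
rewrite z4 z5 !mulr0 add0r addr0; move: (beta _) (beta _) => b4 b5.
move: (profile l1 5) (profile l2 4) (profile l3 4) (profile l3 5) neq => A B c d.
rewrite -(eqr_nat rat) !natrD !natrM => neq e3 e2 e1; case/eqP: neq.
move: A%:R B%:R c%:R d%:R e1 e2 e3 => {}A {}B {}c {}d e1 e2 e3.
by rewrite -[RHS]mulr1 -e3 -[c]mul1r -[d in LHS]mul1r -{1}e2 -{1}e1; ring.
Qed.

(* The words of weight at most [t] represent all the vectors at distance at most [t] from the code. *)
Lemma t_regular_check r t (tb : seq (seq nat)) : covering_radius (code_of_gen P) = r ->
  (t <= r)%N ->
  all (fun e => [seq profile e j | j <- iota 0 r.+1] == nth [::] tb (wtl e))
    [seq e <- words n | (wtl e <= t)%N] ->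
  t_regular (code_of_gen P) t.
Proof.
move=> R tr /allP chk; split; rewrite R //.
have key v : (dist_to (code_of_gen P) v <= t)%N -> forall j, (j <= r)%N ->
    nb_at (code_of_gen P) v j = nth 0%N (nth [::] tb (dist_to (code_of_gen P) v)) j.
  move=> vt j jr; have [c Dc cd] := dist_to_attained (code_of_gen P) v.
  rewrite (nb_at_translate _ _ Dc) -cd hdistE; rewrite -cd hdistE in vt.
  move: (v - c) vt => e; have [l lw ->] := vec_words e; have [sl _] := words_wf lw.
  rewrite wt_vec // => vt; rewrite nb_at_profile //.
  have /eqP <- : [seq profile l j | j <- iota 0 r.+1] == nth [::] tb (wtl l).
    by apply: chk; rewrite mem_filter vt.
  by rewrite (nth_map 0%N) ?size_iota // nth_iota.
by move=> v w vt wv j jr; rewrite !key ?wv.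
Qed.

Hypotheses (n_def : n = (k + 7)%N) (nmdsP : near_mds_mx P).

Definition agree_profile r (s : seq nat) : seq nat :=
  [seq count (fun N => orthog N s) (normals k n Pc i) | i <- iota 0 r.+1].

Lemma agree_profileP r (w : 'rV['F_3]_n) : (r <= k)%N ->
  exists2 s, s \in words k.+1 &
    forall i, (i <= r)%N -> agree_sum (code_of_pcm P) i w = nth 0%N (agree_profile r s) i.
Proof.
move=> lerk; have [s sw sE] := vec_words (w *m P^T); exists s => // i leir.
rewrite (nth_map 0%N) ?size_iota // nth_iota // add0n.
(* The ground field is treated as its own lift along the identity, with a single component and
   coefficient 1. *)
have wE : w *m (map_mx (@idfun 'F_3) P)^T = comb (@idfun 'F_3) (fun _ : 'I_1 => 1) k.+1 [:: s] :> 'rV_k.+1.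
  by rewrite map_idfun sE /comb big_ord1 /= scale1r map_idfun.
have sw1 : all (fun l => l \in words k.+1) [:: s] by rewrite /= sw.
have := @agree_sum_pcm_count k n Pc n_def size_Pc _ _ 1 _ indepF3_1 i w [:: s] nmdsP (leq_trans leir lerk) (erefl 1%N) sw1 wE.
rewrite map_idfun => ->; rewrite count_normals.
by apply: eq_count => N; rewrite /= andbT.
Qed.

Lemma ex_profile r s : (r <= k)%N -> s \in words k.+1 ->
  exists w : 'rV['F_3]_n, forall i, (i <= r)%N ->
    agree_sum (code_of_pcm P) i w = nth 0%N (agree_profile r s) i.
Proof.
move=> lerk sw; have [w] := ex_syndrome size_Pc (@idfun 'F_3) (vec k.+1 s) injP.
rewrite map_idfun => wE; exists w => i leir.
rewrite (nth_map 0%N) ?size_iota // nth_iota // add0n.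
have wE' : w *m (map_mx (@idfun 'F_3) P)^T = comb (@idfun 'F_3) (fun _ : 'I_1 => 1) k.+1 [:: s] :> 'rV_k.+1.
  by rewrite map_idfun wE /comb big_ord1 /= scale1r map_idfun.
have sw1 : all (fun l => l \in words k.+1) [:: s] by rewrite /= sw.
have := @agree_sum_pcm_count k n Pc n_def size_Pc _ _ 1 _ indepF3_1 i w [:: s] nmdsP (leq_trans leir lerk) (erefl 1%N) sw1 wE'.
rewrite map_idfun => ->; rewrite count_normals.
by apply: eq_count => N; rewrite /= andbT.
Qed.


Lemma agree_profile_size r s : size (agree_profile r s) = r.+1.
Proof. by rewrite size_map size_iota. Qed.

(* [tb] lists the possible values of (S_0, ..., S_r). *)
Definition table_check r (tb : seq (seq nat)) : bool :=
  all (fun s => agree_profile r s \in tb) (words k.+1).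

Section Table.
Variables (r : nat) (tb : seq (seq nat)).
Hypotheses (lerk : (r <= k)%N) (tbP : table_check r tb).

Lemma table_profileP (w : 'rV['F_3]_n) : exists t, [/\ t \in tb, size t = r.+1 &
  forall i, (i <= r)%N -> agree_sum (code_of_pcm P) i w = nth 0%N t i].
Proof.
have [s sw sE] := agree_profileP w lerk; exists (agree_profile r s); split=> //.
  exact: (allP tbP).
exact: agree_profile_size.
Qed.

Lemma table_covering_radius s : (0 < r)%N -> all (fun t => nth 0 t r != 0)%N tb ->
  s \in words k.+1 -> nth 0%N (agree_profile r s) r.-1 = 0%N ->
  covering_radius (code_of_pcm P) = r.
Proof.
move=> r0 /allP tbr sw s0.
have lern : (r <= n)%N by apply: leq_trans lerk _; rewrite n_def leq_addr.
apply: covering_radiusP => [v|].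
  apply: agree_sum_close => //; have [t [ttb _ tE]] := table_profileP v.
  by rewrite tE //; apply/eqP/tbr.
have [w wE] := ex_profile lerk sw; exists w => c Ac.
rewrite -(prednK r0); apply: agree_sum_eq0_far Ac; first by rewrite (leq_trans (leq_pred _)).
by rewrite wE // leq_pred.
Qed.

Lemma table_UPWS (g : nat -> rat) : covering_radius (code_of_pcm P) = r ->
  all (fun t => \sum_(i < r.+1) g i * (nth 0%N t i)%:R == 1) tb -> UPWS (code_of_pcm P).
Proof.
move=> R /allP gP; apply: (UPWS_agree_sum (g := g) R) => v.
have [t [ttb _ tE]] := table_profileP v; rewrite -[RHS](eqP (gP t ttb)).
by apply: eq_bigr => i _; rewrite tE // -ltnS.
Qed.

(** The zero pattern of a row encodes the distance to the code, so it suffices that no two distinct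
    rows share a pattern. *)
Lemma table_completely_regular : covering_radius (code_of_pcm P) = r ->
  all (fun t => all (fun t' => (map (eq_op 0%N) t == map (eq_op 0%N) t') ==> (t == t')) tb) tb ->
  completely_regular (code_of_pcm P).
Proof.
move=> R chk; apply: completely_regular_agree_sum R _ => v w vw.
have [t [ttb st tE]] := table_profileP v; have [t' [t'tb st' t'E]] := table_profileP w.
suff tt' : t = t' by move=> i ir; rewrite tE // t'E // tt'.
apply/eqP; apply: (implyP (allP (allP chk t ttb) t' t'tb)); apply/eqP.
apply: (@eq_from_nth _ false); rewrite !size_map st ?st' // => i ir.
by rewrite !(nth_map 0%N) ?st ?st' // 2!(eq_sym 0%N) -tE // -t'E // vw.
Qed.

End Table.

(** * The lift to the field with nine elements *)

Section Quadratic.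
Variables (L : finFieldType) (iota : {rmorphism 'F_3 -> L}) (r : nat).
Hypotheses (L9 : #|L| = (3 ^ 2)%N) (lerk : (r < k)%N).

Local Notation PL := (map_mx iota P).

(** A syndrome over a field of nine elements has two components over F_3; it is a combination of r +
    1 columns as soon as the F_3-span of these columns contains both. Filtering by the first
    component shortens the search for the second. *)
Definition plane_cover_check : bool :=
  let Ns := normals k n Pc r.+1 in
  all (fun s => let Ns' := [seq N <- Ns | orthog N s] in
    all (fun s' => lazy_has (fun N => orthog N s') Ns') (words k.+1)) (words k.+1).

Definition span_count i ss : nat := count (fun N => all (orthog N) ss) (normals k n Pc i).

(** At distance r + 1 the counts B_0, ..., B_r vanish and B_(r+1) = S_(r+1), so a relation would
    force S_(r+1) to be constant on the vectors at this distance. *)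
Lemma quadratic_not_UPWS ss1 ss2 : plane_cover_check ->
  all (fun ss => (size ss == 2) && all (fun l => l \in words k.+1) ss) [:: ss1; ss2] ->
  (span_count r ss1 == 0%N) && (span_count r ss2 == 0%N) ->
  span_count r.+1 ss1 != span_count r.+1 ss2 ->
  covering_radius (code_of_pcm PL) = r.+1 /\ ~ UPWS (code_of_pcm PL).
Proof.
move=> cov /and3P[/andP[/eqP s1 w1] /andP[/eqP s2 w2] _] /andP[/eqP z1 /eqP z2] neq.
have [a ia] : exists a, indepF3 iota 2 a by apply: ex_indepF3; rewrite L9.
have lern : (r.+1 <= n)%N by apply: leq_trans lerk _; rewrite n_def leq_addr.
have cnt i (w : 'rV[L]_n) ss : (i <= k)%N -> size ss = 2%N ->
    all (fun l => l \in words k.+1) ss ->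
    w *m PL^T = comb iota (fun l : 'I_2 => a l) k.+1 ss ->
    agree_sum (code_of_pcm PL) i w = span_count i ss.
  by move=> ik szs sw wE; rewrite (agree_sum_pcm_count n_def size_Pc ia nmdsP ik szs sw wE) count_normals.
have [v1 v1E] := ex_syndrome size_Pc iota (comb iota (fun l : 'I_2 => a l) k.+1 ss1) injP.
have [v2 v2E] := ex_syndrome size_Pc iota (comb iota (fun l : 'I_2 => a l) k.+1 ss2) injP.
have far ss v : size ss = 2%N -> all (fun l => l \in words k.+1) ss ->
    v *m PL^T = comb iota (fun l : 'I_2 => a l) k.+1 ss -> span_count r ss = 0%N ->
    forall c, c \in code_of_pcm PL -> (r < hdist v c)%N.
  move=> szs sw vE z; apply: agree_sum_eq0_far; first exact: ltnW.
  by rewrite (cnt _ _ ss) // ltnW.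
have R : covering_radius (code_of_pcm PL) = r.+1.
  apply: covering_radiusP => [v|]; last by exists v1; apply: far v1E z1.
  have [ss [szs sw vE]] := indepF3_row_span (v *m PL^T) ia L9.
  apply: agree_sum_close => //; rewrite (cnt _ _ ss) //.
  apply/eqP; rewrite -lt0n -has_count.
  case: ss szs sw {vE} => [|x [|y [|]]] // _ /and3P[xw yw _].
  have := allP (allP cov x xw) y yw; rewrite lazy_hasE => /hasP[N]; rewrite mem_filter => /andP[Nx NN] Ny.
  by apply/hasP; exists N; rewrite //= Nx Ny.
split=> //; rewrite /UPWS R => -[beta betaP].
have E ss v : size ss = 2%N -> all (fun l => l \in words k.+1) ss ->
    v *m PL^T = comb iota (fun l : 'I_2 => a l) k.+1 ss -> span_count r ss = 0%N ->
    beta ord_max * (span_count r.+1 ss)%:R = 1.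
  move=> szs sw vE z; have f := far ss v szs sw vE z.
  rewrite -[RHS](betaP v) big_ord_recr big1 /= => [|i _]; last first.
    by rewrite (nb_at_far f) ?mulr0 // -ltnS.
  rewrite add0r -(cnt _ v) // agree_sum_ord // big_ord_recr big1 /= => [|i _].
    by rewrite add0n binn muln1.
  by rewrite (nb_at_far f) // -ltnS.
have e1 := E ss1 v1 s1 w1 v1E z1; have e2 := E ss2 v2 s2 w2 v2E z2.
case/eqP: neq; apply/eqP; rewrite -(eqr_nat rat); apply/eqP.
have b0 : beta ord_max != 0 by apply: contra_eq_neq e1 => ->; rewrite mul0r eq_sym oner_neq0.
by apply: (mulfI b0); rewrite e1 e2.
Qed.

End Quadratic.

End GroundField.

(** * The punctured Golay codes *)

Definition M11_rows : seq (seq nat) :=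
  [:: [:: 2; 2; 2; 2; 2];
      [:: 2; 2; 1; 1; 0];
      [:: 2; 1; 2; 0; 1];
      [:: 1; 2; 0; 2; 1];
      [:: 1; 0; 2; 1; 2];
      [:: 0; 1; 1; 2; 2]]%N.

Definition golay_gen : seq (seq nat) :=
  units 6 ++ [seq [seq nth 0%N r j | r <- M11_rows] | j <- iota 0 5].

(* The columns of the parity check matrix [-M^T | I] of the code generated by [I | M]. *)
Definition golay_pcm (k : nat) : seq (seq nat) :=
  [seq [seq mod3 (2 * a) | a <- take k.+1 r] | r <- M11_rows] ++ units k.+1.

Lemma golay_gen_mx : row_mx 1%:M M11 = matc 6 11 golay_gen.
Proof.
apply/matrixP => i j; rewrite [LHS]mxE [RHS]mxE; case: splitP => l jl; rewrite mxE jl.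
  by case: i l {jl} => [[|[|[|[|[|[|//]]]]]] Hi] [[|[|[|[|[|[|//]]]]]] Hl].
by case: i l {jl} => [[|[|[|[|[|[|//]]]]]] Hi] [[|[|[|[|[|//]]]]] Hl].
Qed.

Lemma puncture_golay n (hn : (n <= 11)%N) :
  puncture hn G11 = code_of_gen (matc 6 n (take n golay_gen)).
Proof.
rewrite /G11 golay_gen_mx puncture_code_of_gen; congr code_of_gen.
by apply/matrixP => i j; rewrite !mxE nth_take.
Qed.

Definition golay_check (k n : nat) : bool :=
  [&& size (golay_pcm k) == n, size (take n golay_gen) == n,
      inj_check k (golay_pcm k), inj_check 5 (take n golay_gen),
      all (fun u => all (fun w => dot (lmul u (golay_pcm k)) (lmul w (take n golay_gen)) == 0%N)
          (units 6)) (units k.+1),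
      all (fun l => wtl l \in [:: 0; 6; 9]%N) (gen_words k (golay_pcm k)) &
      all (fun l => (wtl l == 0) || (k < wtl l))%N (gen_words 5 (take n golay_gen))].

Lemma golay_check10 : golay_check 3 10. Proof. by vm_compute. Qed.
Lemma golay_check9 : golay_check 2 9. Proof. by vm_compute. Qed.
Lemma golay_check8 : golay_check 1 8. Proof. by vm_compute. Qed.

(* The vectors w1, w2, w3 of [not_UPWS_gen], given by their two components over F_3; found by search. *)
Definition witness10 : seq (seq (seq nat)) :=
  [:: [:: [:: 2; 0; 1; 1; 2; 2; 0; 0; 0; 0]; [:: 0; 2; 2; 2; 2; 2; 0; 0; 0; 0]];
      [:: [:: 0; 0; 0; 2; 0; 2; 1; 0; 0; 0]; [:: 2; 1; 0; 2; 0; 1; 0; 0; 0; 0]];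
      [:: [:: 0; 0; 1; 0; 0; 1; 0; 0; 2; 0]; [:: 0; 2; 1; 0; 0; 2; 0; 1; 0; 0]]]%N.

Definition witness9 : seq (seq (seq nat)) :=
  [:: [:: [:: 1; 0; 1; 2; 0; 2; 0; 0; 0]; [:: 2; 1; 0; 2; 1; 2; 0; 0; 0]];
      [:: [:: 1; 0; 0; 0; 2; 1; 0; 0; 0]; [:: 0; 0; 0; 2; 1; 2; 2; 0; 0]];
      [:: [:: 2; 0; 1; 0; 0; 1; 0; 0; 1]; [:: 0; 0; 1; 0; 0; 0; 2; 0; 1]]]%N.

Definition witness8 : seq (seq (seq nat)) :=
  [:: [:: [:: 1; 0; 1; 2; 0; 2; 0; 0]; [:: 2; 1; 0; 2; 1; 2; 0; 0]];
      [:: [:: 1; 2; 2; 0; 0; 1; 1; 0]; [:: 0; 1; 1; 0; 0; 2; 1; 0]];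
      [:: [:: 0; 1; 0; 0; 0; 2; 1; 2]; [:: 1; 2; 0; 0; 0; 2; 0; 0]]]%N.

Definition not_UPWS_data k n (w : seq (seq (seq nat))) : bool :=
  all (fun es => (size es == 2) && all (fun e => e \in words n) es) w &&
  not_UPWS_check k n (golay_pcm k) (nth [::] w 0) (nth [::] w 1) (nth [::] w 2).

Lemma not_UPWS_data10 : not_UPWS_data 3 10 witness10. Proof. by vm_compute. Qed.
Lemma not_UPWS_data9 : not_UPWS_data 2 9 witness9. Proof. by vm_compute. Qed.
Lemma not_UPWS_data8 : not_UPWS_data 1 8 witness8. Proof. by vm_compute. Qed.

(** The components span the plane orthogonal to (1, 1, 1, 1). It contains a single column of the
    parity check matrix: it is a tangent plane of the quadric. *)
Lemma syn_far10 : syn_far_check 3 10 (golay_pcm 3) 3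
  [:: [:: 2; 0; 1; 0]; [:: 1; 0; 0; 2]; [:: 0; 1; 2; 0]]%N.
Proof. by vm_compute. Qed.
(** The components span the line orthogonal to (1, 2, 2), which contains no column: the line at
    infinity of the affine plane. *)
Lemma syn_far9 : syn_far_check 2 9 (golay_pcm 2) 2 [:: [:: 1; 1; 0]; [:: 1; 2; 2]]%N.
Proof. by vm_compute. Qed.
(** The two components are independent, so no single column has both as multiples. *)
Lemma syn_far8 : syn_far_check 1 8 (golay_pcm 1) 1 [:: [:: 0; 2]; [:: 1; 1]]%N.
Proof. by vm_compute. Qed.

(** The rows belong to the zero syndrome, to the multiples of columns, and to the remaining
    syndromes: a point off the quadric lies on three secant lines. *)
Definition table10 : seq (seq nat) := [:: [:: 1; 10; 45]; [:: 0; 1; 9]; [:: 0; 0; 3]]%N.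
(** The last row belongs to the points at infinity: each lies on three affine lines, with three
    pairs of columns on each. *)
Definition table9 : seq (seq nat) := [:: [:: 1; 9; 36]; [:: 0; 1; 12]; [:: 0; 0; 9]]%N.
Definition table8 : seq (seq nat) := [:: [:: 1; 8]; [:: 0; 2]]%N.

Lemma table10P : table_check 3 10 (golay_pcm 3) 2 table10. Proof. by vm_compute. Qed.
Lemma table9P : table_check 2 9 (golay_pcm 2) 2 table9. Proof. by vm_compute. Qed.
Lemma table8P : table_check 1 8 (golay_pcm 1) 1 table8. Proof. by vm_compute. Qed.

Lemma covers10 : covers_check 3 10 (golay_pcm 3) 5. Proof. by vm_compute. Qed.
Lemma covers9 : covers_check 2 9 (golay_pcm 2) 5. Proof. by vm_compute. Qed.
Lemma covers8 : covers_check 1 8 (golay_pcm 1) 5. Proof. by vm_compute. Qed.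

(** Indexed by the weight of a word, which for weight at most 2 is its distance from the dual code,
    the minimum distance being 6. The entry 18 = 60 * 6 / (10 * 2) counts the words of weight 6 with
    a prescribed nonzero entry at one coordinate. *)
Definition profile_table10 : seq (seq nat) :=
  [:: [:: 1; 0; 0; 0; 0; 0]; [:: 0; 1; 0; 0; 0; 18]; [:: 0; 0; 1; 0; 5; 10]]%N.

Lemma profiles10 :
  all (fun e => [seq profile 3 (golay_pcm 3) e j | j <- iota 0 6] == nth [::] profile_table10 (wtl e))
    [seq e <- words 10 | (wtl e <= 2)%N].
Proof. by vm_compute. Qed.

Lemma plane_cover10 : plane_cover_check 3 10 (golay_pcm 3) 2. Proof. by vm_compute. Qed.

Lemma nb_wt_data : [&& profile 5 (take 10 golay_gen) (zeros 10) 4 == 60,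
  profile 5 (take 9 golay_gen) (zeros 9) 3 == 24 &
  profile 5 (take 8 golay_gen) (zeros 8) 2 == 8]%N.
Proof. by vm_compute. Qed.

Section PuncturedGolay.
Variables (k n : nat) (hn : (n <= 11)%N).
Hypotheses (n_def : n = (k + 7)%N) (chk : golay_check k n).

Local Notation C := (puncture hn G11).
Local Notation P := (matc k.+1 n (golay_pcm k)).

Let sP : size (golay_pcm k) = n.
Proof. by case/and5P: chk => /eqP. Qed.

Let iP : inj_check k (golay_pcm k).
Proof. by case/and5P: chk. Qed.

Lemma golay_code_of_pcm : C = code_of_pcm P.
Proof.
case/and5P: chk => /eqP s1 /eqP s2 i1 i2 /and3P[orth _ _].
by rewrite puncture_golay; apply: code_of_gen_pcm orth.
Qed.

Lemma golay_dual : dual_code C = code_of_gen P.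
Proof. by rewrite golay_code_of_pcm dual_code_of_pcm. Qed.

Lemma golay_near_mds : near_mds_mx P.
Proof.
case/and5P: chk => /eqP s1 /eqP s2 i1 i2 /and3P[orth wD wA].
exact: near_mds_matc n_def s1 s2 i1 i2 orth wD wA.
Qed.

Lemma golay_steiner : steiner_mx P.
Proof.
case/and5P: chk => /eqP s1 /eqP s2 i1 i2 /and3P[orth wD wA].
exact: steiner_matc n_def s1 s2 i1 i2 orth wD wA.
Qed.

Let nm := golay_near_mds.
Let st := golay_steiner.

Lemma golay_code_params r : covering_radius C = r -> code_params C 6 k.+1 r.
Proof.
move=> R; split=> //; rewrite golay_code_of_pcm; first exact: dim_pcm.
exact: min_dist_pcm.
Qed.

Lemma golay_NMDS : NMDS C.
Proof. by rewrite golay_code_of_pcm; apply: NMDS_pcm. Qed.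

Lemma golay_nb_wt j : nb_wt C j = profile 5 (take n golay_gen) (zeros n) j.
Proof.
by case/and5P: chk => _ /eqP s2 _ i2 _; rewrite puncture_golay nb_wt_profile.
Qed.

Lemma golay_covering_radius r tb s : (r <= k)%N -> table_check k n (golay_pcm k) r tb ->
  [&& (0 < r)%N, all (fun t => nth 0 t r != 0)%N tb, s \in words k.+1 &
      nth 0%N (agree_profile k n (golay_pcm k) r s) r.-1 == 0%N] ->
  covering_radius C = r.
Proof.
move=> rk tbP /and4P[r0 tbr sw /eqP s0]; rewrite golay_code_of_pcm.
exact: table_covering_radius tbP _ r0 tbr sw s0.
Qed.

Lemma golay_UPWS r tb (g : nat -> rat) : table_check k n (golay_pcm k) r tb -> (r <= k)%N ->
  covering_radius C = r ->
  all (fun t => \sum_(i < r.+1) g i * (nth 0%N t i)%:R == 1) tb -> UPWS C.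
Proof.
by rewrite golay_code_of_pcm => tbP rk R; apply: table_UPWS tbP _ R.
Qed.

Lemma golay_completely_regular r tb : table_check k n (golay_pcm k) r tb -> (r <= k)%N ->
  covering_radius C = r ->
  all (fun t => all (fun t' => (map (eq_op 0%N) t == map (eq_op 0%N) t') ==> (t == t')) tb) tb ->
  completely_regular C.
Proof.
by rewrite golay_code_of_pcm => tbP rk R; apply: table_completely_regular tbP R.
Qed.

Lemma golay_dual_base l : covers_check k n (golay_pcm k) 5 ->
  (l \in words n) && all (fun c => 5 <= hdl l c)%N (gen_words k (golay_pcm k)) ->
  code_params (dual_code C) k.+1 6 5 /\ NMDS (dual_code C).
Proof.
move=> cov /andP[lw far]; rewrite golay_dual; split; last exact: NMDS_gen.
split; [exact: dim_gen | exact: min_dist_gen |].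
exact: covering_radius_check cov lw far.
Qed.

Lemma golay_dual_not_UPWS l1 l2 l3 : covering_radius (dual_code C) = 5 ->
  all (fun l => l \in words n) [:: l1; l2; l3] ->
  [&& all (fun l => all (fun j => profile k (golay_pcm k) l j == 0)%N (iota 0 4)) [:: l1; l2; l3],
      (profile k (golay_pcm k) l1 4 == 0%N) && (profile k (golay_pcm k) l2 5 == 0%N) &
      (profile k (golay_pcm k) l3 4 * profile k (golay_pcm k) l1 5 +
       profile k (golay_pcm k) l3 5 * profile k (golay_pcm k) l2 4 !=
       profile k (golay_pcm k) l2 4 * profile k (golay_pcm k) l1 5)%N] ->
  ~ UPWS (dual_code C).
Proof.
by rewrite golay_dual => R lw /and3P[z45 z neq]; apply: not_UPWS_profiles lw z45 z neq.
Qed.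

Section Lifts.
Variables (m : nat) (F : finFieldType) (iota : {rmorphism 'F_3 -> F}).
Hypothesis cardF : #|F| = (3 ^ m)%N.

Lemma golay_lift_UPWS ss : syn_far_check k n (golay_pcm k) k ss ->
  (size ss <= m)%N -> all (fun l => l \in words k.+1) ss ->
  [/\ code_params (lift_code iota C) 6 k.+1 k.+1, UPWS (lift_code iota C)
    & NMDS (lift_code iota C)].
Proof.
move=> far sm sw; rewrite golay_code_of_pcm.
by apply: (lift_UPWS n_def sP iP nm st _ _ (erefl (size ss)) sw far); rewrite cardF leq_pexp2l.
Qed.

Lemma golay_dual_lift_not_UPWS w : (2 <= m)%N -> not_UPWS_data k n w -> size w = 3%N ->
  [/\ code_params (lift_code iota (dual_code C)) k.+1 6 6, NMDS (lift_code iota (dual_code C))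
    & ~ UPWS (lift_code iota (dual_code C))].
Proof.
case: w => [|es1 [|es2 [|es3 []]]] // m2 /andP[ew wchk] _; rewrite golay_dual.
by apply: (lift_dual_not_UPWS n_def sP nm st _ _ ew wchk); rewrite cardF leq_pexp2l.
Qed.

Lemma golay_dual_lift_max :
  [/\ \dim (lift_code iota (dual_code C)) = k.+1,
      min_dist (lift_code iota (dual_code C)) = 6%N,
      (nb_wt (lift_code iota (dual_code C)) 6)%:R = Amax n k.+1 (3 ^ m)
    & forall C' : {vspace 'rV[F]_n}, NMDS C' -> \dim C' = k.+1 ->
        (nb_wt C' 6 <= nb_wt (lift_code iota (dual_code C)) 6)%N].
Proof. by rewrite golay_dual; apply: lift_dual_max cardF. Qed.

Lemma golay_dual_lift_nb_wt7 : nb_wt (lift_code iota (dual_code C)) 7 = 0%N.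
Proof. by rewrite golay_dual; apply: lift_dual_nb_wt7. Qed.

End Lifts.

End PuncturedGolay.

(** Coefficients of S_0, S_1, S_2, obtained from the rows of [table10] taken from the last to the
    first, each row fixing one more coefficient. *)
Definition coef10 : seq rat := [:: 6; - 2; 3^-1].

Lemma UPWS_coef10 : all (fun t =>
  \sum_(i < 3) coef10`_i * (nth 0%N t i)%:R == 1) table10.
Proof.
apply/and4P; split=> //; apply/eqP; rewrite !big_ord_recr big_ord0 /=; by field.
Qed.

Definition coef9 : seq rat := [:: 0; - 3^-1; 9^-1].

Lemma UPWS_coef9 : all (fun t =>
  \sum_(i < 3) coef9`_i * (nth 0%N t i)%:R == 1) table9.
Proof.
apply/and4P; split=> //; apply/eqP; rewrite !big_ord_recr big_ord0 /=; by field.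
Qed.

Definition coef8 : seq rat := [:: - 3; 2^-1].

Lemma UPWS_coef8 : all (fun t =>
  \sum_(i < 2) coef8`_i * (nth 0%N t i)%:R == 1) table8.
Proof.
apply/and3P; split=> //; apply/eqP; rewrite !big_ord_recr big_ord0 /=; by field.
Qed.

Lemma golay10_quadratic (F : finFieldType) (iota : {rmorphism 'F_3 -> F}) : #|F| = (3 ^ 2)%N ->
  [/\ code_params (lift_code iota G10) 6 4 3, NMDS (lift_code iota G10)
    & ~ UPWS (lift_code iota G10)].
Proof.
move=> cF; have n_def : 10%N = (3 + 7)%N by [].
have nm := near_mds_map iota (golay_near_mds n_def golay_check10).
have st := steiner_map iota (golay_steiner n_def golay_check10).
case/and5P: (golay_check10) => /eqP sP _ iP _ _.
rewrite /G10 (golay_code_of_pcm _ n_def golay_check10) lift_code_of_pcm.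
(* The first pair spans a tangent line of the quadric, through the column (1, 0, 0, 0); the second
   spans a line missing it. They lie in 3 and 2 secant planes, each with 4 triples of columns, so
   S_3 is 12 and 8. *)
have [] := @quadratic_not_UPWS 3 10 _ sP iP n_def (golay_near_mds n_def golay_check10) F iota 2
  cF isT [:: [:: 1; 2; 0; 1]; [:: 0; 2; 0; 1]]%N [:: [:: 2; 2; 0; 0]; [:: 0; 1; 2; 0]]%N plane_cover10.
- by vm_compute.
- by vm_compute.
- by vm_compute.
move=> R nU; split; [split; [exact: dim_pcm | exact: min_dist_pcm | exact: R] | exact: NMDS_pcm | exact: nU].
Qed.

Theorem theorem4p5 :
  (* (i) *)
  ([/\ code_params G10 6 4 2, UPWS G10 & NMDS G10]
   /\ (forall (m : nat) (F : finFieldType) (iota : {rmorphism 'F_3 -> F}),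
        (3 <= m)%N -> #|F| = (3 ^ m)%N ->
        [/\ code_params (lift_code iota G10) 6 4 4,
            UPWS (lift_code iota G10) & NMDS (lift_code iota G10)])
   /\ [/\ code_params G9 6 3 2, UPWS G9 & NMDS G9]
   /\ (forall (m : nat) (F : finFieldType) (iota : {rmorphism 'F_3 -> F}),
        (2 <= m)%N -> #|F| = (3 ^ m)%N ->
        [/\ code_params (lift_code iota G9) 6 3 3,
            UPWS (lift_code iota G9) & NMDS (lift_code iota G9)])
   /\ [/\ code_params G8 6 2 1, UPWS G8 & NMDS G8]
   /\ (forall (m : nat) (F : finFieldType) (iota : {rmorphism 'F_3 -> F}),
        (2 <= m)%N -> #|F| = (3 ^ m)%N ->
        [/\ code_params (lift_code iota G8) 6 2 2,
            UPWS (lift_code iota G8) & NMDS (lift_code iota G8)]))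
  /\
  (* (ii) *)
  ((completely_regular G8 /\ NMDS G8)
   /\ (forall (m : nat) (F : finFieldType) (iota : {rmorphism 'F_3 -> F}),
        (2 <= m)%N -> #|F| = (3 ^ m)%N ->
        completely_regular (lift_code iota G8) /\ NMDS (lift_code iota G8))
   /\ [/\ code_params G9 6 3 2, completely_regular G9 & NMDS G9]
   /\ (code_params (dual_code G10) 4 6 5 /\ t_regular (dual_code G10) 2))
  /\
  (* (iii) *)
  ([/\ code_params (dual_code G10) 4 6 5, NMDS (dual_code G10)
     & ~ UPWS (dual_code G10)]
   /\ (forall (m : nat) (F : finFieldType) (iota : {rmorphism 'F_3 -> F}),
        (2 <= m)%N -> #|F| = (3 ^ m)%N ->
        [/\ code_params (lift_code iota (dual_code G10)) 4 6 6,
            NMDS (lift_code iota (dual_code G10))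
          & ~ UPWS (lift_code iota (dual_code G10))])
   /\ [/\ code_params (dual_code G9) 3 6 5, NMDS (dual_code G9)
        & ~ UPWS (dual_code G9)]
   /\ (forall (m : nat) (F : finFieldType) (iota : {rmorphism 'F_3 -> F}),
        (2 <= m)%N -> #|F| = (3 ^ m)%N ->
        [/\ code_params (lift_code iota (dual_code G9)) 3 6 6,
            NMDS (lift_code iota (dual_code G9))
          & ~ UPWS (lift_code iota (dual_code G9))])
   /\ [/\ code_params (dual_code G8) 2 6 5, NMDS (dual_code G8)
        & ~ UPWS (dual_code G8)]
   /\ (forall (m : nat) (F : finFieldType) (iota : {rmorphism 'F_3 -> F}),
        (2 <= m)%N -> #|F| = (3 ^ m)%N ->
        [/\ code_params (lift_code iota (dual_code G8)) 2 6 6,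
            NMDS (lift_code iota (dual_code G8))
          & ~ UPWS (lift_code iota (dual_code G8))])
   /\ (forall (F : finFieldType) (iota : {rmorphism 'F_3 -> F}),
        #|F| = (3 ^ 2)%N ->
        [/\ code_params (lift_code iota G10) 6 4 3,
            NMDS (lift_code iota G10) & ~ UPWS (lift_code iota G10)]))
  /\
  (* (iv) *)
  ((forall (m : nat) (F : finFieldType) (iota : {rmorphism 'F_3 -> F}),
      (1 <= m)%N -> #|F| = (3 ^ m)%N ->
      [/\ \dim (lift_code iota (dual_code G10)) = 4%N,
          min_dist (lift_code iota (dual_code G10)) = 6%N,
          (nb_wt (lift_code iota (dual_code G10)) 6)%:R = Amax 10 4 (3 ^ m)
        & forall C : {vspace 'rV[F]_10}, NMDS C -> \dim C = 4%N ->
            (nb_wt C 6 <= nb_wt (lift_code iota (dual_code G10)) 6)%N]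
      /\
      [/\ \dim (lift_code iota (dual_code G9)) = 3%N,
          min_dist (lift_code iota (dual_code G9)) = 6%N,
          (nb_wt (lift_code iota (dual_code G9)) 6)%:R = Amax 9 3 (3 ^ m)
        & forall C : {vspace 'rV[F]_9}, NMDS C -> \dim C = 3%N ->
            (nb_wt C 6 <= nb_wt (lift_code iota (dual_code G9)) 6)%N]
      /\
      [/\ \dim (lift_code iota (dual_code G8)) = 2%N,
          min_dist (lift_code iota (dual_code G8)) = 6%N,
          (nb_wt (lift_code iota (dual_code G8)) 6)%:R = Amax 8 2 (3 ^ m)
        & forall C : {vspace 'rV[F]_8}, NMDS C -> \dim C = 2%N ->
            (nb_wt C 6 <= nb_wt (lift_code iota (dual_code G8)) 6)%N])
   /\ (forall C : {vspace 'rV['F_3]_10}, \dim C = 6%N -> min_dist C = 4%N ->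
        (nb_wt G10 4 <= nb_wt C 4)%N)
   /\ (forall C : {vspace 'rV['F_3]_9}, \dim C = 6%N -> min_dist C = 3%N ->
        (nb_wt G9 3 <= nb_wt C 3)%N)
   /\ (forall C : {vspace 'rV['F_3]_8}, \dim C = 6%N -> min_dist C = 2%N ->
        (nb_wt G8 2 <= nb_wt C 2)%N))
  /\
  (* (v) *)
  (forall (m : nat) (F : finFieldType) (iota : {rmorphism 'F_3 -> F}),
     (1 <= m)%N -> #|F| = (3 ^ m)%N ->
     [/\ nb_wt (lift_code iota (dual_code G10)) 7 = 0%N,
         nb_wt (lift_code iota (dual_code G9)) 7 = 0%N
       & nb_wt (lift_code iota (dual_code G8)) 7 = 0%N]).
Proof.
have n10 : 10%N = (3 + 7)%N by [].
have n9 : 9%N = (2 + 7)%N by [].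
have n8 : 8%N = (1 + 7)%N by [].
have c10 := golay_check10; have c9 := golay_check9; have c8 := golay_check8.
(* The syndrome (1, 1, 0, 0) is proportional to no column, so it has S_1 = 0 and gives a vector at
   distance 2. *)
have R10 : covering_radius G10 = 2%N.
  by apply: (golay_covering_radius _ n10 c10 (s := [:: 1; 1; 0; 0]%N) _ table10P); vm_compute.
have R9 : covering_radius G9 = 2%N.
  by apply: (golay_covering_radius _ n9 c9 (s := [:: 1; 1; 0]%N) _ table9P); vm_compute.
have R8 : covering_radius G8 = 1%N.
  by apply: (golay_covering_radius _ n8 c8 (s := [:: 1; 1]%N) _ table8P); vm_compute.
(* Each [l] below is a vector at distance 5 from the dual code, compared with all the codewords by
   evaluation. *)
have [P10' N10'] : code_params (dual_code G10) 4 6 5 /\ NMDS (dual_code G10).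
  by apply: (golay_dual_base _ n10 c10 (l := [:: 0; 1; 1; 1; 1; 1; 0; 0; 0; 0]%N) covers10); vm_compute.
have [P9' N9'] : code_params (dual_code G9) 3 6 5 /\ NMDS (dual_code G9).
  by apply: (golay_dual_base _ n9 c9 (l := [:: 0; 1; 1; 1; 1; 1; 0; 0; 0]%N) covers9); vm_compute.
have [P8' N8'] : code_params (dual_code G8) 2 6 5 /\ NMDS (dual_code G8).
  by apply: (golay_dual_base _ n8 c8 (l := [:: 0; 1; 1; 1; 1; 1; 0; 0]%N) covers8); vm_compute.
have N10 : NMDS G10 := golay_NMDS _ n10 c10.
have N9 : NMDS G9 := golay_NMDS _ n9 c9.
have N8 : NMDS G8 := golay_NMDS _ n8 c8.
have lift9 m (F : finFieldType) (iota : {rmorphism 'F_3 -> F}) :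
    (2 <= m)%N -> #|F| = (3 ^ m)%N ->
    [/\ code_params (lift_code iota G9) 6 3 3, UPWS (lift_code iota G9) & NMDS (lift_code iota G9)].
  by move=> m2 cF; apply: (golay_lift_UPWS _ n9 c9 iota cF syn_far9 m2); vm_compute.
have lift8 m (F : finFieldType) (iota : {rmorphism 'F_3 -> F}) :
    (2 <= m)%N -> #|F| = (3 ^ m)%N ->
    [/\ code_params (lift_code iota G8) 6 2 2, UPWS (lift_code iota G8) & NMDS (lift_code iota G8)].
  by move=> m2 cF; apply: (golay_lift_UPWS _ n8 c8 iota cF syn_far8 m2); vm_compute.
split; [|split; [|split; [|split]]].
- split; [|split; [|split; [|split; [|split]]]].
  + split; [exact: (golay_code_params n10 c10 R10) | | exact: N10].
    exact: (golay_UPWS (g := nth 0 coef10) n10 c10 table10P isT R10 UPWS_coef10).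
  + move=> m F iota m3 cF.
    by apply: (golay_lift_UPWS _ n10 c10 iota cF syn_far10 m3); vm_compute.
  + split; [exact: (golay_code_params n9 c9 R9) | | exact: N9].
    exact: (golay_UPWS (g := nth 0 coef9) n9 c9 table9P isT R9 UPWS_coef9).
  + exact: lift9.
  + split; [exact: (golay_code_params n8 c8 R8) | | exact: N8].
    exact: (golay_UPWS (g := nth 0 coef8) n8 c8 table8P isT R8 UPWS_coef8).
  + exact: lift8.
- split; [|split; [|split]].
  + by split; [exact: (golay_completely_regular n8 c8 table8P isT R8) | exact: N8].
  + move=> m F iota m2 cF; have [[d8 md8 r8] U8 NM8] := lift8 m F iota m2 cF.
    split; last exact: NM8.
    move: r8; rewrite /G8 (golay_code_of_pcm _ n8 c8) lift_code_of_pcm.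
    apply: (completely_regular_pcm2 n8); first exact: near_mds_map (golay_near_mds n8 c8).
    exact: steiner_map (golay_steiner n8 c8).
  + split; [exact: (golay_code_params n9 c9 R9) | | exact: N9].
    exact: (golay_completely_regular n9 c9 table9P isT R9).
  + split; [exact: P10' |].
    case: P10' => _ _; rewrite /G10 (golay_dual _ n10 c10).
    case/and5P: c10 => /eqP sP _ iP _ _ R.
    exact: (t_regular_check sP iP R _ profiles10).
- split; [|split; [|split; [|split; [|split; [|split]]]]].
  + split; [exact: P10' | exact: N10' |]; case: P10' => _ _ R.
    by apply: (golay_dual_not_UPWS n10 c10 (l1 := [:: 0; 1; 1; 1; 1; 1; 0; 0; 0; 0]%N)
      (l2 := [:: 1; 1; 0; 0; 2; 2; 0; 0; 0; 0]%N) (l3 := [:: 0; 0; 1; 1; 1; 1; 0; 0; 0; 0]%N) R);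
      vm_compute.
  + move=> m F iota m2 cF; exact: (golay_dual_lift_not_UPWS _ n10 c10 iota cF m2 not_UPWS_data10).
  + split; [exact: P9' | exact: N9' |]; case: P9' => _ _ R.
    by apply: (golay_dual_not_UPWS n9 c9 (l1 := [:: 0; 1; 1; 1; 1; 1; 0; 0; 0]%N)
      (l2 := [:: 0; 1; 2; 1; 2; 0; 0; 0; 0]%N) (l3 := [:: 0; 0; 1; 1; 1; 1; 0; 0; 0]%N) R);
      vm_compute.
  + move=> m F iota m2 cF; exact: (golay_dual_lift_not_UPWS _ n9 c9 iota cF m2 not_UPWS_data9).
  + split; [exact: P8' | exact: N8' |]; case: P8' => _ _ R.
    by apply: (golay_dual_not_UPWS n8 c8 (l1 := [:: 0; 1; 1; 1; 1; 1; 0; 0]%N)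
      (l2 := [:: 0; 0; 1; 2; 2; 1; 0; 0]%N) (l3 := [:: 0; 0; 1; 1; 1; 1; 0; 0]%N) R);
      vm_compute.
  + move=> m F iota m2 cF; exact: (golay_dual_lift_not_UPWS _ n8 c8 iota cF m2 not_UPWS_data8).
  + exact: golay10_quadratic.
- case/and3P: nb_wt_data => /eqP w10 /eqP w9 /eqP w8; split; [|split; [|split]].
  + move=> m F iota _ cF; split; last split.
    * exact: (golay_dual_lift_max _ n10 c10 iota cF).
    * exact: (golay_dual_lift_max _ n9 c9 iota cF).
    * exact: (golay_dual_lift_max _ n8 c8 iota cF).
  + by move=> C dC mC; rewrite /G10 (golay_nb_wt _ c10) w10 min_wt4_lb.
  + by move=> C dC mC; rewrite /G9 (golay_nb_wt _ c9) w9 min_wt3_lb.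
  + by move=> C dC mC; rewrite /G8 (golay_nb_wt _ c8) w8 min_wt2_lb.
- move=> m F iota _ _; split.
  + exact: (golay_dual_lift_nb_wt7 _ n10 c10).
  + exact: (golay_dual_lift_nb_wt7 _ n9 c9).
  + exact: (golay_dual_lift_nb_wt7 _ n8 c8).
Qed.
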